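(* Let $N\ge2$ and $\alpha\in(-1,+\infty)$. Then $$\mu_1^\alpha(\mathbb{S}^{N-1}_+)=N+\alpha-1.$$
   Context: $\mathbb{S}^{N-1}$ is the unit sphere of $\mathbb{R}^N$, $\mathbb{S}^{N-1}_+=\{\zeta\in\mathbb{S}^{N-1}:\zeta_N>0\}$, $d\sigma$ is the standard surface measure, $d\sigma_\alpha=\zeta_N^\alpha\,d\sigma$ on $\mathbb{S}^{N-1}_+$, and $\nabla_{\mathbb{S}}$ is the gradient on the sphere. $W^{1,2}(\mathbb{S}^{N-1}_+;d\sigma_\alpha)$ is the closure of $C^\infty(\mathbb{S}^{N-1}_+)$ under the norm given by $\|u\|^2=\|u\|^2_{L^2(\mathbb{S}^{N-1}_+;d\sigma_\alpha)}+\|\nabla_{\mathbb{S}}u\|^2_{L^2(\mathbb{S}^{N-1}_+;d\sigma_\alpha)}$. Let $\theta_1\in(0,\pi/2)$ be the polar angle on $\mathbb{S}^{N-1}_+$, i.e. $\zeta_N=\cos\theta_1$, let $\Delta_{\mathbb{S}^{N-2}}$ be the Laplace–Beltrami operator on $\mathbb{S}^{N-2}$ (acting in the remaining angular variables), and $$\Delta^\alpha_{\mathbb{S}^{N-1}}u=\frac{1}{\sin^{N-2}\theta_1}\frac{\partial}{\partial\theta_1}\left(\sin^{N-2}\theta_1\cos^\alpha\theta_1\frac{\partial u}{\partial\theta_1}\right)+\frac{\cos^\alpha\theta_1}{\sin^2\theta_1}\Delta_{\mathbb{S}^{N-2}}u.$$ $\mu_1^\alpha(\mathbb{S}^{N-1}_+)$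 is the first non-trivial (Neumann) eigenvalue of the problem $-\Delta^\alpha_{\mathbb{S}^{N-1}}u=\mu\cos^\alpha\theta_1\,u$ on $\mathbb{S}^{N-1}_+$, $\int_{\mathbb{S}^{N-1}_+}u\,d\sigma_\alpha=0$; it has the variational characterization $$\mu_1^\alpha(\mathbb{S}^{N-1}_+)=\min\left\{\frac{\int_{\mathbb{S}^{N-1}_+}|\nabla_{\mathbb{S}}u|^2\,d\sigma_\alpha}{\int_{\mathbb{S}^{N-1}_+}u^2\,d\sigma_\alpha}:\ u\in W^{1,2}(\mathbb{S}^{N-1}_+;d\sigma_\alpha)\setminus\{0\},\ \int_{\mathbb{S}^{N-1}_+}u\,d\sigma_\alpha=0\right\}.$$ *)

(* Defs.v *)
From HB Require Import structures.
From mathcomp Require Import all_boot all_order all_algebra.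
From mathcomp Require Import all_classical all_reals all_analysis.
From mathcomp Require Import measurable_realfun.

Set Implicit Arguments.
Unset Strict Implicit.
Unset Printing Implicit Defensive.

Import Order.TTheory GRing.Theory Num.Theory.
Import numFieldNormedType.Exports.

Local Open Scope classical_set_scope.
Local Open Scope ring_scope.

Section row_measurable.
Context {R : realType} (n : nat).

Let coord (i : 'I_n) (x : 'rV[R]_n) : R := x ord0 i.

Let row_set0 : g_sigma_preimage coord set0.
Proof. exact: sigma_algebra0. Qed.

Let row_setC A : g_sigma_preimage coord A -> g_sigma_preimage coord (~` A).
Proof. exact: sigma_algebraC. Qed.

Let row_bigcup (F : _^nat) : (forall i, g_sigma_preimage coord (F i)) ->
  g_sigma_preimage coord (\bigcup_i (F i)).
Proof. exact: sigma_algebra_bigcup. Qed.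

(* The sigma-algebra generated by the coordinate functions, that is, the Borel
   sigma-algebra of R^n. *)
HB.instance Definition _ := @isMeasurable.Build default_measure_display
  'rV[R]_n (g_sigma_preimage coord) row_set0 row_setC row_bigcup.

End row_measurable.

Lemma measurable_coord (R : realType) n (i : 'I_n) :
  measurable_fun [set: 'rV[R]_n] (fun x : 'rV[R]_n => x ord0 i).
Proof.
move=> _ Y mY; rewrite setTI; apply: sub_sigma_algebra => /=.
rewrite -bigcup_seq/=; exists i => /=; first by rewrite mem_index_enum.
by exists Y => //; rewrite setTI.
Qed.

Lemma measurable_fun_rowP (R : realType) d (T : measurableType d) n
    (D : set T) (f : T -> 'rV[R]_n) : measurable D ->
  (forall i, measurable_fun D (fun t => f t ord0 i)) -> measurable_fun D f.
Proof.
move=> mD mf _ Y mY.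
have mD' A : measurable A -> measurable (D `&` A) by exact: measurableI.
suff : [set B | measurable (D `&` f @^-1` B)] Y by [].
move: Y mY; apply: smallest_sub.
  split => /=.
  - by rewrite preimage_set0 setI0.
  - move=> A mA; rewrite setTD preimage_setC.
    rewrite (_ : _ `&` _ = D `\` (D `&` f @^-1` A)); first exact: measurableD.
    by rewrite setDIr setDv set0U.
  - move=> F mF; rewrite preimage_bigcup setI_bigcupr.
    exact: bigcup_measurable.
move=> B; rewrite -bigcup_seq => -[i _ [C mC <-]] /=.
rewrite setTI -[X in _ `&` X]/((fun t => f t ord0 i) @^-1` C).
exact: mf.
Qed.

Section lebesgue_row.
Context {R : realType}.

Definition rowcons n (p : measurableTypeR R * 'rV[R]_n) : 'rV[R]_n.+1 :=
  \row_i (if unlift ord0 i is Some j then p.2 ord0 j else p.1).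

Lemma measurable_rowcons n : measurable_fun setT (@rowcons n).
Proof.
apply: measurable_fun_rowP => // i.
rewrite /rowcons; under eq_fun do rewrite mxE.
case: unliftP => [j _|_].
  exact: measurableT_comp (measurable_coord j) measurable_snd.
exact: measurable_fst.
Qed.

Section cons_measure.
Context n (m : {sigma_finite_measure set 'rV[R]_n -> \bar R}).

Definition cons_measure : set 'rV[R]_n.+1 -> \bar R :=
  pushforward (@lebesgue_measure R \x m)%E (@rowcons n).

Let cons_measure0 : cons_measure set0 = 0%E.
Proof. by rewrite /cons_measure /pushforward preimage_set0 measure0. Qed.

Let cons_measure_ge0 A : (0 <= cons_measure A)%E.
Proof. by rewrite /cons_measure /pushforward measure_ge0. Qed.

Let cons_measure_sigma_additive : semi_sigma_additive cons_measure.
Proof.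
have mP (A : set 'rV[R]_n.+1) : measurable A -> measurable (@rowcons n @^-1` A).
  by move=> mA; rewrite -[X in measurable X]setTI; exact: measurable_rowcons.
move=> F mF tF mUF; rewrite /cons_measure /pushforward preimage_bigcup.
apply: measure_semi_sigma_additive.
- by move=> k; exact: mP.
- apply/trivIsetP => /= i j _ _ ij; rewrite -preimage_setI.
  by move/trivIsetP : tF => /(_ _ _ _ _ ij) ->//; rewrite preimage_set0.
- by rewrite -preimage_bigcup; exact: mP.
Qed.

HB.instance Definition _ := isMeasure.Build _ _ _ cons_measure
  cons_measure0 cons_measure_ge0 cons_measure_sigma_additive.

Let cons_measure_sigma_finite : sigma_finite setT cons_measure.
Proof.
have /sigma_finiteP[/= F' [TF ndF Foo]] := sigma_finiteT (@lebesgue_measure R).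
have /sigma_finiteP[/= G' [TG ndG Goo]] := sigma_finiteT m.
pose tl (x : 'rV[R]_n.+1) : 'rV[R]_n := \row_j x ord0 (lift ord0 j).
have mtl : measurable_fun setT tl.
  apply: measurable_fun_rowP => // i; rewrite /tl.
  by under eq_fun do rewrite mxE; exact: measurable_coord.
pose H k := (fun x : 'rV[R]_n.+1 => x ord0 ord0) @^-1` F' k `&` tl @^-1` G' k.
exists H.
  apply/esym/seteqP; split=> // x _.
  have [i _ Fi] : (\bigcup_k F' k) (x ord0 ord0) by rewrite -TF.
  have [j _ Gj] : (\bigcup_k G' k) (tl x) by rewrite -TG.
  exists (maxn i j) => //; split.
  - suff : F' i `<=` F' (maxn i j) by exact.
    exact/subsetPset/ndF/leq_maxl.
  - suff : G' j `<=` G' (maxn i j) by exact.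
    exact/subsetPset/ndG/leq_maxr.
move=> k; have [mFk Fk] := Foo k; have [mGk Gk] := Goo k; split.
  apply: measurableI; rewrite -[X in measurable X]setTI.
    exact: (measurable_coord ord0).
  exact: mtl.
rewrite /cons_measure /pushforward (_ : _ @^-1` _ = F' k `*` G' k).
  by rewrite product_measure1E// lte_mul_pinfty// ge0_fin_numE.
have tlK p : tl (@rowcons n p) = p.2.
  by apply/rowP => j; rewrite !mxE liftK.
apply/seteqP; split => -[a b] /=; rewrite /H /= tlK mxE unlift_none //=.
Qed.

HB.instance Definition _ := Measure_isSigmaFinite.Build _ _ _ cons_measure
  cons_measure_sigma_finite.

End cons_measure.

Fixpoint lebesgue_row n : {sigma_finite_measure set 'rV[R]_n -> \bar R} :=
  match n with
  | 0 => [the {sigma_finite_measure set 'rV[R]_0 -> \bar R} of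
             \d_(0 : 'rV[R]_0)]
  | n'.+1 => [the {sigma_finite_measure set 'rV[R]_n'.+1 -> \bar R} of
                 cons_measure (lebesgue_row n')]
  end.

End lebesgue_row.

Section sphere.
Context {R : realType}.

Definition dot n (x y : 'rV[R]_n) : R := \sum_i x ord0 i * y ord0 i.

(* Euclidean norm; the norm `|x| of 'rV[R]_n is the max norm. *)
Definition enorm n (x : 'rV[R]_n) : R := Num.sqrt (dot x x).

Definition sphere_proj n (x : 'rV[R]_n) : 'rV[R]_n := (enorm x)^-1 *: x.

(* The open upper half of the sphere S^n of R^(n+1). *)
Definition hemisphere n : set 'rV[R]_n.+1 :=
  [set z | enorm z = 1 /\ 0 < z ord0 ord_max].

Lemma measurable_enorm n : measurable_fun setT (@enorm n).
Proof.
apply: (measurableT_comp (f := @Num.sqrt R)).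
  exact: continuous_measurable_fun (@sqrt_continuous R).
by apply: measurable_sum => i; apply: measurable_funM; exact: measurable_coord.
Qed.

Lemma measurable_sphere_proj n : measurable_fun setT (@sphere_proj n).
Proof.
apply: measurable_fun_rowP => // i; rewrite /sphere_proj.
under eq_fun do rewrite mxE -powR_inv1 ?sqrtr_ge0//.
apply: measurable_funM; last exact: measurable_coord.
exact: measurableT_comp (measurable_powR _) (@measurable_enorm n).
Qed.

Definition punctured_ball n : set 'rV[R]_n := [set x | 0 < enorm x <= 1].

Lemma measurable_punctured_ball n : measurable (@punctured_ball n).
Proof.
rewrite (_ : @punctured_ball n = (setT `&` @enorm n @^-1` `]0, 1])%classic).
  by apply: measurable_enorm => //; exact: measurable_itv.
by rewrite setTI; apply/seteqP; split => x /=; rewrite in_itv.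
Qed.

(* Surface measure of the unit sphere of R^n: sigma(A) is n times the volume of
   the cone {r z | 0 < r <= 1, z in A}. *)
Definition surface_measure n (A : set 'rV[R]_n) : \bar R :=
  (n%:R%:E * lebesgue_row n (@punctured_ball n `&` @sphere_proj n @^-1` A))%E.

Section surface_measure_instance.
Variable n : nat.

Let m := mscale n%:R%:nng (mrestr (lebesgue_row n) (@measurable_punctured_ball n)).

Let surface_measureE A : @surface_measure n A = pushforward m (@sphere_proj n) A.
Proof. by rewrite /surface_measure /pushforward /m /mscale /mrestr /= setIC. Qed.

Let surface_measure0 : @surface_measure n set0 = 0%E.
Proof. by rewrite /surface_measure preimage_set0 setI0 measure0 mule0. Qed.

Let surface_measure_ge0 A : (0 <= @surface_measure n A)%E.
Proof. by rewrite /surface_measure mule_ge0. Qed.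

Let surface_measure_sigma_additive : semi_sigma_additive (@surface_measure n).
Proof.
have mP (A : set 'rV[R]_n) : measurable A -> measurable (@sphere_proj n @^-1` A).
  by move=> mA; rewrite -[X in measurable X]setTI; exact: measurable_sphere_proj.
move=> F mF tF mUF; rewrite surface_measureE /pushforward preimage_bigcup.
under eq_fun do under eq_bigr do rewrite surface_measureE.
apply: measure_semi_sigma_additive.
- by move=> k; exact: mP.
- apply/trivIsetP => /= i j _ _ ij; rewrite -preimage_setI.
  by move/trivIsetP : tF => /(_ _ _ _ _ ij) ->//; rewrite preimage_set0.
- by rewrite -preimage_bigcup; exact: mP.
Qed.

HB.instance Definition _ := isMeasure.Build _ _ _ (@surface_measure n)
  surface_measure0 surface_measure_ge0 surface_measure_sigma_additive.

End surface_measure_instance.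
End sphere.

Section calculus.
Context {R : realType}.

Definition iter_partial n (s : seq 'I_n) (f : 'rV[R]_n -> R) : 'rV[R]_n -> R :=
  foldr (fun i g => 'D_(delta_mx ord0 i) g) f s.

Definition smooth_on n (U : set 'rV[R]_n) (f : 'rV[R]_n -> R) :=
  forall s x, U x -> differentiable (iter_partial s f) x.

(* Functions on (a part of) the sphere are represented by functions on the whole
   space, of which only the values on the sphere matter; differential operators
   of the sphere are those of the extension that is homogeneous of degree 0. *)
Definition hext n (u : 'rV[R]_n -> R) : 'rV[R]_n -> R :=
  fun x => u (sphere_proj x).

Definition smooth_hemisphere n (u : 'rV[R]_n.+1 -> R) :=
  smooth_on [set x | 0 < x ord0 ord_max] (hext u).

Definition grad_sphere n (u : 'rV[R]_n -> R) (z : 'rV[R]_n) : 'rV[R]_n :=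
  \row_i 'D_(delta_mx ord0 i) (hext u) z.

Definition laplacian_sphere n (u : 'rV[R]_n -> R) (z : 'rV[R]_n) : R :=
  \sum_i 'D_(delta_mx ord0 i) ('D_(delta_mx ord0 i) (hext u)) z.

(* The point (sin t * w, cos t) of S^n, for w in S^(n-1). *)
Definition polar n (t : R) (w : 'rV[R]_n) : 'rV[R]_n.+1 :=
  \row_i (if unlift ord_max i is Some j then sin t * w ord0 j else cos t).

(* Delta^alpha on S^n at the point of polar angle t and direction w. *)
Definition weighted_laplacian n (alpha : R) (u : 'rV[R]_n.+1 -> R)
    (t : R) (w : 'rV[R]_n) : R :=
  (sin t ^+ n.-1)^-1 *
    derive1 (fun s => sin s ^+ n.-1 * cos s `^ alpha *
                      derive1 (fun r => u (polar r w)) s) t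
  + cos t `^ alpha / sin t ^+ 2 * laplacian_sphere (fun v => u (polar t v)) w.

End calculus.

Section eigenvalue.
Context {R : realType} (n : nat) (alpha : R).
Implicit Types (u : 'rV[R]_n.+1 -> R) (V : 'rV[R]_n.+1 -> 'rV[R]_n.+1).

(* Integration over the upper half of S^n against dsigma_alpha. *)
Definition wint (f : 'rV[R]_n.+1 -> R) : \bar R :=
  (\int[@surface_measure R n.+1]_(z in @hemisphere R n)
     (f z * z ord0 ord_max `^ alpha)%:E)%E.

(* Squared norms of L^2(dsigma_alpha) *)
Definition sqnorm (f : 'rV[R]_n.+1 -> R) : \bar R := wint (fun z => f z ^+ 2).

Definition sqnormv V : \bar R := wint (fun z => dot (V z) (V z)).

(* [sobolev u V] means that u belongs to W^{1,2}, with gradient V: (u, V) is the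
   limit in L^2 of (w_k, grad w_k) for smooth w_k. *)
Definition sobolev u V :=
  [/\ measurable_fun (@hemisphere R n) u, measurable_fun (@hemisphere R n) V,
      (sqnorm u < +oo)%E, (sqnormv V < +oo)%E &
      exists w : nat -> 'rV[R]_n.+1 -> R,
      [/\ forall k, smooth_hemisphere (w k),
          sqnorm (fun z => w k z - u z) @[k --> \oo] --> 0%E &
          sqnormv (fun z => grad_sphere (w k) z - V z) @[k --> \oo] --> 0%E]].

Definition nontrivial_mean0 u := sqnorm u <> 0%E /\ wint u = 0%E.

(* The equation holds pointwise; the Neumann condition is the natural one: there
   is no boundary term in Green's formula against functions of W^{1,2}. *)
Definition neumann_eigenfunction (mu : R) u :=
  [/\ smooth_hemisphere u, sobolev u (grad_sphere u), nontrivial_mean0 u,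
      forall (t : R) (w : 'rV[R]_n), 0 < t < pi / 2 -> enorm w = 1 ->
        - weighted_laplacian alpha u t w = mu * cos t `^ alpha * u (polar t w) &
      forall v V, sobolev v V ->
        wint (fun z => dot (grad_sphere u z) (V z)) =
        (mu%:E * wint (fun z => u z * v z)%R)%E].

Definition neumann_eigenvalues : set R :=
  [set mu | exists u, neumann_eigenfunction mu u].

Definition rayleigh_quotients : set R :=
  [set r | exists u V, [/\ sobolev u V, nontrivial_mean0 u &
                           r = fine (sqnormv V) / fine (sqnorm u)]].

End eigenvalue.

Definition is_min (R : realType) (A : set R) (m : R) := A m /\ lbound A m.

(* mu is the first nontrivial Neumann eigenvalue of the upper half of S^n. *)
Definition is_mu1 (R : realType) (n : nat) (alpha mu : R) :=
  is_min (neumann_eigenvalues n alpha) mu.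

(* Main.v *)
(* The substitution u -> |x| u(x/|x|) turns the spectral gap of the hemisphere into
   the Gaussian Poincare inequality with constant 1 on the half-space x_last > 0,
   for the weight x_last^alpha exp(-|x|^2/2). The latter holds on each line and
   tensorizes. In one variable, if psi is increasing, vanishes at x0 and solves
   -(m psi')' = lam m psi, then F = (m psi'/lam) (g - g x0)^2/psi satisfies
   F' <= m (g'^2/lam - (g - g x0)^2) on both sides of x0; take psi = x, lam = 1
   for the Gaussian and psi = x^2 - (1 + alpha), lam = 2 for
   x^alpha exp(-x^2/2) on (0, +oo).
   For f = |x| (w(x/|x|) - c) with c the mean of w, |grad f|^2 is
   (w - c)^2 + |grad_S w|^2 at x/|x|, while the second moment gives
   int |x|^2 k(x/|x|) = (N + alpha) int k(x/|x|); the Poincare inequality becomes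
   (N + alpha) int (w - c)^2 <= int (w - c)^2 + |grad_S w|^2.
   Equality holds for the first coordinate, which is therefore a minimizer of the
   Rayleigh quotient and solves the weak eigenvalue equation. *)

From HB Require Import structures.
Require Import Defs.
From mathcomp Require Import all_boot all_order all_algebra.
From mathcomp Require Import all_classical all_reals all_analysis.
From mathcomp Require Import measurable_realfun ring lra.
Import Order.TTheory GRing.Theory Num.Theory.
Import numFieldNormedType.Exports.
Set Implicit Arguments.
Unset Strict Implicit.
Unset Printing Implicit Defensive.
Local Open Scope classical_set_scope.
Local Open Scope ring_scope.

(** * One-dimensional inequalities *)

(** The sphere has no product structure, the Gaussian weight has one: this is the gain of the
    passage to the half-space. The passage costs nothing because the extremal function on the sphere
    is the restriction of a linear function; extension with degree 1 gives that linear function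
    back, and it is extremal for the Gaussian inequality with constant 1. The weighted coordinate
    has the better gap 2, so it does not spoil that constant. In one variable g is compared with its
    value at x0, not with its mean. Since x0 does not depend on g, the same x0 serves for all
    sections, and the first variable can be eliminated by subtracting one function of the others.
    The weight degenerates or blows up at x_last = 0. No boundary term arises there, because F has
    the sign of psi at the ends of every segment around x0. The polar formula is available for
    nonnegative integrands only, so signed means are carried over through positive and negative
    parts. The minimizer is explicit, hence no compactness argument occurs; smooth functions yield
    W^{1,2} by approximation. *)

Lemma is_derive_continuous (R : realType) (f : R -> R) (x df : R) :
  is_derive x 1 f df -> {for x, continuous f}.
Proof.
by move=> [d _]; apply/differentiable_continuous/derivable1_diffP.
Qed.

Lemma within_itv_continuous (R : realType) (f : R -> R) (a b : R) :
  (forall x, x \in `[a, b] -> {for x, continuous f}) ->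
  {within `[a, b], continuous f}.
Proof.
by move=> cf; apply: continuous_in_subspaceT => x /set_mem/= /cf.
Qed.

Lemma continuous_sqr (R : realType) (T : topologicalType) (f : T -> R) (x : T) :
  {for x, continuous f} -> {for x, continuous (fun y => f y ^+ 2)}.
Proof. by move=> cf; apply: (cvgM cf cf). Qed.

Section ground_state_1d.
Context {R : realType}.
Variables (a b x0 lam : R) (g g' m psi psi' kap k : R -> R).
Let mu := @lebesgue_measure R.
Hypothesis ax0 : a < x0.
Hypothesis x0b : x0 < b.
Hypothesis lam0 : 0 < lam.
Hypothesis dg : forall x, x \in `[a, b] -> is_derive x 1 g (g' x).
Hypothesis cg' : forall x, x \in `[a, b] -> {for x, continuous g'}.
Hypothesis cm : forall x, x \in `[a, b] -> {for x, continuous m}.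
Hypothesis m0 : forall x, x \in `[a, b] -> 0 <= m x.
Hypothesis dpsi : forall x, x \in `[a, b] -> is_derive x 1 psi (psi' x).
Hypothesis psi'0 : forall x, x \in `[a, b] -> 0 < psi' x.
(** [kE] and [dk] together express -(m psi')' = lam m psi. The flux [k] is named separately because
    [m] is only assumed continuous. *)
Hypothesis kE : forall x, x \in `[a, b] -> k x = m x * psi' x / lam.
Hypothesis dk : forall x, x \in `[a, b] -> is_derive x 1 k (- psi x * m x).
Hypothesis psiE : forall x, x \in `[a, b] -> psi x = (x - x0) * kap x.
Hypothesis kap0 : forall x, x \in `[a, b] -> 0 < kap x.
Hypothesis ckap : forall x, x \in `[a, b] -> {for x, continuous kap}.

Let G x := m x * (g' x ^+ 2 / lam) - m x * (g x - g x0) ^+ 2.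
Let P x := (\int[mu]_(t in `[a, x]) G t)%R.
Let F x := k x * (g x - g x0) ^+ 2 / psi x.

Let x0ab : x0 \in `[a, b]. Proof. by rewrite in_itv/= !ltW. Qed.

Let oo_cc x : x \in `]a, b[ -> x \in `[a, b].
Proof. by rewrite !in_itv/= => /andP[? ?]; rewrite !ltW. Qed.

Let psi_neq0 x : x \in `[a, b] -> x != x0 -> psi x != 0.
Proof. by move=> xab xx0; rewrite psiE// mulf_neq0 ?subr_eq0// gt_eqF// kap0. Qed.

Let dF x : x \in `[a, b] -> x != x0 -> is_derive x 1 F
  (2 * k x * (g x - g x0) * g' x / psi x - m x * (g x - g x0) ^+ 2
    - k x * psi' x * (g x - g x0) ^+ 2 / psi x ^+ 2).
Proof.
move=> xab xx0; have psix := psi_neq0 xab xx0.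
have dkx := dk xab; have dgx := dg xab; have dpx := dpsi xab.
have dpVx := is_deriveV psix dpx.
rewrite /F; apply: is_derive_eq.
rewrite /GRing.scale/=.
by field.
Qed.

Let cg x : x \in `[a, b] -> {for x, continuous g}.
Proof. by move=> /dg/is_derive_continuous. Qed.

(** At [x0] the quotient [F] is 0 by the convention for the inverse of 0. This is also its limit: g
    - g x0 = h (x - x0) by Caratheodory, and one factor x - x0 cancels against psi = (x - x0)
    kap. *)
Let cFx0 : F x @[x --> x0] --> F x0.
Proof.
have /is_derive1_caratheodory[h [hE ch h0]] := dg x0ab.
have Fx0 : F x0 = 0 by rewrite /F psiE// !subrr mul0r invr0 mulr0.
have <- : k x0 * (g x0 - g x0) * h x0 / kap x0 = F x0.
  by rewrite Fx0 subrr mulr0 !mul0r.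
suff ch' : {for x0, continuous (fun x => k x * (g x - g x0) * h x / kap x)}.
  apply: cvg_trans ch'.
  apply: near_eq_cvg; near=> x.
    have xab : x \in `[a, b].
      apply: oo_cc; near: x; apply: near_in_itvoo.
      by rewrite in_itv/= ax0.
    have [->|xx0] := eqVneq x x0; first by rewrite Fx0 !subrr mulr0 !mul0r.
    have xx0' : x - x0 != 0 by rewrite subr_eq0.
    rewrite /F hE psiE//.
    have : kap x != 0 by rewrite gt_eqF// kap0.
    by move=> ?; field; apply/andP.
apply: cvgM; last by apply: cvgV; [rewrite gt_eqF// kap0|exact: ckap].
apply: cvgM; last exact: ch.
apply: cvgM; first exact: (is_derive_continuous (dk x0ab)).
by apply: cvgB; [exact: cg|exact: cvg_cst].
Unshelve. all: by end_near. Qed.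

Let cm1 x : x \in `[a, b] ->
  {for x, continuous (fun x => m x * (g' x ^+ 2 / lam))}.
Proof.
move=> xab; apply: cvgM; first exact: cm.
by apply: cvgM; [apply: continuous_sqr; exact: cg'|exact: cvg_cst].
Qed.

Let cm2 x : x \in `[a, b] ->
  {for x, continuous (fun x => m x * (g x - g x0) ^+ 2)}.
Proof.
move=> xab; apply: cvgM; first exact: cm.
apply: (@continuous_sqr _ _ (fun x => g x - g x0)).
by apply: cvgB; [exact: cg|exact: cvg_cst].
Qed.

Let cG x : x \in `[a, b] -> {for x, continuous G}.
Proof. by move=> xab; apply: cvgB; [exact: cm1|exact: cm2]. Qed.

Let intG : mu.-integrable `[a, b] (EFin \o G).
Proof.
apply: continuous_compact_integrable; first exact: segment_compact.
exact: within_itv_continuous.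
Qed.

Let ab : a < b. Proof. exact: lt_trans x0b. Qed.

Let D x := P x - F x.

Let cD : {within `[a, b], continuous D}.
Proof.
have cF : {within `[a, b], continuous F}.
  apply: within_itv_continuous => x xab.
  by have [->//|xx0] := eqVneq x x0; exact: (is_derive_continuous (dF xab xx0)).
have cP : {within `[a, b], continuous P}.
  by apply: parameterized_integral_continuous => //; exact: ltW.
by move=> x; apply: cvgB; [exact: cP|exact: cF].
Qed.

Let dD x : x \in `]a, b[ -> x != x0 ->
  derivable D x 1 /\ 0 <= derive1 D x.
Proof.
move=> xab xx0; have xab' := oo_cc xab.
have [dP P'] : derivable P x 1 /\ derive1 P x = G x.
  move: xab; rewrite in_itv/= => /andP[ax xb].
  by apply: (@continuous_FTC1_closed _ G a x b) => //; exact: cG.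
have [dFx F'] := dF xab' xx0.
split; first exact: derivableB.
rewrite derive1E deriveB// F' -derive1E P' /G kE//.
have psix := psi_neq0 xab' xx0.
set u := g x - g x0.
(* The integrand minus F' is a perfect square, which vanishes when g - g x0 is proportional to
   psi. *)
have -> : m x * (g' x ^+ 2 / lam) - m x * u ^+ 2 -
   (2 * (m x * psi' x / lam) * u * g' x / psi x -
    m x * u ^+ 2 -
    m x * psi' x / lam * psi' x * u ^+ 2 / psi x ^+ 2) =
   m x / lam * (g' x - psi' x * u / psi x) ^+ 2.
  by field; rewrite psix gt_eqF.
by rewrite mulr_ge0 ?sqr_ge0// divr_ge0 ?m0// ltW.
Qed.

(** [D] is nondecreasing on both sides of [x0], so P b >= F b - F a. As psi changes sign at [x0], F
    a <= 0 <= F b, whatever g does at the endpoints. *)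
Lemma ground_state_1d :
  (\int[mu]_(x in `[a, b]) (m x * (g x - g x0) ^+ 2)%:E <=
   \int[mu]_(x in `[a, b]) (m x * (g' x ^+ 2 / lam))%:E)%E.
Proof.
have Dax0 : D a <= D x0.
  apply: (@ger0_derive1_le_cc _ D a x0) => //; rewrite ?in_itv/= ?lexx ?ltW//.
  - move=> x; rewrite in_itv/= => /andP[ax xx0].
    by apply: (dD _ _).1; rewrite ?in_itv/= ?ax ?(lt_trans xx0)// lt_eqF.
  - move=> x; rewrite in_itv/= => /andP[ax xx0].
    by apply: (dD _ _).2; rewrite ?in_itv/= ?ax ?(lt_trans xx0)// lt_eqF.
  - by apply: continuous_subspaceW cD; apply: subset_itvl; rewrite bnd_simp ltW.
have Dx0b : D x0 <= D b.
  apply: (@ger0_derive1_le_cc _ D x0 b) => //; rewrite ?in_itv/= ?lexx ?ltW//.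
  - move=> x; rewrite in_itv/= => /andP[x0x xb].
    by apply: (dD _ _).1; rewrite ?in_itv/= ?xb ?(lt_trans _ x0x)// gt_eqF.
  - move=> x; rewrite in_itv/= => /andP[x0x xb].
    by apply: (dD _ _).2; rewrite ?in_itv/= ?xb ?(lt_trans _ x0x)// gt_eqF.
  - by apply: continuous_subspaceW cD; apply: subset_itvr; rewrite bnd_simp ltW.
have aab : a \in `[a, b] by rewrite in_itv/= lexx ltW.
have bab : b \in `[a, b] by rewrite in_itv/= lexx ltW.
have k0 x : x \in `[a, b] -> 0 <= k x.
  by move=> xab; rewrite kE// divr_ge0 ?(ltW lam0)// mulr_ge0 ?m0// ltW// psi'0.
have Fa : F a <= 0.
  apply: mulr_ge0_le0; first by rewrite mulr_ge0 ?sqr_ge0 ?k0.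
  rewrite invr_le0 psiE//; apply: mulr_le0_ge0; first by rewrite subr_le0 ltW.
  by rewrite ltW ?kap0.
have Fb : 0 <= F b.
  apply: divr_ge0; first by rewrite mulr_ge0 ?sqr_ge0 ?k0.
  by rewrite psiE// mulr_ge0// ?subr_ge0 ?ltW// kap0.
have Pa : P a = 0 by rewrite /P set_itv1 Rintegral_set1.
have Pb : 0 <= P b.
  have := le_trans Dax0 Dx0b; rewrite /D Pa sub0r => h.
  rewrite -(subrK (F b) (P b)) addr_ge0// (le_trans _ h)//.
  by rewrite oppr_ge0.
have i1 : mu.-integrable `[a, b]
    (EFin \o (fun x => m x * (g' x ^+ 2 / lam))).
  apply: continuous_compact_integrable; first exact: segment_compact.
  exact: within_itv_continuous.
have i2 : mu.-integrable `[a, b]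
    (EFin \o (fun x => m x * (g x - g x0) ^+ 2)).
  apply: continuous_compact_integrable; first exact: segment_compact.
  exact: within_itv_continuous.
move: Pb; rewrite /P RintegralB// subr_ge0 => h.
rewrite -[leLHS]fineK; last exact: integrable_fin_num i2.
rewrite -[leRHS]fineK; last exact: integrable_fin_num i1.
by rewrite lee_fin.
Qed.
End ground_state_1d.

(** Monotone convergence carries inequalities from segments to the line and the half-line; either
    side may be infinite. *)
Lemma le_integral_bigcup d (T : measurableType d) (R : realType)
    (mu : {measure set T -> \bar R}) (A : (set T)^nat) (f h : T -> \bar R) :
    nondecreasing_seq A -> (forall n, measurable (A n)) ->
    measurable_fun (\bigcup_n A n) f -> measurable_fun (\bigcup_n A n) h ->
    (forall x, (\bigcup_n A n) x -> 0 <= f x)%E ->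
    (forall x, (\bigcup_n A n) x -> 0 <= h x)%E ->
    (forall n, \int[mu]_(x in A n) f x <= \int[mu]_(x in A n) h x)%E ->
  (\int[mu]_(x in \bigcup_n A n) f x <= \int[mu]_(x in \bigcup_n A n) h x)%E.
Proof.
move=> ndA mA mf mh f0 h0 fh.
have mU : measurable (\bigcup_n A n) by exact: bigcup_measurable.
have sub n : A n `<=` \bigcup_n A n by exact: bigcup_sup.
have mfA n : measurable_fun (A n) f by exact: measurable_funS (sub n) mf.
have f0A n x : A n x -> (0 <= f x)%E by move=> /sub/f0.
have cf := ge0_nondecreasing_set_cvg_integral (mu := mu) ndA mA mfA f0A.
rewrite -(cvg_lim _ cf)//; apply: lime_le; first by apply/cvg_ex; eexists; exact: cf.
apply: nearW => n; apply: le_trans (fh n) _.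
exact: ge0_subset_integral.
Qed.

Section weighted_hardy.
Context {R : realType}.
Let mu := @lebesgue_measure R.

Definition gauss (x : R) := expR (- (x ^+ 2 / 2)).

Lemma is_derive_gauss (x : R) : is_derive x 1 gauss (- x * gauss x).
Proof.
apply: is_derive_eq; rewrite /GRing.scale/= /gauss.
by field.
Qed.

Lemma continuous_gauss : continuous gauss.
Proof. by move=> x; exact: is_derive_continuous (is_derive_gauss x). Qed.

Lemma hardy_gauss (g g' : R -> R) :
  (forall x : R, is_derive x 1 g (g' x)) -> continuous g' ->
  (\int[mu]_x ((g x - g 0) ^+ 2 * gauss x)%:E <=
   \int[mu]_x (g' x ^+ 2 * gauss x)%:E)%E.
Proof.
move=> dg cg'.
have cg : continuous g by move=> x; exact: is_derive_continuous (dg x).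
pose A n : set R := `[- n.+1%:R, n.+1%:R]%classic.
have -> : [set: R] = \bigcup_n A n.
  apply/esym; rewrite -subTset => x _; exists (Num.truncn `|x|) => //.
  rewrite /A/= in_itv/= -ler_norml; apply: ltW.
  exact: truncnS_gt.
have ndA : nondecreasing_seq A.
  move=> i j ij; apply/subsetPset/subset_itv; rewrite bnd_simp ?lerN2 ler_nat//.
apply: le_integral_bigcup => //.
- by move=> n; exact: measurable_itv.
- apply: measurable_funTS; apply/measurable_EFinP; apply: continuous_measurable_fun.
  move=> x; apply: cvgM; last exact: continuous_gauss.
  apply: (@continuous_sqr _ _ (fun x => g x - g 0)).
  by apply: cvgB; [exact: cg|exact: cvg_cst].
- apply: measurable_funTS; apply/measurable_EFinP; apply: continuous_measurable_fun.
  by move=> x; apply: cvgM; [apply: continuous_sqr; exact: cg'|exact: continuous_gauss].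
- by move=> x _; rewrite lee_fin mulr_ge0 ?sqr_ge0// expR_ge0.
- by move=> x _; rewrite lee_fin mulr_ge0 ?sqr_ge0// expR_ge0.
move=> n.
have := @ground_state_1d R (- n.+1%:R) n.+1%:R 0 1 g g' gauss id (cst 1) (cst 1) gauss.
rewrite oppr_lt0 ltr0Sn.
under eq_integral do rewrite mulrC.
under [leRHS]eq_integral do rewrite mulrC divr1.
apply => //.
- by move=> x _; exact: cg'.
- by move=> x _; exact: continuous_gauss.
- by move=> x _; exact: expR_ge0.
- by move=> x _ /=; rewrite mulr1 divr1.
- by move=> x _ /=; exact: is_derive_gauss.
- by move=> x _ /=; rewrite subr0 mulr1.
- by move=> x _; exact: cst_continuous.
Qed.

Variables (alpha : R).
Hypothesis alpha1 : -1 < alpha.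

Definition half_gauss (x : R) := x `^ alpha * gauss x.

Lemma is_derive_powR_gauss (a x : R) : 0 < x ->
  is_derive x 1 (fun y => y `^ (a + 1) * gauss y)
    ((a + 1) * (x `^ a * gauss x) - x `^ (a + 2) * gauss x).
Proof.
move=> x0; have := is_derive1_powR (a + 1) x0 => dp.
have dg := is_derive_gauss x.
apply: is_derive_eq; rewrite /GRing.scale/= addrK.
have -> : x `^ (a + 2) = x * x `^ (a + 1).
  by rewrite -[X in X * _]powRr1 ?ltW// -powRD ?(gt_eqF x0) ?implybT//; congr (_ `^ _); ring.
by ring.
Qed.

Lemma continuous_half_gauss x : 0 < x -> {for x, continuous half_gauss}.
Proof.
move=> x0; apply: cvgM; last exact: continuous_gauss.
exact: is_derive_continuous (is_derive1_powR alpha x0).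
Qed.

Lemma hardy_half_gauss (g g' : R -> R) :
  (forall x : R, 0 < x -> is_derive x 1 g (g' x)) ->
  (forall x : R, 0 < x -> {for x, continuous g'}) ->
  (\int[mu]_(x in `]0%R, +oo[)
      ((g x - g (Num.sqrt (alpha + 1))) ^+ 2 * half_gauss x)%:E <=
   \int[mu]_(x in `]0%R, +oo[) (g' x ^+ 2 * half_gauss x)%:E)%E.
Proof.
move=> dg cg'; pose x0 : R := Num.sqrt (alpha + 1); rewrite -/x0.
have x00 : 0 < x0 by rewrite sqrtr_gt0 -ltrBlDr sub0r alpha1.
have x02 : x0 ^+ 2 = alpha + 1 by rewrite sqr_sqrtr// ltW// -ltrBlDr sub0r.
have cg x : 0 < x -> {for x, continuous g}.
  by move=> x_gt0; exact: is_derive_continuous (dg _ x_gt0).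
have oy (x : R) : `]0%R, +oo[%classic x -> 0 < x by rewrite /= in_itv/= andbT.
(* [x0] must be interior to every segment, so the left endpoints are fractions of [x0] and the right
   ones lie beyond it. *)
pose A n : set R := `[x0 / n.+2%:R, x0 + n.+1%:R]%classic.
have A0 n x : x \in `[x0 / n.+2%:R, x0 + n.+1%:R] -> 0 < x.
  by rewrite in_itv/= => /andP[h _]; apply: lt_le_trans h; rewrite divr_gt0.
have UE : `]0%R, +oo[%classic = \bigcup_n A n.
  apply/seteqP; split => [x /oy x_gt0|x [n _ /A0]]; last by rewrite /= in_itv/= andbT.
  exists (maxn (Num.truncn x) (Num.truncn (x0 / x))) => //.
  rewrite /A/= in_itv/=; set k := maxn _ _.
  apply/andP; split.
    rewrite ler_pdivrMr// mulrC -ler_pdivrMr//.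
    apply/ltW/(lt_le_trans (truncnS_gt _)); rewrite ler_nat.
    by apply: leq_trans (leqnSn _); rewrite ltnS leq_maxr.
  apply/ltW/(lt_le_trans (truncnS_gt _)).
  by rewrite -[leLHS]add0r lerD ?(ltW x00)// ler_nat ltnS leq_maxl.
have ndA : nondecreasing_seq A.
  move=> i j ij; apply/subsetPset/subset_itv; rewrite bnd_simp.
    by rewrite ler_pM2l// lef_pV2 ?posrE// ler_nat !ltnS.
  by rewrite lerD2l ler_nat ltnS.
have mA n : measurable (A n) by exact: measurable_itv.
have UA x : (\bigcup_n A n) x -> 0 < x by move=> [n _ /A0].
have AU n : A n `<=` `]0%R, +oo[ by move=> x /A0; rewrite /= in_itv/= andbT.
have mfU (f : R -> R) : (forall x : R, 0 < x -> {for x, continuous f}) ->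
    measurable_fun (`]0%R, +oo[%classic : set R) (EFin \o f).
  move=> cf; apply/measurable_EFinP; apply: open_continuous_measurable_fun => //.
  by move=> x /set_mem/oy; exact: cf.
have h0 x : 0 <= half_gauss x by rewrite mulr_ge0 ?powR_ge0 ?expR_ge0.
rewrite UE; apply: le_integral_bigcup => //; rewrite -?UE.
- apply: mfU => x x_gt0; apply: cvgM; last exact: continuous_half_gauss.
  apply: (@continuous_sqr _ _ (fun x => g x - g x0)).
  by apply: cvgB; [exact: cg|exact: cvg_cst].
- apply: mfU => x x_gt0; apply: cvgM; last exact: continuous_half_gauss.
  by apply: continuous_sqr; exact: cg'.
- by move=> x _; rewrite lee_fin mulr_ge0 ?sqr_ge0.
- by move=> x _; rewrite lee_fin mulr_ge0 ?sqr_ge0.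
move=> n.
have := @ground_state_1d R (x0 / n.+2%:R) (x0 + n.+1%:R) x0 2 g g' half_gauss
  (fun x => x ^+ 2 - x0 ^+ 2) (fun x => 2 * x) (fun x => x + x0)
  (fun x => x `^ (alpha + 1) * gauss x).
under eq_integral do rewrite mulrC.
move=> H; apply: le_trans (H _ _ _ _ _ _ _ _ _ _ _ _ _ _) _; clear H => //.
- by rewrite ltr_pdivrMr// ltr_pMr// ltr1n.
- by rewrite ltrDl.
- by move=> x /A0; exact: dg.
- by move=> x /A0; exact: cg'.
- by move=> x /A0; exact: continuous_half_gauss.
- move=> x _; apply: is_derive_eq; rewrite /GRing.scale/= subr0.
  by ring.
- by move=> x /A0 x_gt0; rewrite mulr_gt0.
- move=> x /A0 x_gt0; rewrite powRD ?(gt_eqF x_gt0) ?implybT// powRr1 ?(ltW x_gt0)//.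
  by rewrite /half_gauss; field.
- move=> x /A0 x_gt0; apply: is_derive_eq (is_derive_powR_gauss alpha x_gt0) _.
  rewrite x02 /half_gauss powRD ?(gt_eqF x_gt0) ?implybT//.
  by rewrite powR_mulrn ?(ltW x_gt0)//; ring.
- by move=> x _; ring.
- by move=> x /A0 x_gt0; rewrite addr_gt0.
- move=> x _; apply: cvgD; [exact: cvg_id|exact: cvg_cst].
(* The eigenvalue 2 yields half of the right-hand side. The constant is relaxed to 1, that of the
   Gaussian factors it will be combined with. *)
apply: ge0_le_integral => //.
- by move=> x _; rewrite lee_fin mulr_ge0// divr_ge0 ?sqr_ge0.
- apply: measurable_funS (mfU (fun x => half_gauss x * (g' x ^+ 2 / 2)) _) => //; first exact: (AU n).
  move=> x x_gt0; apply: cvgM; first exact: continuous_half_gauss.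
  by apply: cvgM; [apply: continuous_sqr; exact: cg'|exact: cvg_cst].
- apply: measurable_funS (mfU (fun x => g' x ^+ 2 * half_gauss x) _) => //; first exact: (AU n).
  move=> x x_gt0; apply: cvgM; last exact: continuous_half_gauss.
  by apply: continuous_sqr; exact: cg'.
- move=> x _; rewrite lee_fin mulrC ler_wpM2r// ler_pdivrMr//.
  by rewrite ler_peMr ?sqr_ge0// ler1n.
Qed.

End weighted_hardy.

Lemma gt0_integral d (T : measurableType d) (R : realType)
    (mu : {measure set T -> \bar R}) (D : set T) (f : T -> \bar R) :
    measurable D -> (0 < mu D)%E -> measurable_fun D f ->
    (forall x, D x -> 0 < f x)%E -> (0 < \int[mu]_(x in D) f x)%E.
Proof.
move=> mD D0 mf f0; have f0' x : D x -> (0 <= f x)%E by move=> /f0/ltW.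
rewrite lt0e integral_ge0// andbT; apply/eqP.
have -> : (\int[mu]_(x in D) f x = \int[mu]_(x in D) `|f x|)%E.
  by apply: eq_integral => x /set_mem /f0' ?; rewrite gee0_abs.
move=> /(ae_eq_integral_abs _ mD mf) [N [mN N0 DN]].
suff : (mu D <= mu N)%E by rewrite N0 leNgt D0.
apply: le_measure; rewrite ?inE// => x Dx; apply: DN => /= /(_ Dx) fx.
by have := f0 _ Dx; rewrite fx ltxx.
Qed.

(** * Moments of x^a exp(-x^2/2) *)

Section moments.
Context {R : realType}.
Let mu := @lebesgue_measure R.
Local Notation I0y := (`]0%R, +oo[%classic : set R).

Let oy (x : R) : I0y x -> 0 < x. Proof. by rewrite /= in_itv/= andbT. Qed.

Lemma continuous_powR_gauss (a x : R) :
  0 < x -> {for x, continuous (fun y => y `^ a * gauss y)}.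
Proof. exact: continuous_half_gauss. Qed.

Lemma measurable_powR_gauss (a : R) (A : set R) :
  measurable_fun A (EFin \o (fun y => y `^ a * gauss y)).
Proof.
apply/measurable_EFinP; apply: measurable_funM.
  by apply: measurable_funTS; exact: measurable_powR.
apply: measurable_funTS; apply: continuous_measurable_fun.
exact: continuous_gauss.
Qed.

Lemma powR_gauss_ge0 (a x : R) : 0 <= x `^ a * gauss x.
Proof. by rewrite mulr_ge0 ?powR_ge0 ?expR_ge0. Qed.

(** From ln x < x, the exponent b ln x - x^2/2 is at most b x - x^2/2, and completing the square at
    b + 1 bounds this by (b + 1)^2/2 - x. *)
Let powR_gauss_le (b x : R) : 0 <= b -> 0 < x ->
  x `^ b * gauss x <= expR ((b + 1) ^+ 2 / 2) * expR (- x).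
Proof.
move=> b0 x0; rewrite /powR gt_eqF// /gauss -!expRD ler_expR.
have := ler_wpM2l b0 (ltW (ln_sublinear x0)).
have : 0 <= (x - (b + 1)) ^+ 2 by exact: sqr_ge0.
set l := b * ln x; rewrite sqrrB => h1 h2.
by lra.
Qed.

Let powR_gauss_cvg0 (b : R) : 0 <= b ->
  (fun n : nat => n.+1%:R `^ b * gauss n.+1%:R) @ \oo --> 0.
Proof.
move=> b0.
apply: (@squeeze_cvgr _ _ _ _ (cst 0)
  (fun n : nat => expR ((b + 1) ^+ 2 / 2) * expR (- n.+1%:R))).
- apply: nearW => n; rewrite powR_gauss_ge0/=.
  exact: powR_gauss_le.
- exact: cvg_cst.
- rewrite -[X in _ --> X](mulr0 (expR ((b + 1) ^+ 2 / 2))).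
  apply: cvgM; first exact: cvg_cst.
  have h : (fun n : nat => (n.+1%:R : R)) @ \oo --> +oo.
    by rewrite (cvg_shiftS (fun n : nat => (n%:R : R))); exact: cvgr_idn.
  exact: cvg_comp h (@cvgr_expR R).
Qed.

Let moment_ltpos (b : R) : 0 <= b ->
  (\int[mu]_(x in I0y) (x `^ b * gauss x)%:E < +oo)%E.
Proof.
move=> b0.
apply: (@le_lt_trans _ _
  (\int[mu]_(x in I0y) (expR ((b + 1) ^+ 2 / 2) * expR (- x))%:E)%E).
  apply: ge0_le_integral => //.
  - by move=> x _; rewrite lee_fin powR_gauss_ge0.
  - exact: measurable_powR_gauss.
  - apply: measurable_funTS; apply/measurable_EFinP; apply: continuous_measurable_fun.
    move=> x; apply: cvgM; first exact: cvg_cst.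
    by apply: continuous_comp; [exact: opp_continuous|exact: continuous_expR].
  - by move=> x /oy x0; rewrite lee_fin powR_gauss_le.
under eq_integral do rewrite EFinM.
have cexpN : continuous (fun x : R => expR (- x)).
  by move=> x; apply: continuous_comp; [exact: opp_continuous|exact: continuous_expR].
have mexpN (A : set R) : measurable_fun A (fun x : R => (expR (- x))%:E).
  apply: measurable_funTS; apply/measurable_EFinP; exact: continuous_measurable_fun.
rewrite ge0_integralZl ?lee_fin ?expR_ge0//; last exact: mexpN.
rewrite lte_mul_pinfty ?lee_fin ?expR_ge0//.
rewrite integral_itv_obnd_cbnd//.
rewrite (@ge0_continuous_FTC2y R _ (fun x => - expR (- x)) 0 0).
- by rewrite -EFinB ltry.
- by move=> x _; exact: expR_ge0.
- exact: continuous_subspaceT.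
- rewrite -oppr0; apply: cvgN; exact: cvgr_expR.
- by move=> x _; apply: ex_derive.
- apply: cvg_at_right_filter; apply: cvgN; exact: cexpN.
- move=> x _; rewrite derive1E.
  have h : is_derive x (1:R) (fun x : R => - expR (- x)) (expR (- x)).
    by apply: is_derive_eq; rewrite /GRing.scale/= mulrN1 opprK.
  by case: h.
Qed.

(** Integration by parts with x^(a+1) exp(-x^2/2); the boundary term at 0 disappears because a + 1 >
    0. *)
Lemma moment_rec (a : R) : -1 < a ->
  (\int[mu]_(x in I0y) (x `^ (a + 2) * gauss x)%:E =
   (a + 1)%:E * \int[mu]_(x in I0y) (x `^ a * gauss x)%:E)%E.
Proof.
move=> a1.
(* With [n.+2] on the left the segment is nondegenerate already at n = 0. *)
pose A n : set R := `[n.+2%:R^-1, n.+1%:R]%classic.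
have A0 n x : x \in `[n.+2%:R^-1, n.+1%:R] -> 0 < x.
  by rewrite in_itv/= => /andP[h _]; apply: lt_le_trans h; rewrite invr_gt0.
have An n : n.+2%:R^-1 < n.+1%:R :> R.
  by apply: (@lt_le_trans _ _ 1); rewrite ?invf_lt1 ?ltr1n// ler1n.
have UE : I0y = \bigcup_n A n.
  apply/seteqP; split => [x /oy x0|x [n _ /A0]]; last by rewrite /= in_itv/= andbT.
  exists (maxn (Num.truncn x) (Num.truncn x^-1)) => //.
  rewrite /A/= in_itv/=; set k := maxn _ _; apply/andP; split.
    rewrite -[leRHS]invrK lef_pV2 ?posrE ?invr_gt0//.
    apply/ltW/(lt_le_trans (truncnS_gt _)); rewrite ler_nat.
    by apply: leq_trans (leqnSn _); rewrite ltnS leq_maxr.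
  apply/ltW/(lt_le_trans (truncnS_gt _)).
  by rewrite ler_nat ltnS leq_maxl.
have ndA : nondecreasing_seq A.
  move=> i j ij; apply/subsetPset/subset_itv; rewrite bnd_simp.
    by rewrite lef_pV2 ?posrE// ler_nat !ltnS.
  by rewrite ler_nat ltnS.
have mA n : measurable (A n : set (measurableTypeR R)) by exact: measurable_itv.
have cvgA b : (\int[mu]_(x in A n) (x `^ b * gauss x)%:E)%E @[n --> \oo] -->
    (\int[mu]_(x in I0y) (x `^ b * gauss x)%:E)%E.
  rewrite UE; apply: ge0_nondecreasing_set_cvg_integral => //.
    by move=> n; exact: measurable_powR_gauss.
  by move=> n x _; rewrite lee_fin powR_gauss_ge0.
have iA b n : mu.-integrable (A n) (EFin \o (fun x => x `^ b * gauss x)).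
  apply: continuous_compact_integrable; first exact: segment_compact.
  by apply: within_itv_continuous => x /A0; exact: continuous_powR_gauss.
pose F x : R := x `^ (a + 1) * gauss x.
have FTC n : (\int[mu]_(x in A n) (x `^ (a + 2) * gauss x)%:E =
    (a + 1)%:E * \int[mu]_(x in A n) (x `^ a * gauss x)%:E
     + (F n.+2%:R^-1 - F n.+1%:R)%:E)%E.
  have := @continuous_FTC2 R
    (fun x => (a + 1) * (x `^ a * gauss x) - x `^ (a + 2) * gauss x) F _ _ (An n).
  under eq_integral do rewrite EFinB EFinM.
  rewrite integralB//; [|by apply: integrableZl => //; exact: iA|exact: iA].
  rewrite integralZl//; last exact: iA.
  have /fineK <- := integrable_fin_num (mA n) (iA (a + 2) n).
  have /fineK <- := integrable_fin_num (mA n) (iA a n).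
  move=> H; rewrite -EFinM -EFinD; congr (_%:E).
  suff /H : {within `[n.+2%:R^-1, n.+1%:R], continuous
      (fun x => (a + 1) * (x `^ a * gauss x) - x `^ (a + 2) * gauss x)}.
    have dF (x : R) : 0 < x -> derivable F x 1 by move=> /(is_derive_powR_gauss a)[].
    have cF x : 0 < x -> {for x, continuous F} by exact: continuous_powR_gauss.
    have n2 : 0 < n.+2%:R^-1 :> R by rewrite invr_gt0.
    have n1 : 0 < n.+1%:R :> R by [].
    have oF : derivable_oo_LRcontinuous F n.+2%:R^-1 n.+1%:R.
      split.
      - by move=> x; rewrite in_itv/= => /andP[h _]; apply/dF/(lt_trans _ h).
      - by apply: cvg_at_right_filter; exact: cF.
      - by apply: cvg_at_left_filter; exact: cF.
    move=> /(_ oF) h.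
    have {h} /h : {in `]n.+2%:R^-1, n.+1%:R[, derive1 F =1
        (fun x : R => (a + 1) * (x `^ a * gauss x) - x `^ (a + 2) * gauss x)}.
      move=> x; rewrite in_itv/= => /andP[nx _].
      by have [_] := is_derive_powR_gauss a (lt_trans n2 nx); rewrite derive1E.
    rewrite -!EFinM -!EFinB => -[h]; lra.
  apply: within_itv_continuous => x /A0 x0; apply: cvgB.
    by apply: cvgM; [exact: cvg_cst|exact: continuous_powR_gauss].
  exact: continuous_powR_gauss.
have a10 : 0 < a + 1 by rewrite -ltrBlDr sub0r.
have F0 : F n.+2%:R^-1 - F n.+1%:R @[n --> \oo] --> (0 : R).
  rewrite -[X in _ --> X]subr0; apply: cvgB; last exact: powR_gauss_cvg0 (ltW a10).
  apply: (@squeeze_cvgr _ _ _ _ (cst 0) (fun n : nat => n.+2%:R^-1 `^ (a + 1))).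
  - apply: nearW => k; rewrite powR_gauss_ge0/= ler_piMr ?powR_ge0//.
    by rewrite -expR0 ler_expR oppr_le0 divr_ge0 ?sqr_ge0.
  - exact: cvg_cst.
  have /cvg_at_rightP := powR_cvg0 a10; apply; split; first by move=> k; rewrite invr_gt0.
  by rewrite (cvg_shiftS (fun n : nat => n.+1%:R^-1 : R)); exact: cvg_harmonic.
rewrite -(cvg_lim _ (cvgA (a + 2)))//; apply/cvg_lim => //.
under eq_fun do rewrite FTC.
rewrite -[((a + 1)%:E * _)%E]adde0; apply: cvgeD.
- by rewrite fin_num_adde_defl.
- by apply: cvgeZl => //; exact: cvgA.
- by apply: cvg_EFin; [exact: nearW|exact: F0].
Qed.

(** For a < 0 the singularity at 0 is not estimated: the moment of order a + 2 is finite by the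
    exponential bound, and by [moment_rec] it is a positive multiple of the moment of order a. *)
Lemma moment_fin (a : R) : -1 < a ->
  (\int[mu]_(x in I0y) (x `^ a * gauss x)%:E < +oo)%E.
Proof.
move=> a1; have := @moment_ltpos (a + 2); rewrite moment_rec// => h.
have {h} /h : 0 <= a + 2 by lra.
have : (0 <= \int[mu]_(x in I0y) (x `^ a * gauss x)%:E)%E.
  by apply: integral_ge0 => x _; rewrite lee_fin powR_gauss_ge0.
case: (\int[mu]_(x in I0y) (x `^ a * gauss x)%:E)%E => [r||] //=; first by move=> _ _; exact: ltry.
by move=> _; rewrite gt0_muley// lte_fin -ltrBlDr sub0r.
Qed.

Lemma moment_gt0 (a : R) :
  (0 < \int[mu]_(x in I0y) (x `^ a * gauss x)%:E)%E.
Proof.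
apply: gt0_integral => //.
- suff : (0 < mu I0y)%E by [].
  by rewrite /mu lebesgue_measure_itv/= ltry sube0 ltry.
- exact: measurable_powR_gauss.
- by move=> x /oy x0; rewrite lte_fin mulr_gt0 ?powR_gt0 ?expR_gt0.
Qed.

Lemma gauss_even_integral (f : R -> R) :
    (forall x, 0 <= f x) -> continuous f -> (forall x, f (- x) = f x) ->
  (\int[mu]_x (f x * gauss x)%:E = 2%:E * \int[mu]_(x in I0y) (f x * gauss x)%:E)%E.
Proof.
move=> f0 cf fN.
have c : continuous (fun x => f x * gauss x).
  by move=> x; apply: cvgM; [exact: cf|exact: continuous_gauss].
rewrite ge0_symfun_integralT//.
- rewrite -set_itvcy integral_itv_obnd_cbnd//.
  by apply: measurable_funTS; apply/measurable_EFinP; exact: continuous_measurable_fun.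
- by move=> x; rewrite mulr_ge0 ?expR_ge0.
- by move=> x /=; rewrite fN /gauss sqrrN.
Qed.

Lemma gauss_integralE :
  (\int[mu]_x (gauss x)%:E = 2%:E * \int[mu]_(x in I0y) (x `^ 0 * gauss x)%:E)%E.
Proof.
under eq_integral do rewrite -[gauss _]mul1r.
rewrite (@gauss_even_integral (cst 1))//; last by move=> x; exact: cst_continuous.
by under [in RHS]eq_integral do rewrite powRr0.
Qed.

Lemma gauss_integral_fin : (\int[mu]_x (gauss x)%:E < +oo)%E.
Proof.
by rewrite gauss_integralE lte_mul_pinfty// ?lee_fin// moment_fin// ltrN10.
Qed.

Lemma gauss_integral_gt0 : (0 < \int[mu]_x (gauss x)%:E)%E.
Proof. by rewrite gauss_integralE mule_gt0// moment_gt0. Qed.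

Lemma gauss_moment2 :
  (\int[mu]_x (x ^+ 2 * gauss x)%:E = \int[mu]_x (gauss x)%:E)%E.
Proof.
rewrite gauss_integralE (@gauss_even_integral (fun x => x ^+ 2)).
- congr (_ * _)%E; have := @moment_rec 0.
  rewrite !add0r mul1e => <-; last exact: ltrN10.
  by apply: eq_integral => x /set_mem/oy/ltW x0; rewrite powR_mulrn.
- by move=> x; exact: sqr_ge0.
- exact: exprn_continuous.
- by move=> x; rewrite sqrrN.
Qed.

Lemma integral_oppr (f : R -> \bar R) :
  measurable_fun (setT : set (measurableTypeR R)) f -> (forall x, 0 <= f x)%E ->
  (\int[mu]_x f (- (x : R))%R = \int[mu]_x f x)%E.
Proof.
move=> mf f0.
have mN : measurable_fun (setT : set (measurableTypeR R))
  (-%R : R -> measurableTypeR R) by exact: oppr_measurable.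
rewrite -[LHS](@ge0_integral_pushforward _ _ _ _ R _ mN mu setT f)//.
by apply: eq_measure_integral => A mA _; exact: lebesgue_measureN.
Qed.

End moments.

(** * Weighted integrals and tensorization *)

Section weighted.
Context d (T : measurableType d) (R : realType).
Variables (mu : {measure set T -> \bar R}) (D : set T) (rho : T -> R).
Implicit Types f g : T -> R.

Definition wI f : \bar R := (\int[mu]_(x in D) (f x * rho x)%:E)%E.
(** [fine] sends infinite integrals to 0, so [wE] is meaningful under [wL1]; [wIE] then converts
    between the two. *)
Definition wE f : R := fine (wI f).
Definition wL1 f := mu.-integrable D (fun x => (f x * rho x)%:E).
Definition wL2 f := measurable_fun D f /\ (wI (fun x => f x ^+ 2)%R < +oo)%E.

Hypothesis mD : measurable D.
Hypothesis mrho : measurable_fun D rho.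
Hypothesis rho0 : forall x, D x -> 0 <= rho x.

Lemma eq_wI f g : {in D, f =1 g} -> wI f = wI g.
Proof. by move=> fg; apply: eq_integral => x xD; rewrite fg. Qed.

Lemma wI_ge0 f : (forall x, D x -> 0 <= f x) -> (0 <= wI f)%E.
Proof.
by move=> f0; apply: integral_ge0 => x Dx; rewrite lee_fin mulr_ge0 ?f0 ?rho0.
Qed.

Lemma measurable_weighted f : measurable_fun D f ->
  measurable_fun D (fun x => (f x * rho x)%:E).
Proof. by move=> mf; apply/measurable_EFinP; exact: measurable_funM. Qed.

Lemma le_wI f g : measurable_fun D f -> measurable_fun D g ->
  (forall x, D x -> 0 <= f x <= g x) -> (wI f <= wI g)%E.
Proof.
move=> mf mg fg; apply: ge0_le_integral => //.
- by move=> x Dx; have /andP[f0 _] := fg _ Dx; rewrite lee_fin mulr_ge0 ?rho0.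
- exact: measurable_weighted.
- exact: measurable_weighted.
- by move=> x Dx; have /andP[_ fgx] := fg _ Dx; rewrite lee_fin ler_wpM2r ?rho0.
Qed.

Lemma ge0_wID f g : measurable_fun D f -> measurable_fun D g ->
  (forall x, D x -> 0 <= f x) -> (forall x, D x -> 0 <= g x) ->
  wI (fun x => f x + g x) = (wI f + wI g)%E.
Proof.
move=> mf mg f0 g0; rewrite /wI -ge0_integralD//.
- by apply: eq_integral => x _; rewrite mulrDl EFinD.
- by move=> x Dx; rewrite lee_fin mulr_ge0 ?f0 ?rho0.
- exact: measurable_weighted.
- by move=> x Dx; rewrite lee_fin mulr_ge0 ?g0 ?rho0.
- exact: measurable_weighted.
Qed.

Lemma ge0_wIZ k f : measurable_fun D f -> (forall x, D x -> 0 <= f x) -> 0 <= k ->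
  wI (fun x => k * f x) = (k%:E * wI f)%E.
Proof.
move=> mf f0 k0; rewrite /wI -ge0_integralZl_EFin//.
- by apply: eq_integral => x _; rewrite -mulrA EFinM.
- by move=> x Dx; rewrite lee_fin mulr_ge0 ?f0 ?rho0.
- exact: measurable_weighted.
Qed.

Lemma wL1_ge0 f : measurable_fun D f -> (forall x, D x -> 0 <= f x) ->
  (wI f < +oo)%E -> wL1 f.
Proof.
move=> mf f0 foo; apply/integrableP; split; first exact: measurable_weighted.
rewrite (_ : (\int[mu]_(x in D) _)%E = wI f)//.
apply: eq_integral => x /set_mem Dx; rewrite gee0_abs// lee_fin.
by rewrite mulr_ge0 ?f0 ?rho0.
Qed.

Lemma wIE f : wL1 f -> wI f = (wE f)%:E.
Proof. by move=> /(integrable_fin_num mD) h; rewrite /wE fineK. Qed.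

Lemma wL1D f g : wL1 f -> wL1 g -> wL1 (fun x => f x + g x).
Proof.
move=> lf lg; rewrite /wL1; under eq_fun do rewrite mulrDl EFinD.
exact: integrableD.
Qed.

Lemma wL1Z k f : wL1 f -> wL1 (fun x => k * f x).
Proof.
move=> lf; rewrite /wL1; under eq_fun do rewrite -mulrA EFinM.
exact: integrableZl.
Qed.

Lemma wL1B f g : wL1 f -> wL1 g -> wL1 (fun x => f x - g x).
Proof.
move=> lf lg; rewrite /wL1; under eq_fun do rewrite mulrBl EFinB.
exact: integrableB.
Qed.

Lemma wED f g : wL1 f -> wL1 g -> wE (fun x => f x + g x) = wE f + wE g.
Proof.
move=> lf lg; rewrite /wE -fineD ?integrable_fin_num// /wI -integralD//.
by congr fine; apply: eq_integral => x _; rewrite mulrDl EFinD.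
Qed.

Lemma wEB f g : wL1 f -> wL1 g -> wE (fun x => f x - g x) = wE f - wE g.
Proof.
move=> lf lg; rewrite /wE -fineB ?integrable_fin_num// /wI -integralB//.
by congr fine; apply: eq_integral => x _; rewrite mulrBl EFinB.
Qed.

Lemma wEZ k f : wL1 f -> wE (fun x => k * f x) = k * wE f.
Proof.
move=> lf; rewrite /wE -[k in RHS]/(fine k%:E) -fineM ?integrable_fin_num//.
rewrite /wI -integralZl//.
by congr fine; apply: eq_integral => x _; rewrite -mulrA EFinM.
Qed.

Lemma wE_ge0 f : (forall x, D x -> 0 <= f x) -> 0 <= wE f.
Proof. by move=> f0; rewrite fine_ge0 ?wI_ge0. Qed.

Lemma wL2_sqr f : wL2 f -> wL1 (fun x => f x ^+ 2).
Proof.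
move=> [mf foo]; apply: wL1_ge0 => //; first exact: measurable_funX.
by move=> x _; exact: sqr_ge0.
Qed.

Lemma wL2M f g : wL2 f -> wL2 g -> wL1 (fun x => f x * g x).
Proof.
move=> lf lg; have [[mf _] [mg _]] := (lf, lg).
have := wL1D (wL2_sqr lf) (wL2_sqr lg).
apply: le_integrable => //; first by apply: measurable_weighted; exact: measurable_funM.
move=> x Dx; rewrite !abse_EFin lee_fin !normrM ler_wpM2r// [leRHS]ger0_norm ?addr_ge0 ?sqr_ge0//.
have : 0 <= (`|f x| - `|g x|) ^+ 2 by exact: sqr_ge0.
rewrite sqrrB !real_normK ?num_real// -mulr_natl => h.
have hf := sqr_ge0 (f x); have hg := sqr_ge0 (g x).
set p := `|f x| * `|g x| in h *; set u := f x ^+ 2 in h hf *.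
set v := g x ^+ 2 in h hg *. lra.
Qed.

Lemma wL2D f g : wL2 f -> wL2 g -> wL2 (fun x => f x + g x).
Proof.
move=> lf lg; have [[mf _] [mg _]] := (lf, lg).
split; first exact: measurable_funD.
under eq_wI do rewrite sqrrD -mulr_natl.
rewrite wIE ?ltry//.
apply: wL1D; last exact: wL2_sqr.
apply: wL1D; first exact: wL2_sqr.
by apply: wL1Z; exact: wL2M.
Qed.

Lemma wL2Z k f : wL2 f -> wL2 (fun x => k * f x).
Proof.
move=> lf; have [mf _] := lf; split; first exact: measurable_funM.
under eq_wI do rewrite exprMn.
by rewrite wIE ?ltry//; apply: wL1Z; exact: wL2_sqr.
Qed.

Lemma wL2B f g : wL2 f -> wL2 g -> wL2 (fun x => f x - g x).
Proof.
move=> lf lg; under eq_fun do rewrite -mulN1r.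
by apply: wL2D => //; exact: wL2Z.
Qed.

Hypothesis fin1 : (wI (fun=> 1%R) < +oo)%E.

Lemma wL2_cst k : wL2 (fun=> k).
Proof.
split; first exact: measurable_cst.
under eq_wI do rewrite -[_ ^+ 2]mulr1.
rewrite wIE ?ltry//; apply: wL1Z; apply: wL1_ge0 => //.
Qed.

Lemma wL2_L1 f : wL2 f -> wL1 f.
Proof.
move=> lf; have := wL2M lf (wL2_cst 1).
by under [X in wL1 X]eq_fun do rewrite mulr1.
Qed.

Lemma wE_sqrB f k : wL2 f ->
  wE (fun x => (f x - k) ^+ 2) =
  wE (fun x => f x ^+ 2) - 2 * k * wE f + k ^+ 2 * wE (fun=> 1).
Proof.
move=> lf; under [X in wE X]eq_fun => x.
  rewrite (_ : _ ^+ 2 = f x ^+ 2 - 2 * k * f x + k ^+ 2 * 1); last by ring.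
  over.
have l1 := wL2_L1 (wL2_cst 1); have lf1 := wL2_L1 lf.
rewrite wED//; last 2 first.
- by apply: wL1B; [exact: wL2_sqr|exact: wL1Z].
- exact: wL1Z.
rewrite wEB//; first by rewrite !wEZ.
- exact: wL2_sqr.
- exact: wL1Z.
Qed.

Lemma wL2_max f : wL2 f -> wL2 (fun x => Num.max (f x) 0).
Proof.
move=> [mf foo]; have mm : measurable_fun D (fun x => Num.max (f x) 0).
  exact: measurable_maxr.
split => //; apply: le_lt_trans foo; apply: le_wI; [exact: measurable_funX..|].
move=> x _; rewrite sqr_ge0/=; have [fx|fx] := leP (f x) 0; last by [].
by rewrite expr0n sqr_ge0.
Qed.

(** This brings signed means within reach of the Tonelli and polar formulas, which are stated for
    nonnegative functions. *)
Lemma wE_maxB f : wL2 f ->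
  wE f = wE (fun x => Num.max (f x) 0) - wE (fun x => Num.max (- f x) 0).
Proof.
move=> lf; have lN : wL2 (fun x => - f x).
  by under eq_fun do rewrite -mulN1r; exact: wL2Z.
rewrite -wEB; [|exact/wL2_L1/wL2_max..].
congr wE; apply/funext => x; have [fx|fx] := leP (f x) 0.
  by rewrite max_l ?oppr_ge0// sub0r opprK.
by rewrite max_r ?oppr_le0 ?(ltW fx)// subr0.
Qed.

Hypothesis gt1 : (0 < wI (fun=> 1%R))%E.

Lemma wE1_gt0 : 0 < wE (fun=> 1).
Proof. by rewrite /wE fine_gt0 ?gt1. Qed.

(* Pythagoras for the three constants closest to a, to b and to a - b. *)
Lemma wE_sqrB_compare f g k : wL2 f -> wL2 (fun x => f x - g x) -> wL1 g ->
  wE (fun x => (f x - wE g / wE (fun=> 1)) ^+ 2) <=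
  wE (fun x => (f x - k) ^+ 2) + wE (fun x => (f x - g x) ^+ 2).
Proof.
move=> lf lfg lg.
have := wE_ge0 (f := fun x => (f x - g x - (wE f - wE g) / wE (fun=> 1)) ^+ 2).
have lf1 := wL2_L1 lf.
move=> /(_ (fun _ _ => sqr_ge0 _)); rewrite !wE_sqrB// wEB//.
have M0 := wE1_gt0; set M := wE (fun=> 1) in M0 *.
set A := wE f; set B := wE g; set S := wE (fun x => f x ^+ 2).
set P := wE _ => h.
rewrite -subr_ge0.
rewrite (_ : _ - _ = (P - 2 * ((A - B) / M) * (A - B) + ((A - B) / M) ^+ 2 * M)
  + M * (k - A / M) ^+ 2); last by field; rewrite gt_eqF.
by rewrite addr_ge0// mulr_ge0 ?sqr_ge0// ltW.
Qed.

End weighted.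

(** * Tensorization of the Poincare inequality *)

Section tensorization.
Context d1 d2 (T1 : measurableType d1) (T2 : measurableType d2) (R : realType).
Variables (m1 : {sigma_finite_measure set T1 -> \bar R})
          (m2 : {sigma_finite_measure set T2 -> \bar R}).
Variables (rho1 : T1 -> R) (rho2 : T2 -> R).
Hypothesis mrho1 : measurable_fun setT rho1.
Hypothesis mrho2 : measurable_fun setT rho2.
Hypothesis rho1_gt0 : forall x, 0 < rho1 x.
Hypothesis rho2_ge0 : forall y, 0 <= rho2 y.
Let rho (z : T1 * T2) := rho1 z.1 * rho2 z.2.
Let W := wI (m1 \x m2)%E setT rho.
Let W1 := wI m1 setT rho1.
Let W2 := wI m2 setT rho2.

Let rho1_ge0 x : 0 <= rho1 x. Proof. exact: ltW. Qed.

Let mrho : measurable_fun setT rho.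
Proof.
by apply: measurable_funM; [exact: measurableT_comp mrho1 measurable_fst|
  exact: measurableT_comp mrho2 measurable_snd].
Qed.

Let rho_ge0 z : 0 <= rho z. Proof. by rewrite mulr_ge0. Qed.

Let msec1 (h : T1 * T2 -> R) x : measurable_fun setT h ->
  measurable_fun setT (fun y => h (x, y)).
Proof. by move=> mh; exact: measurableT_comp mh (measurable_pair1 x). Qed.

Let msec2 (h : T1 * T2 -> R) y : measurable_fun setT h ->
  measurable_fun setT (fun x => h (x, y)).
Proof. by move=> mh; exact: measurableT_comp mh (measurable_pair2 y). Qed.

Let mW (h : T1 * T2 -> R) : measurable_fun setT h ->
  measurable_fun setT (fun z => (h z * rho z)%:E).
Proof. exact: measurable_weighted. Qed.

Let W2E (h : T1 * T2 -> R) x : measurable_fun setT h -> (forall z, 0 <= h z) ->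
  fubini_F m2 (fun z => (h z * rho z)%:E) x =
  (W2 (fun y => h (x, y)) * (rho1 x)%:E)%E.
Proof.
move=> mh h0; rewrite muleC /W2 /wI -ge0_integralZl_EFin//.
- by apply: eq_integral => y _; rewrite -EFinM /rho/=; congr EFin; ring.
- by move=> y _; rewrite lee_fin mulr_ge0.
- by apply: measurable_weighted => //; exact: msec1.
Qed.

Let W1E (h : T1 * T2 -> R) y : measurable_fun setT h -> (forall z, 0 <= h z) ->
  fubini_G m1 (fun z => (h z * rho z)%:E) y =
  (W1 (fun x => h (x, y)) * (rho2 y)%:E)%E.
Proof.
move=> mh h0; rewrite muleC /W1 /wI -ge0_integralZl_EFin//.
- by apply: eq_integral => x _; rewrite -EFinM /rho/=; congr EFin; ring.
- by move=> x _; rewrite lee_fin mulr_ge0.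
- by apply: measurable_weighted => //; exact: msec2.
Qed.

Lemma wI_prod1 (h : T1 * T2 -> R) : measurable_fun setT h ->
  (forall z, 0 <= h z) ->
  W h = (\int[m1]_x (W2 (fun y => h (x, y)) * (rho1 x)%:E))%E.
Proof.
move=> mh h0; rewrite /W /wI fubini_tonelli1//; last 2 first.
- exact: mW.
- by move=> z; rewrite lee_fin mulr_ge0.
by apply: eq_integral => x _; rewrite W2E.
Qed.

Lemma wI_prod2 (h : T1 * T2 -> R) : measurable_fun setT h ->
  (forall z, 0 <= h z) ->
  W h = (\int[m2]_y (W1 (fun x => h (x, y)) * (rho2 y)%:E))%E.
Proof.
move=> mh h0; rewrite /W /wI fubini_tonelli2//; last 2 first.
- exact: mW.
- by move=> z; rewrite lee_fin mulr_ge0.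
by apply: eq_integral => y _; rewrite W1E.
Qed.

Let mW2 (h : T1 * T2 -> R) : measurable_fun setT h -> (forall z, 0 <= h z) ->
  measurable_fun setT (fun x => W2 (fun y => h (x, y)) * (rho1 x)%:E)%E.
Proof.
move=> mh h0; have := measurable_fun_fubini_tonelli_F (m2 := m2) (fun z => (h z * rho z)%:E).
move=> /(_ (mW mh)) H; have {}H : measurable_fun setT (fubini_F m2 (fun z => (h z * rho z)%:E)).
  by apply: H => z; rewrite lee_fin mulr_ge0.
by apply: eq_measurable_fun H => x _; rewrite W2E.
Qed.

Let mW1 (h : T1 * T2 -> R) : measurable_fun setT h -> (forall z, 0 <= h z) ->
  measurable_fun setT (fun y => W1 (fun x => h (x, y)) * (rho2 y)%:E)%E.
Proof.
move=> mh h0; have := measurable_fun_fubini_tonelli_G (m1 := m1) (fun z => (h z * rho z)%:E).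
move=> /(_ (mW mh)) H; have {}H : measurable_fun setT (fubini_G m1 (fun z => (h z * rho z)%:E)).
  by apply: H => z; rewrite lee_fin mulr_ge0.
by apply: eq_measurable_fun H => y _; rewrite W1E.
Qed.

Let W_add (h k : T1 * T2 -> R) :
  measurable_fun setT h -> measurable_fun setT k ->
  (forall z, 0 <= h z) -> (forall z, 0 <= k z) ->
  W (fun z => h z + k z) = (W h + W k)%E.
Proof. by move=> mh mk h0 k0; rewrite /W ge0_wID. Qed.

Hypothesis m1T : (0 < m1 setT)%E.
Hypothesis W2_fin : (W2 (fun=> 1%R) < +oo)%E.
Hypothesis W2_gt0 : (0 < W2 (fun=> 1%R))%E.

Variables (f g e : T1 * T2 -> R) (x0 : T1).
Hypothesis mf : measurable_fun setT f.
Hypothesis mg : measurable_fun setT g.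
Hypothesis me : measurable_fun setT e.
Hypothesis e_ge0 : forall z, 0 <= e z.
Hypothesis f_fin : (W (fun z => f z ^+ 2)%R < +oo)%E.
(** The functions to come are differentiable over the half-space only. The other sections carry the
    weight 0. *)
Hypothesis ineq1 : forall y, 0 < rho2 y ->
  (W1 (fun x => (f (x, y) - f (x0, y)) ^+ 2)%R <= W1 (fun x => g (x, y) ^+ 2)%R)%E.
Hypothesis ineq2 : forall x, (W2 (fun y => f (x, y) ^+ 2)%R < +oo)%E ->
  exists c, (W2 (fun y => (f (x, y) - c) ^+ 2)%R <= W2 (fun y => e (x, y)))%E.

Let D z := f z - f (x0, z.2).

Let mD : measurable_fun setT D.
Proof.
apply: measurable_funB => //.
exact: (measurableT_comp (msec1 x0 mf) measurable_snd).
Qed.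

Let W_D : (W (fun z => D z ^+ 2)%R <= W (fun z => g z ^+ 2)%R)%E.
Proof.
have mg2 : measurable_fun setT (fun z => g z ^+ 2) by exact: measurable_funX.
have mD2 : measurable_fun setT (fun z => D z ^+ 2) by exact: measurable_funX.
have s0 (h : T1 * T2 -> R) z : 0 <= h z ^+ 2 by exact: sqr_ge0.
rewrite !wI_prod2//; apply: ge0_le_integral => //.
- by move=> y _; rewrite mule_ge0 ?lee_fin// wI_ge0.
- exact: (mW1 mD2 (s0 D)).
- exact: (mW1 mg2 (s0 g)).
(* Where [rho2] vanishes both integrands are 0, so [ineq1] is invoked only in its range. *)
- move=> y _; have := rho2_ge0 y; rewrite le_eqVlt => /predU1P[<-|y0].
    by rewrite !mule0.
  by rewrite lee_wpmul2r ?lee_fin//; exact: ineq1.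
Qed.

Let ae_W2 (h : T1 * T2 -> R) : measurable_fun setT h -> (W (fun z => h z ^+ 2)%R < +oo)%E ->
  {ae m1, forall x, (W2 (fun y => h (x, y) ^+ 2)%R < +oo)%E}.
Proof.
move=> mh; have mh2 : measurable_fun setT (fun z => h z ^+ 2) by exact: measurable_funX.
have h0 z : 0 <= h z ^+ 2 by exact: sqr_ge0.
rewrite wI_prod1// => hoo.
have : m1.-integrable setT (fun x => W2 (fun y => h (x, y) ^+ 2)%R * (rho1 x)%:E)%E.
  apply/integrableP; split; first exact: (mW2 mh2).
  under eq_integral => x _.
    rewrite gee0_abs; last by rewrite mule_ge0 ?lee_fin// wI_ge0.
    over.
  exact: hoo.
move=> /(integrable_ae measurableT); apply: filterS => x /(_ I).
have : (0 <= W2 (fun y => h (x, y) ^+ 2)%R)%E by rewrite wI_ge0.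
case: (W2 _) => [r _ _|_|//]; first exact: ltry.
by rewrite gt0_mulye ?lte_fin.
Qed.

(** [ineq2] gives a constant for each x, while a single one is wanted: the mean of f (x0, .). By
    [wE_sqrB_compare] the exchange costs the integral of D^2, and [ineq1] pays for it with the term
    g^2. *)
Lemma tensorize_poincare : exists c,
  (W (fun z => (f z - c) ^+ 2)%R <= W (fun z => g z ^+ 2 + e z)%R)%E.
Proof.
have mg2 : measurable_fun setT (fun z => g z ^+ 2) by exact: measurable_funX.
have s0 (h : T1 * T2 -> R) z : 0 <= h z ^+ 2 by exact: sqr_ge0.
rewrite (W_add mg2 me (s0 g) e_ge0).
have [gfin|] := boolP (W (fun z => g z ^+ 2)%R < +oo)%E; last first.
  rewrite -leNgt leye_eq => /eqP ->; exists 0.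
  have e0 : (0 <= W e)%E by exact: wI_ge0.
  by rewrite addye ?leey// -ltNye (lt_le_trans _ e0).
have aef := ae_W2 mf f_fin.
have aeD := ae_W2 mD (le_lt_trans W_D gfin).
have l2 (h : T1 * T2 -> R) x : measurable_fun setT h ->
    (W2 (fun y => h (x, y) ^+ 2)%R < +oo)%E -> wL2 m2 setT rho2 (fun y => h (x, y)).
  by move=> mh; split => //; exact: msec1.
(* The slice at [x0] itself could be exceptional for Tonelli. One x at which both f (x, .) and D (x,
   .) are square integrable shows that their difference f (x0, .) is too. *)
have [x [fx Dx]] : exists x, (W2 (fun y => f (x, y) ^+ 2)%R < +oo)%E /\
    (W2 (fun y => D (x, y) ^+ 2)%R < +oo)%E.
  have : {ae m1, forall x, (W2 (fun y => f (x, y) ^+ 2)%R < +oo)%E /\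
      (W2 (fun y => D (x, y) ^+ 2)%R < +oo)%E}.
    by near=> x; split; near: x.
  move=> [N [mN N0 sN]]; apply: contrapT => nex.
  have : (m1 setT <= m1 N)%E.
    apply: le_measure; rewrite ?inE// => x _; apply: sN => /= h.
    by apply: nex; exists x.
  by rewrite N0 leNgt m1T.
have lf0 : wL2 m2 setT rho2 (fun y => f (x0, y)).
  rewrite (_ : (fun y => f (x0, y)) = (fun y => f (x, y) - D (x, y))).
    exact: (wL2B measurableT mrho2 (fun y _ => rho2_ge0 y) (l2 _ _ mf fx) (l2 _ _ mD Dx)).
  by apply/funext => y; rewrite /D/= subKr.
have fc := wL2_L1 measurableT mrho2 (fun y _ => rho2_ge0 y) W2_fin lf0.
exists (wE m2 setT rho2 (fun y => f (x0, y)) / wE m2 setT rho2 (fun=> 1)).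
set c := _ / _.
apply: le_trans (leeD2r _ W_D).
have mD2 : measurable_fun setT (fun z => D z ^+ 2) by exact: measurable_funX.
have mfc : measurable_fun setT (fun z => (f z - c) ^+ 2).
  by apply: measurable_funX; exact: measurable_funB.
have De0 z : 0 <= D z ^+ 2 + e z by rewrite addr_ge0.
have mDe : measurable_fun setT (fun z => D z ^+ 2 + e z) by exact: measurable_funD.
rewrite -(W_add mD2 me (s0 D) e_ge0).
rewrite (wI_prod1 mfc (s0 (fun z => f z - c))) (wI_prod1 mDe De0).
apply: ae_ge0_le_integral => //.
- move=> z _; rewrite mule_ge0 ?lee_fin// wI_ge0// => y _.
  exact: (s0 (fun z => f z - c)).
- exact: (mW2 mfc (s0 (fun z => f z - c))).
- by move=> z _; rewrite mule_ge0 ?lee_fin// wI_ge0.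
- exact: (mW2 mDe De0).
apply: filterS aef => z fz _; rewrite lee_wpmul2r ?lee_fin// /W2 ge0_wID//; last 2 first.
- exact: (msec1 z mD2).
- exact: (msec1 z me).
(* On a slice where D^2 has infinite integral the right-hand side is infinite. *)
have [Dz|] := boolP (W2 (fun y => D (z, y) ^+ 2)%R < +oo)%E; last first.
  rewrite -leNgt leye_eq => /eqP; rewrite /W2 => ->.
  have e0 : (0 <= W2 (fun y => e (z, y)))%E by exact: wI_ge0.
  by rewrite addye ?leey// -ltNye (lt_le_trans _ e0).
have [k fk] := ineq2 fz.
apply: le_trans (leeD2l _ fk); rewrite addeC.
have r0 y : setT y -> 0 <= rho2 y by [].
have lf := l2 _ _ mf fz; have lD := l2 _ _ mD Dz.
have lc k' := wL2_cst measurableT mrho2 r0 W2_fin k'.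
have lk k' := wL2B measurableT mrho2 r0 lf (lc k').
have sq k' := wL2_sqr mrho2 r0 (lk k').
have sqD := wL2_sqr mrho2 r0 lD.
rewrite /W2 (wIE measurableT (sq c)) (wIE measurableT (sq k)) (wIE measurableT sqD).
rewrite -EFinD lee_fin.
exact: (wE_sqrB_compare measurableT mrho2 r0 W2_fin W2_gt0 k lf lD fc).
Unshelve. all: by end_near. Qed.
End tensorization.

(** * The Gaussian Poincare inequality on the half-space *)

Section row_integral.
Context {R : realType}.
Let mu := @lebesgue_measure R.

Lemma lift0_ord_max n : lift ord0 (@ord_max n) = ord_max.
Proof. exact/val_inj. Qed.

Lemma rowcons0 n (t : R) (y : 'rV[R]_n) : rowcons (t, y) ord0 ord0 = t.
Proof. by rewrite mxE unlift_none. Qed.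

Lemma rowcons_lift n (t : R) (y : 'rV[R]_n) j :
  rowcons (t, y) ord0 (lift ord0 j) = y ord0 j.
Proof. by rewrite mxE liftK. Qed.

Lemma rowcons_max n (t : R) (y : 'rV[R]_n.+1) :
  rowcons (t, y) ord0 ord_max = y ord0 ord_max.
Proof. by rewrite -lift0_ord_max rowcons_lift. Qed.

Lemma dot_rowcons n (t : R) (y : 'rV[R]_n) :
  dot (rowcons (t, y)) (rowcons (t, y)) = t ^+ 2 + dot y y.
Proof.
rewrite /dot big_ord_recl rowcons0 expr2; congr (_ + _).
by apply: eq_bigr => j _; rewrite rowcons_lift.
Qed.

Lemma integral_rowS n (F : 'rV[R]_n.+1 -> \bar R) :
  measurable_fun setT F -> (forall x, 0 <= F x)%E ->
  (\int[lebesgue_row n.+1]_x F x =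
   \int[mu \x lebesgue_row n]_z F (rowcons z))%E.
Proof.
move=> mF F0.
by rewrite /= /cons_measure ge0_integral_pushforward//; exact: measurable_rowcons.
Qed.

Lemma integral_row1 (F : 'rV[R]_1 -> \bar R) :
  measurable_fun setT F -> (forall x, 0 <= F x)%E ->
  (\int[lebesgue_row 1]_x F x = \int[mu]_t F (rowcons (t, 0%R)))%E.
Proof.
move=> mF F0; rewrite integral_rowS//.
rewrite (fubini_tonelli1 (fun z => F (rowcons z)))//; last first.
  exact: measurableT_comp mF (@measurable_rowcons R 0).
apply: eq_integral => t _; rewrite /fubini_F.
rewrite -[LHS]/(\int[\d_(0%R : 'rV[R]_0)]_y F (rowcons (t, y)))%E.
rewrite integral_dirac//; first by rewrite diracT mul1e.
apply: measurableT_comp mF _.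
exact: measurableT_comp (@measurable_rowcons R 0) (measurable_pair1 _).
Qed.

End row_integral.

Section gauss_space.
Context {R : realType}.
Variable alpha : R.
Hypothesis alpha1 : -1 < alpha.
Let mu := @lebesgue_measure R.

Definition halfspace n : set 'rV[R]_n.+1 := [set x | 0 < x ord0 ord_max].

Lemma measurable_halfspace n : measurable (@halfspace n).
Proof.
have := @measurable_coord R n.+1 ord_max measurableT `]0, +oo[%classic.
rewrite setTI => /(_ (measurable_itv _)).
by congr measurable; apply/seteqP; split => x /=; rewrite in_itv/= andbT.
Qed.

(** The half-space enters through an indicator, so that integrals run over the whole space and
    factor along [rowcons]. *)
Definition gweight n (x : 'rV[R]_n.+1) : R :=
  x ord0 ord_max `^ alpha * expR (- (dot x x / 2)) * \1_(@halfspace n) x.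

Lemma measurable_dot n : measurable_fun setT (fun x : 'rV[R]_n => dot x x).
Proof.
by apply: measurable_sum => i; apply: measurable_funM; exact: measurable_coord.
Qed.

Lemma measurable_gweight n : measurable_fun setT (@gweight n).
Proof.
apply: measurable_funM; last exact: measurable_indic (@measurable_halfspace n).
apply: measurable_funM.
  exact: measurableT_comp (measurable_powR _) (measurable_coord _).
apply: measurableT_comp => //; apply: measurableT_comp => //.
by apply: measurable_funM => //; exact: measurable_dot.
Qed.

Lemma gweight_ge0 n x : 0 <= @gweight n x.
Proof. by rewrite !mulr_ge0 ?powR_ge0 ?expR_ge0. Qed.

Lemma gweight_gt0 n x : (0 < @gweight n x) = (0 < x ord0 ord_max).
Proof.
apply/idP/idP => [|h]; last first.
  by rewrite !mulr_gt0 ?powR_gt0 ?expR_gt0// indicE mem_set.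
apply: contraTT => h; rewrite /gweight indicE memNset ?mulr0 ?ltxx//=.
by rewrite /halfspace/=; exact/negP.
Qed.

(** The singular coordinate is the last one and [rowcons] adds a first one: peeling off a Gaussian
    factor leaves the same weight one dimension lower, down to the half-line. *)
Lemma gweight_rowcons n t y :
  gweight (rowcons (t, y)) = gauss t * @gweight n y.
Proof.
rewrite /gweight rowcons_max dot_rowcons.
have -> : \1_(@halfspace n.+1) (rowcons (t, y)) = \1_(@halfspace n) y :> R.
  rewrite !indicE; congr (nat_of_bool _)%:R.
  by apply/idP/idP; rewrite !inE /halfspace/= rowcons_max.
by rewrite mulrDl opprD expRD /gauss; ring.
Qed.

Lemma gweight_row1 t :
  gweight (rowcons (t, 0 : 'rV[R]_0)) = half_gauss alpha t * \1_(`]0, +oo[%classic) t.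
Proof.
rewrite /gweight dot_rowcons /dot big_ord0 addr0.
have -> : (ord_max : 'I_1) = ord0 by exact/val_inj.
rewrite rowcons0; congr (_ * _); rewrite !indicE; congr (nat_of_bool _)%:R.
have E : (ord_max : 'I_1) = ord0 by exact/val_inj.
by apply/idP/idP; rewrite !inE /halfspace/= in_itv/= andbT E rowcons0.
Qed.

Notation W n := (wI (lebesgue_row n.+1) setT (@gweight n)).
Notation W1 := (wI mu setT (@gauss R)).

Let mW n (h : 'rV[R]_n.+1 -> R) : measurable_fun setT h ->
  measurable_fun setT (fun x => (h x * gweight x)%:E).
Proof. by move=> mh; apply: measurable_weighted => //; exact: measurable_gweight. Qed.

Lemma gauss_wI_row1 (h : 'rV[R]_1 -> R) : measurable_fun setT h ->
  (forall x, 0 <= h x) ->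
  W 0 h = (\int[mu]_(t in `]0%R, +oo[) (h (rowcons (t, 0%R)) * half_gauss alpha t)%:E)%E.
Proof.
move=> mh h0; rewrite /wI integral_row1//; last 2 first.
- exact: mW.
- by move=> x; rewrite lee_fin mulr_ge0 ?gweight_ge0.
rewrite [RHS]integral_mkcond; apply: eq_integral => t _.
rewrite gweight_row1 patchE indicE.
by case: ifP => _; rewrite ?mulr1// !mulr0.
Qed.

Lemma gauss_wI_rowS n (h : 'rV[R]_n.+2 -> R) : measurable_fun setT h ->
  (forall x, 0 <= h x) ->
  W n.+1 h = wI (mu \x lebesgue_row n.+1)%E setT
    (fun z => gauss z.1 * gweight z.2) (fun z => h (rowcons z)).
Proof.
move=> mh h0; rewrite /wI integral_rowS//; last 2 first.
- exact: mW.
- by move=> x; rewrite lee_fin mulr_ge0 ?gweight_ge0.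
by apply: eq_integral => -[t y] _; rewrite gweight_rowcons.
Qed.

End gauss_space.

(** For affine [phi] the two difference quotients coincide, so directional derivatives are
    transported without differentiability. *)
Lemma is_derive_line (R : realType) (V V' : normedModType R) (f : V' -> R)
    (phi : V -> V') (t w : V) (v : V') (df : R) :
  (forall h : R, phi (h *: w + t) = h *: v + phi t) ->
  is_derive (phi t) v f df -> is_derive t w (f \o phi) df.
Proof.
move=> phiE [fv <-].
have E : (fun h : R => h^-1 *: (((f \o phi) \o shift t) (h *: w) - (f \o phi) t)) =
    (fun h : R => h^-1 *: ((f \o shift (phi t)) (h *: v) - f (phi t))).
  by apply/funext => h /=; rewrite phiE.
by apply: DeriveDef; rewrite /derivable /derive E.
Qed.

Lemma rowcons_first (R : realType) n (h t : R) (y : 'rV[R]_n) :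
  rowcons (h *: (1 : R) + t, y) = h *: delta_mx ord0 ord0 + rowcons (t, y).
Proof.
apply/rowP => i; have [j ->|->] := unliftP ord0 i.
  by rewrite !mxE !liftK/= mulr0 add0r.
by rewrite !mxE !unlift_none/= ?eqxx.
Qed.

Lemma rowcons_next (R : realType) n (h t : R) (y : 'rV[R]_n) j :
  rowcons (t, h *: delta_mx ord0 j + y) =
  h *: delta_mx ord0 (lift ord0 j) + rowcons (t, y).
Proof.
apply/rowP => i; have [k ->|->] := unliftP ord0 i.
  by rewrite !mxE !liftK/= !mxE/= (inj_eq lift_inj).
by rewrite !mxE !unlift_none/= mulr0 add0r.
Qed.

Section gauss_space_poincare.
Context {R : realType}.
Variable alpha : R.
Hypothesis alpha1 : -1 < alpha.
Let mu := @lebesgue_measure R.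
Notation W n := (wI (lebesgue_row n.+1) setT (@gweight R alpha n)).
Notation W1 := (wI mu setT (@gauss R)).

Let gauss_gt0 (x : R) : 0 < gauss x. Proof. exact: expR_gt0. Qed.

Let mgauss : measurable_fun (setT : set (measurableTypeR R)) (@gauss R).
Proof. by apply: continuous_measurable_fun; exact: continuous_gauss. Qed.

Let mgw n := @measurable_gweight R alpha n.
Let gw0 n := @gweight_ge0 R alpha n.

Lemma gauss_wI_prod n (h : 'rV[R]_n.+2 -> R) : measurable_fun setT h ->
  (forall x, 0 <= h x) ->
  W n.+1 h = (\int[mu]_t (W n (fun y => h (rowcons (t, y))) * (gauss t)%:E))%E.
Proof.
move=> mh h0; rewrite gauss_wI_rowS// wI_prod1//; first exact: mgw.
exact: measurableT_comp mh (@measurable_rowcons R _).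
Qed.

Let egauss : measurable_fun (setT : set (measurableTypeR R)) (fun t => (gauss t)%:E).
Proof. exact/measurable_EFinP. Qed.

Let integral_cst_gauss (k : \bar R) : (0 <= k)%E ->
  (\int[mu]_t (k * (gauss t)%:E) = k * \int[mu]_t (gauss t)%:E)%E.
Proof.
by move=> k0; rewrite ge0_integralZl// => t _; rewrite lee_fin ltW.
Qed.

Lemma gauss_wI1_gt0_fin n : (0 < W n (fun=> 1%R) < +oo)%E.
Proof.
elim: n => [|n /andP[ih0 ihoo]].
  rewrite gauss_wI_row1//; under eq_integral do rewrite mul1r.
  by rewrite moment_gt0 moment_fin.
rewrite gauss_wI_prod// integral_cst_gauss ?ltW//.
by rewrite mule_gt0 ?gauss_integral_gt0// lte_mul_pinfty ?ltW ?gauss_integral_fin// ge0_fin_numE ?ltW.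
Qed.

(** The assumptions ask only for partial derivatives, each continuous along its own direction,
    because these pass to sections in the induction. The last coordinate is the base case and uses
    [hardy_half_gauss]; every other one uses [hardy_gauss]. *)
Lemma gauss_poincare n (f : 'rV[R]_n.+1 -> R) (g : 'I_n.+1 -> 'rV[R]_n.+1 -> R) :
  measurable_fun setT f -> (forall i, measurable_fun setT (g i)) ->
  (forall x, halfspace x -> forall i, is_derive x (delta_mx ord0 i) f (g i x)) ->
  (forall x, halfspace x -> forall i,
     {for 0, continuous (fun t : R => g i (t *: delta_mx ord0 i + x))}) ->
  (W n (fun x => f x ^+ 2)%R < +oo)%E ->
  exists c, (W n (fun x => (f x - c) ^+ 2)%R <= W n (fun x => \sum_i g i x ^+ 2)%R)%E.
Proof.
have cline (p : R -> R) (t : R) : {for 0, continuous (fun h => p (h + t))} ->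
    {for t, continuous p}.
  rewrite /prop_for /continuous_at add0r => cp.
  have E : p = (fun h => p (h + t)) \o (fun s => s - t).
    by apply/funext => s /=; rewrite subrK.
  have : (fun s : R => s - t) @ t --> t - t.
    by apply: cvgB; [exact: cvg_id|exact: cvg_cst].
  rewrite subrr => ct; rewrite {1}E.
  exact: (cvg_comp _ _ ct cp).
elim: n f g => [|n ih] f g mf mg df cg foo.
  pose x0 : R := Num.sqrt (alpha + 1).
  pose phi (t : R) : 'rV[R]_1 := rowcons (t, 0).
  have E0 (i : 'I_1) : i = ord0 by rewrite ord1.
  have hs t : 0 < t -> halfspace (phi t).
    by move=> t0; rewrite /halfspace/= (E0 ord_max) /phi rowcons0.
  have s0 (h : 'rV[R]_1 -> R) x : 0 <= h x ^+ 2 by exact: sqr_ge0.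
  have mfc c : measurable_fun setT (fun x => (f x - c) ^+ 2).
    by apply: measurable_funX; exact: measurable_funB.
  exists (f (phi x0)).
  rewrite gauss_wI_row1//; last exact: (s0 (fun x => f x - _)).
  rewrite gauss_wI_row1//; last 2 first.
  - by apply: measurable_sum => i; exact: measurable_funX.
  - by move=> x; rewrite sumr_ge0// => i _; exact: sqr_ge0.
  under [leRHS]eq_integral do rewrite big_ord1.
  apply: (@hardy_half_gauss R alpha alpha1 (f \o phi) (g ord0 \o phi)).
  - move=> t t0; apply: (@is_derive_line _ _ _ f phi t 1 (delta_mx ord0 ord0)).
      by move=> h; rewrite /phi rowcons_first.
    by apply: df; exact: hs.
  - move=> t t0; apply: cline; have := cg _ (hs _ t0) ord0.
    have -> // : (fun t0 : R => g ord0 (t0 *: delta_mx ord0 ord0 + phi t)) =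
      (fun h : R => (g ord0 \o phi) (h + t)).
    by apply/funext => h /=; rewrite /phi -rowcons_first [_%:A]mulr1.
have mrc : measurable_fun setT (@rowcons R n.+1) by exact: measurable_rowcons.
have hs t y : halfspace y -> halfspace (rowcons (t, y) : 'rV[R]_n.+2).
  by rewrite /halfspace/= rowcons_max.
pose e (z : measurableTypeR R * 'rV[R]_n.+1) :=
  \sum_(j < n.+1) g (lift ord0 j) (rowcons z) ^+ 2.
have mgrc i : measurable_fun setT (fun z => g i (rowcons z)).
  exact: measurableT_comp (mg i) mrc.
have mfrc : measurable_fun setT (fun z => f (rowcons z)).
  exact: measurableT_comp mf mrc.
have [wgt0 wfin] := andP (gauss_wI1_gt0_fin n).
have [||||||||c hc] := @tensorize_poincare _ _ _ _ R mu (lebesgue_row n.+1)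
  (@gauss R) (@gweight R alpha n) mgauss (@mgw n) gauss_gt0 (@gw0 n) _ wfin wgt0
  (fun z => f (rowcons z)) (fun z => g ord0 (rowcons z)) e (0 : R).
- suff : (0 < mu setT)%E by [].
  by rewrite /mu -set_itvNyy lebesgue_measure_itv/= addye ?ltry.
- exact: mfrc.
- exact: mgrc.
- by apply: measurable_sum => j; exact: measurable_funX.
- by move=> z; rewrite sumr_ge0// => j _; exact: sqr_ge0.
- have mf2 : measurable_fun setT (fun x => f x ^+ 2) by exact: measurable_funX.
  by move: foo; rewrite (gauss_wI_rowS alpha mf2 (fun x => sqr_ge0 (f x))).
- move=> y; rewrite gweight_gt0 => y0.
  apply: (@hardy_gauss R (fun t => f (rowcons (t, y))) (fun t => g ord0 (rowcons (t, y)))).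
    move=> t; apply: (@is_derive_line _ _ _ f (fun t => rowcons (t, y)) t 1 (delta_mx ord0 ord0)).
      by move=> h; rewrite rowcons_first.
    by apply: df; exact: hs.
  move=> t; apply: cline; have := cg _ (hs t _ y0) ord0.
  have -> // : (fun t0 : R => g ord0 (t0 *: delta_mx ord0 ord0 + rowcons (t, y))) =
    (fun h : R => g ord0 (rowcons (h + t, y))).
  by apply/funext => h /=; rewrite -rowcons_first [_%:A]mulr1.
- move=> t ftoo.
  apply: (ih (fun y => f (rowcons (t, y))) (fun j y => g (lift ord0 j) (rowcons (t, y)))) => //.
  + exact: measurableT_comp mfrc (measurable_pair1 t).
  + move=> j; exact: measurableT_comp (mgrc _) (measurable_pair1 t).
  + move=> y y0 j.
    apply: (@is_derive_line _ _ _ f (fun y => rowcons (t, y)) y (delta_mx ord0 j)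
      (delta_mx ord0 (lift ord0 j))).
      by move=> h; rewrite rowcons_next.
    by apply: df; exact: hs.
  + move=> y y0 j; have := cg _ (hs t _ y0) (lift ord0 j).
    have -> // : (fun s : R => g (lift ord0 j) (s *: delta_mx ord0 (lift ord0 j) + rowcons (t, y))) =
      (fun s : R => g (lift ord0 j) (rowcons (t, s *: delta_mx ord0 j + y))).
    by apply/funext => s; rewrite -rowcons_next.
exists c; rewrite gauss_wI_rowS//; last 2 first.
- by apply: measurable_funX; exact: measurable_funB.
- by move=> x; exact: sqr_ge0.
rewrite gauss_wI_rowS//; last 2 first.
- by apply: measurable_sum => i; exact: measurable_funX.
- by move=> x; rewrite sumr_ge0// => i _; exact: sqr_ge0.
apply: le_trans hc _; rewrite le_eqVlt; apply/orP; left; apply/eqP.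
by apply: eq_wI => z _; rewrite big_ord_recl.
Qed.
End gauss_space_poincare.

(** * Second moments and parity on the half-space *)

Section gauss_space_moments.
Context {R : realType}.
Variable alpha : R.
Hypothesis alpha1 : -1 < alpha.
Let mu := @lebesgue_measure R.
Notation W n := (wI (lebesgue_row n.+1) setT (@gweight R alpha n)).

Let egauss : measurable_fun (setT : set (measurableTypeR R)) (fun t => (gauss t)%:E).
Proof.
by apply/measurable_EFinP; apply: continuous_measurable_fun; exact: continuous_gauss.
Qed.

Let wI_cst n (k : R) : 0 <= k -> W n (fun=> k) = (k%:E * W n (fun=> 1%R))%E.
Proof.
move=> k0; rewrite -ge0_wIZ//; last 2 first.
- exact: measurable_gweight.
- by move=> x _; exact: gweight_ge0.
by apply: eq_wI => x _; rewrite mulr1.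
Qed.

Let wI_first n (h : 'rV[R]_n.+2 -> R) (p : R -> R) :
  measurable_fun setT h -> (forall x, 0 <= h x) ->
  (forall t y, h (rowcons (t, y)) = p t) ->
  measurable_fun (setT : set (measurableTypeR R)) p -> (forall t, 0 <= p t) ->
  W n.+1 h = (W n (fun=> 1%R) * \int[mu]_t (p t * gauss t)%:E)%E.
Proof.
move=> mh h0 hp mp p0; have [/ltW w0 _] := andP (gauss_wI1_gt0_fin alpha1 n).
rewrite gauss_wI_prod// -ge0_integralZl//; last 2 first.
- apply/measurable_EFinP; apply: measurable_funM => //.
  exact/measurable_EFinP.
- by move=> t _; rewrite lee_fin mulr_ge0 ?expR_ge0.
apply: eq_integral => t _; under eq_wI do rewrite hp.
by rewrite wI_cst// muleAC muleC EFinM.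
Qed.

Lemma gauss_wI_coord2 n :
  W n.+1 (fun x => x ord0 ord0 ^+ 2)%R = W n.+1 (fun=> 1%R).
Proof.
rewrite (@wI_first _ _ (fun t => t ^+ 2))//; last 4 first.
- by apply: measurable_funX; exact: measurable_coord.
- by move=> x; exact: sqr_ge0.
- by move=> t y; rewrite rowcons0.
- by move=> t; exact: sqr_ge0.
rewrite (@wI_first _ (fun=> 1) (fun=> 1))//.
by under [in RHS]eq_integral do rewrite mul1r; rewrite gauss_moment2.
Qed.

(** The reflection of the first coordinate preserves the weight. In this form both sides are
    integrals of nonnegative functions, ready for the polar formula. *)
Lemma gauss_wI_odd n :
  W n.+1 (fun x => Num.max (x ord0 ord0) 0)%R =
  W n.+1 (fun x => Num.max (- x ord0 ord0) 0)%R.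
Proof.
have mmax : measurable_fun (setT : set (measurableTypeR R)) (fun t : R => Num.max t 0).
  by apply: measurable_maxr => //; exact: measurable_id.
have mmaxN : measurable_fun (setT : set (measurableTypeR R)) (fun t : R => Num.max (- t) 0).
  by apply: measurable_maxr => //; exact: oppr_measurable.
have c0 := @measurable_coord R n.+2 ord0.
rewrite (@wI_first _ _ (fun t => Num.max t 0))//; last 4 first.
- by apply: measurable_maxr.
- by move=> x; rewrite le_max lexx orbT.
- by move=> t y; rewrite rowcons0.
- by move=> t; rewrite le_max lexx orbT.
rewrite (@wI_first _ _ (fun t => Num.max (- t) 0))//; last 4 first.
- by apply: measurable_maxr => //; exact: measurableT_comp.
- by move=> x; rewrite le_max lexx orbT.
- by move=> t y; rewrite rowcons0.
- by move=> t; rewrite le_max lexx orbT.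
congr (_ * _)%E; rewrite -integral_oppr//; last 2 first.
- apply/measurable_EFinP; apply: measurable_funM => //; exact/measurable_EFinP.
- by move=> t; rewrite lee_fin mulr_ge0 ?expR_ge0// le_max lexx orbT.
by apply: eq_integral => t _; rewrite /gauss sqrrN.
Qed.

(** Relative to the mass, each Gaussian coordinate contributes 1 to the second moment and the
    weighted one contributes alpha + 1, by [moment_rec]. *)
Lemma gauss_wI_dot n :
  W n (fun x => dot x x) = ((n%:R + 1 + alpha)%:E * W n (fun=> 1%R))%E.
Proof.
elim: n => [|n ih].
  have dot0 (x : 'rV[R]_1) : 0 <= dot x x.
    by rewrite sumr_ge0// => i _; rewrite -expr2 sqr_ge0.
  rewrite !gauss_wI_row1//; last exact: measurable_dot.
  under [in RHS]eq_integral do rewrite mul1r.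
  rewrite add0r addrC -moment_rec//; apply: eq_integral => t /set_mem/=.
  rewrite in_itv/= andbT => t0.
  rewrite dot_rowcons /dot big_ord0 addr0 /half_gauss mulrA; congr (_ * _)%:E.
  by rewrite powRD ?(gt_eqF t0) ?implybT// powR_mulrn ?ltW// mulrC.
have [/ltW w0 woo] := andP (gauss_wI1_gt0_fin alpha1 n).
pose tl (x : 'rV[R]_n.+2) := \sum_(j < n.+1) x ord0 (lift ord0 j) * x ord0 (lift ord0 j).
have mtl : measurable_fun setT tl.
  by apply: measurable_sum => j; apply: measurable_funM; exact: measurable_coord.
have tl0 x : 0 <= tl x by rewrite sumr_ge0// => j _; rewrite -expr2 sqr_ge0.
have mc0 : measurable_fun setT (fun x : 'rV[R]_n.+2 => x ord0 ord0 ^+ 2).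
  by apply: measurable_funX; exact: measurable_coord.
under eq_wI do rewrite /dot big_ord_recl -expr2 -/(tl _).
rewrite ge0_wID//; last 3 first.
- exact: measurable_gweight.
- by move=> x _; exact: gweight_ge0.
- by move=> x _; exact: sqr_ge0.
rewrite gauss_wI_coord2.
have -> : W n.+1 tl = ((n%:R + 1 + alpha)%:E * W n.+1 (fun=> 1%R))%E.
  rewrite gauss_wI_prod//.
  have E t : W n (fun y => tl (rowcons (t, y))) =
      ((n%:R + 1 + alpha)%:E * W n (fun=> 1%R))%E.
    rewrite -ih; apply: eq_wI => y _; apply: eq_bigr => j _.
    by rewrite rowcons_lift.
  under eq_integral do rewrite E -muleA.
  rewrite ge0_integralZl//; last 3 first.
  - by apply: emeasurable_funM => //; exact: measurable_cst.
  - by move=> t _; rewrite mule_ge0// lee_fin expR_ge0.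
  - by rewrite lee_fin -addrA addr_ge0// addrC -lerBlDr sub0r ltW.
  by congr (_ * _)%E; rewrite gauss_wI_prod.
have [/ltW w10 w1oo] := andP (gauss_wI1_gt0_fin alpha1 n.+1).
rewrite -[X in (X + _)%E]mul1e -muleDl//; last by rewrite ge0_fin_numE.
by rewrite -EFinD -natr1; congr (_%:E * _)%E; ring.
Qed.
End gauss_space_moments.

(** * Polar coordinates *)

Section scaling.
Context {R : realType}.
Let mu := @lebesgue_measure R.

Let mscal (r : R) : measurable_fun (setT : set (measurableTypeR R))
  (fun t : measurableTypeR R => (r * t : measurableTypeR R)).
Proof. exact: measurable_funM. Qed.

Lemma lebesgue_measure_scale (r : R) (A : set (measurableTypeR R)) : 0 < r ->
  measurable A -> mu ((fun t => r * t) @^-1` A) = (r^-1%:E * mu A)%E.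
Proof.
move=> r0 mA.
(* Multiplied by r, the image measure gives ]a, b] its length, so uniqueness of the Lebesgue measure
   applies. *)
pose m := mscale (NngNum (ltW r0))
  (@measure_function_pushforward__canonical__measure_function_Measure _ _ _ _ _ mu _ (mscal r)).
have -> : mu A = m A.
  apply: (@lebesgue_measure_unique R m) => // _ [[a b] _ <-].
  rewrite /m /mscale/= /pushforward.
  pose I : set R := `]a / r, b / r]%classic.
  have E : (fun t => r * t) @^-1` `]a, b]%classic = I.
    apply/seteqP; split=> t /=; rewrite /I/= !in_itv/= ltr_pdivrMr// ler_pdivlMr//;
    by rewrite [t * r]mulrC.
  transitivity (r%:E * mu I)%E; last first.
    by congr (_ * mu _)%E; exact/esym/E.
  rewrite /mu /I !lebesgue_measure_itv/= !lte_fin ltr_pM2r ?invr_gt0//.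
  case: ifP => _; last by rewrite mule0.
  by rewrite -!EFinB -EFinM; congr EFin; field; rewrite gt_eqF.
by rewrite /m /mscale/= muleA -EFinM mulVf ?gt_eqF// mul1e.
Qed.

Lemma integral_scale (r : R) (f : measurableTypeR R -> \bar R) : 0 < r ->
  measurable_fun setT f -> (forall x, 0 <= f x)%E ->
  (\int[mu]_t f (r * t)%R = r^-1%:E * \int[mu]_t f t)%E.
Proof.
move=> r0 mf f0.
rewrite -[LHS](@ge0_integral_pushforward _ _ _ _ R _ (mscal r) mu setT f)//.
have r0' : 0 <= r^-1 by rewrite invr_ge0 ltW.
rewrite -[RHS](@ge0_integral_mscale _ _ R mu setT measurableT (NngNum r0') f)//.
apply: eq_measure_integral => A mA _.
exact: lebesgue_measure_scale.
Qed.

Lemma lebesgue_row_scale n (r : R) (A : set 'rV[R]_n) : 0 < r -> measurable A ->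
  lebesgue_row n ((fun x => r *: x) @^-1` A) = ((r^-1 ^+ n)%:E * lebesgue_row n A)%E.
Proof.
move=> r0; elim: n A => [|n ih] A mA.
  rewrite expr0 mul1e; congr (lebesgue_row 0 _).
  by apply/seteqP; split => x /=; have -> : r *: x = x by apply/rowP => -[].
have mrc : measurable_fun setT (@rowcons R n) by exact: measurable_rowcons.
have mB : measurable (@rowcons R n @^-1` A).
  by rewrite -[X in measurable X]setTI; exact: mrc.
rewrite /= /cons_measure /pushforward /product_measure1.
rewrite [X in (\int[_]_x X x)%E](_ : _ = fun t : measurableTypeR R => ((r^-1 ^+ n)%:E *
    lebesgue_row n (xsection (@rowcons R n @^-1` A) (r * t)%R))%E); last first.
  apply/funext => t /=; rewrite -ih; last exact: measurable_xsection.
  congr (lebesgue_row n _); apply/seteqP; split => y /=; rewrite /xsection/= !inE/=;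
    congr A; apply/rowP => i; rewrite !mxE; case: unliftP => //= j _; by rewrite mxE.
have mx := measurable_fun_xsection (lebesgue_row n) mB.
rewrite ge0_integralZl//; last 2 first.
- by apply: measurableT_comp mx (mscal r).
- by rewrite lee_fin exprn_ge0// invr_ge0 ltW.
rewrite (@integral_scale r (lebesgue_row n \o xsection (@rowcons R n @^-1` A)))//.
by rewrite muleA -EFinM -exprSr.
Qed.

End scaling.

Section enorm_theory.
Context {R : realType}.

Lemma dot_ge0 n (x : 'rV[R]_n) : 0 <= dot x x.
Proof. by apply: sumr_ge0 => i _; rewrite -expr2 sqr_ge0. Qed.

Lemma enorm_ge0 n (x : 'rV[R]_n) : 0 <= enorm x.
Proof. exact: sqrtr_ge0. Qed.

Lemma enorm_sqr n (x : 'rV[R]_n) : enorm x ^+ 2 = dot x x.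
Proof. by rewrite sqr_sqrtr ?dot_ge0. Qed.

Lemma dotZ n (c : R) (x : 'rV[R]_n) : dot (c *: x) (c *: x) = c ^+ 2 * dot x x.
Proof. by rewrite /dot mulr_sumr; apply: eq_bigr => i _; rewrite !mxE; ring. Qed.

Lemma enormZ n (c : R) (x : 'rV[R]_n) : 0 <= c -> enorm (c *: x) = c * enorm x.
Proof. by move=> c0; rewrite /enorm dotZ sqrtrM ?sqr_ge0// sqrtr_sqr ger0_norm. Qed.

Lemma sphere_projZ n (c : R) (x : 'rV[R]_n) : 0 < c ->
  sphere_proj (c *: x) = sphere_proj x.
Proof.
move=> c0; rewrite /sphere_proj enormZ ?(ltW c0)// scalerA invfM mulrAC.
by rewrite mulVf ?gt_eqF// mul1r.
Qed.

Lemma sphere_proj_id n (x : 'rV[R]_n) : enorm x = 1 -> sphere_proj x = x.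
Proof. by rewrite /sphere_proj => ->; rewrite invr1 scale1r. Qed.

Lemma enorm_sphere_proj n (x : 'rV[R]_n) : 0 < enorm x -> enorm (sphere_proj x) = 1.
Proof. by move=> x0; rewrite enormZ ?invr_ge0 ?enorm_ge0// mulVf ?gt_eqF. Qed.

Lemma coord_le_enorm n (x : 'rV[R]_n) i : `|x ord0 i| <= enorm x.
Proof.
rewrite -sqrtr_sqr ler_wsqrtr// /dot (bigD1 i)//= -expr2 lerDl.
by apply: sumr_ge0 => j _; rewrite -expr2 sqr_ge0.
Qed.

End enorm_theory.

Section surface_finite.
Context {R : realType}.
Let mu := @lebesgue_measure R.

Let cube n : set 'rV[R]_n := [set x | forall i, `|x ord0 i| <= 1].

Let mcube n : measurable (@cube n).
Proof.
rewrite (_ : @cube n = \bigcap_(i in [set: 'I_n]) [set x | `|x ord0 i| <= 1]); last first.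
  by apply/seteqP; split => [x h i _|x h i]; [exact: h|exact: (h i I)].
apply: fin_bigcap_measurable => // i _.
have m : measurable_fun setT (fun x : 'rV[R]_n => `|x ord0 i|).
  by apply: measurableT_comp => //; exact: measurable_coord.
have := m measurableT `]-oo, 1]%classic (measurable_itv _).
by rewrite setTI; congr measurable; apply/seteqP; split => x /=; rewrite in_itv.
Qed.

Let cube_fin n : (lebesgue_row n (@cube n) < +oo)%E.
Proof.
elim: n => [|n ih].
  by rewrite -[lebesgue_row 0 _]/(\d_(0 : 'rV[R]_0) _) diracE ltry.
rewrite /= /cons_measure /pushforward.
rewrite (_ : _ @^-1` _ = (`[-1, 1]%classic : set (measurableTypeR R)) `*` @cube n); last first.
  apply/seteqP; split => -[t y] /=; rewrite in_itv/= -ler_norml.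
    by move=> h; split => [|i]; [have := h ord0; rewrite rowcons0
      |have := h (lift ord0 i); rewrite rowcons_lift].
  move=> [ht hy] i; have [j ->|->] := unliftP ord0 i; first by rewrite rowcons_lift.
  by rewrite rowcons0.
rewrite product_measure1E//; last exact: mcube.
rewrite lte_mul_pinfty//.
- suff : mu (`[-1, 1]%classic : set R) \is a fin_num by [].
  rewrite /mu lebesgue_measure_itv/=; case: ifP => //.
Qed.

Lemma surface_measure_fin n : fin_num_fun (@surface_measure R n).
Proof.
apply: lty_fin_num_fun.
suff : (n%:R%:E * lebesgue_row n (@punctured_ball R n `&` setT) < +oo)%E by [].
rewrite setIT lte_mul_pinfty ?lee_fin//; apply: le_lt_trans (cube_fin n).
apply: le_measure; rewrite ?inE//; [exact: measurable_punctured_ball|exact: mcube|].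
by move=> x; rewrite /punctured_ball/= => /andP[_ x1] i; apply: le_trans x1; exact: coord_le_enorm.
Qed.

HB.instance Definition _ n := @Measure_isFinite.Build _ _ _ (@surface_measure R n)
  (@surface_measure_fin n).

End surface_finite.

Section lebesgue_pos.
Context {R : realType}.
Let mu := @lebesgue_measure R.

Let m0y : measurable (`]0, +oo[%classic : set (measurableTypeR R)).
Proof. exact: measurable_itv. Qed.

Definition lebesgue_pos : set (measurableTypeR R) -> \bar R := mrestr mu m0y.

HB.instance Definition _ := Measure.on lebesgue_pos.

Let lebesgue_pos_sigma_finite : sigma_finite setT lebesgue_pos.
Proof.
have [F TF Foo] := sigma_finiteT mu.
exists F => // k; have [mFk Fk] := Foo k; split => //.
apply: le_lt_trans Fk; rewrite /lebesgue_pos /mrestr.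
by apply: le_measure; rewrite ?inE//; exact: measurableI.
Qed.

HB.instance Definition _ := Measure_isSigmaFinite.Build _ _ _ lebesgue_pos
  lebesgue_pos_sigma_finite.

End lebesgue_pos.

Lemma ge0_integral_mrestr d (T : measurableType d) (R : realType)
    (m : {measure set T -> \bar R}) (D : set T) (mD : measurable D) (f : T -> \bar R) :
  measurable_fun setT f -> (forall x, 0 <= f x)%E ->
  (\int[mrestr m mD]_x f x = \int[m]_(x in D) f x)%E.
Proof.
move=> mf f0; rewrite -(setUv D) ge0_integral_setU//; last 3 first.
- exact: measurableC.
- by rewrite setUv.
- exact/disj_setPCl.
rewrite [X in (_ + X)%E]null_set_integral ?adde0//.
- by apply: eq_measure_integral => A mA AD; rewrite /= /mrestr setIidl.
- exact: measurableC.
- exact: measurable_funTS.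
- by rewrite /= /mrestr setICl measure0.
Qed.

Section polar.
Context {R : realType} (n : nat).
Let mu := @lebesgue_measure R.
Let lam := @lebesgue_row R n.+1.
Let sigma := @surface_measure R n.+1.

Definition punctured : set 'rV[R]_n.+1 := [set x | 0 < enorm x].

Lemma measurable_punctured : measurable punctured.
Proof.
have := @measurable_enorm R n.+1 measurableT `]0, +oo[%classic (measurable_itv _).
by rewrite setTI; congr measurable; apply/seteqP; split => x /=; rewrite in_itv/= andbT.
Qed.

(** For t = r^(n+1) one has dt = (n+1) r^n dr. In this variable the radial factor of polar
    coordinates is the plain measure [lebesgue_pos], and the factor n + 1 is the one in
    [surface_measure]. *)
Let radius (x : 'rV[R]_n.+1) : measurableTypeR R := enorm x ^+ n.+1.

Let mradius : measurable_fun setT radius.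
Proof. by apply: measurable_funX; exact: measurable_enorm. Qed.

Let mprojV (B : set 'rV[R]_n.+1) : measurable B -> measurable (@sphere_proj R n.+1 @^-1` B).
Proof. by move=> mB; rewrite -[X in measurable X]setTI; exact: measurable_sphere_proj. Qed.

Let tau (x : 'rV[R]_n.+1) : measurableTypeR R * 'rV[R]_n.+1 := (radius x, sphere_proj x).

Let mtau : measurable_fun setT tau.
Proof. by apply: measurable_fun_pair => //; exact: measurable_sphere_proj. Qed.

Let sector (B : set 'rV[R]_n.+1) := punctured `&` @sphere_proj R n.+1 @^-1` B.

Let msector B : measurable B -> measurable (sector B).
Proof. by move=> mB; apply: measurableI; [exact: measurable_punctured|exact: mprojV]. Qed.

(** The truncated sector is the unit cone over B dilated by s^(1/(n+1)), which multiplies its volume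
    by s. *)
Let sector_measure (B : set 'rV[R]_n.+1) (s : R) : 0 < s -> measurable B ->
  (n.+1%:R%:E * lam (sector B `&` [set x | radius x <= s]%R) = s%:E * sigma B)%E.
Proof.
move=> s0 mB; pose r := s `^ (n.+1%:R^-1).
have r0 : 0 < r by exact: powR_gt0.
have rs : r ^+ n.+1 = s.
  rewrite -powR_mulrn ?ltW// /r -powRrM mulVf ?pnatr_eq0// powRr1//; exact: ltW.
have mS : measurable (@punctured_ball R n.+1 `&` @sphere_proj R n.+1 @^-1` B).
  by apply: measurableI; [exact: measurable_punctured_ball|exact: mprojV].
have -> : sector B `&` [set x | radius x <= s]%R =
    (fun x => r^-1 *: x) @^-1` (@punctured_ball R n.+1 `&` @sphere_proj R n.+1 @^-1` B).
  apply/seteqP; split => x /=; rewrite /punctured_ball/= enormZ ?invr_ge0 ?(ltW r0)//;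
    rewrite sphere_projZ ?invr_gt0// pmulr_rgt0 ?invr_gt0// ler_pdivrMl// mulr1;
    have -> : (radius x <= s) = (enorm x <= r) by
      rewrite /radius -rs ler_pXn2r// ?nnegrE ?enorm_ge0// ltW.
  - by move=> [[? ?] ?]; split => //; apply/andP.
  - by move=> [/andP[? ?] ?].
rewrite lebesgue_row_scale ?invr_gt0// invrK rs.
by rewrite -[sigma B]/(n.+1%:R%:E * _)%E muleCA.
Qed.

Let sector0 (B : set 'rV[R]_n.+1) (s : R) : s <= 0 ->
  sector B `&` [set x | radius x <= s]%R = set0.
Proof.
move=> s0; apply/seteqP; split => // x [[/= x0 _] /= xs].
by have := lt_le_trans (exprn_gt0 n.+1 x0) (le_trans xs s0); rewrite ltxx.
Qed.

Let sector_measure_max (B : set 'rV[R]_n.+1) (s : R) : measurable B ->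
  (n.+1%:R%:E * lam (sector B `&` [set x | radius x <= s]%R) =
   (Num.max s 0)%:E * sigma B)%E.
Proof.
move=> mB; have [s0|s0] := leP s 0; last exact: sector_measure.
by rewrite sector0// measure0 mule0 mul0e.
Qed.

(** As functions of A both sides are measures. They agree on half-open intervals, by difference of
    two truncated sectors, and such intervals determine them. *)
Let polar_rect (A : set (measurableTypeR R)) (B : set 'rV[R]_n.+1) :
  measurable A -> measurable B ->
  (n.+1%:R%:E * lam (sector B `&` radius @^-1` A) = lebesgue_pos A * sigma B)%E.
Proof.
move=> mA mB.
have sfin : sigma B \is a fin_num by exact: surface_measure_fin.
have s0 : 0 <= fine (sigma B) by exact: fine_ge0.
pose l := mscale (NngNum (ler0n R n.+1))
  (@measure_function_pushforward__canonical__measure_function_Measure _ _ _ _ _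
    (mrestr lam (msector mB)) _ mradius).
pose r := mscale (NngNum s0) (@lebesgue_pos R).
have lE (X : set (measurableTypeR R)) : l X = (n.+1%:R%:E * lam (sector B `&` radius @^-1` X))%E.
  by rewrite /l /mscale/= /pushforward /mrestr setIC.
have rE (X : set (measurableTypeR R)) : r X = (lebesgue_pos X * sigma B)%E.
  by rewrite /r /mscale/= fineK// muleC.
rewrite -lE -rE.
have mle (t : R) : measurable (sector B `&` [set x | radius x <= t]%R).
  apply: measurableI; first exact: msector.
  have := mradius measurableT (measurable_itv `]-oo, t]).
  by rewrite setTI; congr measurable; apply/seteqP; split => x /=; rewrite in_itv.
have agree (a b : R) : l `]a, b]%classic = r `]a, b]%classic.
  rewrite lE rE.
  have [ba|ab] := leP b a.
    rewrite set_itv_ge ?bnd_simp -?leNgt//.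
    by rewrite preimage_set0 setI0 !measure0 mule0 mul0e.
  have -> : sector B `&` radius @^-1` `]a, b]%classic =
      (sector B `&` [set x | radius x <= b]%R) `\` (sector B `&` [set x | radius x <= a]%R).
    apply/seteqP; split => x /=; rewrite in_itv/=.
      by move=> [h /andP[ax xb]]; split; [split|move=> [_]; rewrite leNgt ax].
    move=> [[h xb] na]; split; first by []; rewrite xb andbT ltNge; apply/negP => xa.
    by apply: na.
  have fin t : lam (sector B `&` [set x | radius x <= t]%R) \is a fin_num.
    have := sector_measure_max t mB; rewrite -(fineK sfin) -EFinM.
    case: (lam _) => [//||]; rewrite ?gt0_muley ?gt0_muleNy ?lte_fin//.
  rewrite measureD; [|exact: mle|exact: mle|by rewrite ltey_eq fin].
  have -> : (sector B `&` [set x | radius x <= b]%R) `&`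
      (sector B `&` [set x | radius x <= a]%R) = sector B `&` [set x | radius x <= a]%R.
    apply/setIidr => x [h xa]; split; [exact: h|exact: le_trans xa (ltW ab)].
  rewrite muleBr//; last by rewrite fin_num_adde_defr ?fin.
  rewrite !sector_measure_max// -muleBl//.
  congr (_ * _)%E; rewrite /lebesgue_pos /mrestr.
  have -> : `]a, b]%classic `&` `]0, +oo[%classic = `]Num.max a 0, b]%classic :> set R.
    apply/seteqP; split => x /=; rewrite !in_itv/= andbT gt_max.
      by move=> [/andP[-> ->] ->].
    by move=> /andP[/andP[-> ->] ->].
  rewrite lebesgue_measure_itv/= lte_fin.
  have [b0|b0] := leP b 0.
    have [a0|a0] := leP a 0; first by rewrite (le_gtF b0) subee.
    by have := lt_le_trans ab b0; rewrite ltNge (ltW a0).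
  have -> : Num.max a 0 < b by rewrite gt_max ab b0.
  by [].
apply: (@measure_unique _ R (measurableTypeR R) (@ocitv R) (fun k => `](- k%:R), k%:R]%classic)) => //.
- exact: ocitvI.
- by move=> k; exact: is_ocitv.
- rewrite -subTset => x _; exists (Num.truncn `|x|).+1 => //=.
  by have := truncnS_gt `|x|; rewrite in_itv/= ltr_norml => /andP[-> /ltW ->].
- by move=> _ [[a b] _ <-]; exact: agree.
- move=> k; rewrite [X in (X < _)%E](_ : _ = r `](- k%:R), k%:R]%classic); last exact: agree.
  have mI : measurable (`](- k%:R), k%:R]%classic : set (measurableTypeR R)) by [].
  pose I : set R := `](- k%:R), k%:R]%classic.
  have fI : (lebesgue_pos I < +oo)%E.
    apply: (@le_lt_trans _ _ (mu I)).
      by rewrite /lebesgue_pos /mrestr; apply: le_measure; rewrite ?inE//; exact: measurableI.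
    by rewrite /mu /I lebesgue_measure_itv/=; case: ifP => // _; rewrite -EFinB ltry.
  by rewrite rE lte_mul_pinfty ?ge0_fin_numE// ltey_eq sfin.
Qed.

Lemma polar_integral (h : measurableTypeR R * 'rV[R]_n.+1 -> \bar R) :
  measurable_fun setT h -> (forall z, 0 <= h z)%E ->
  (n.+1%:R%:E * \int[lam]_(x in punctured) h (tau x) =
   \int[lebesgue_pos \x sigma]_z h z)%E.
Proof.
move=> mh h0.
pose nu := mscale (NngNum (ler0n R n.+1))
  (@measure_function_pushforward__canonical__measure_function_Measure _ _ _ _ _
    (mrestr lam measurable_punctured) _ mtau).
transitivity (\int[nu]_z h z)%E.
  rewrite /nu ge0_integral_mscale//; congr (_ * _)%E.
  rewrite -(ge0_integral_mrestr lam measurable_punctured)//; last exact: measurableT_comp mh mtau.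
  by rewrite ge0_integral_pushforward//; exact: mtau.
(* A measure that has the product values on rectangles is the product measure; [polar_rect] computes
   these values. *)
apply: eq_measure_integral => X mX _; apply/esym.
apply: (@product_measure_unique _ _ _ _ R lebesgue_pos sigma nu) => // A B mA mB.
rewrite -polar_rect// /nu /mscale/= /pushforward /mrestr; congr (_ * lam _)%E.
by apply/seteqP; split => x /=; rewrite /sector/=; tauto.
Qed.

End polar.

(* The constant is the integral of g against r^n dr. *)
Lemma polar_integral_radial (R : realType) n (g : R -> R) : measurable_fun setT g ->
  (forall r, 0 <= g r) -> exists C : \bar R, (0 <= C)%E /\
  forall k : 'rV[R]_n.+1 -> R, measurable_fun setT k -> (forall z, 0 <= k z) ->
  (\int[lebesgue_row n.+1]_(x in @punctured R n) (g (enorm x) * k (sphere_proj x))%:E =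
   C * \int[@surface_measure R n.+1]_z (k z)%:E)%E.
Proof.
move=> mg g0.
(* [root] undoes the substitution t = r^(n+1), so that g (root t) is g at the original radius. *)
pose root (t : measurableTypeR R) : R := t `^ (n.+1%:R^-1).
have mroot : measurable_fun setT root by exact: measurable_powR.
have mgr : measurable_fun setT (fun t => (g (root t))%:E).
  by apply/measurable_EFinP; exact: measurableT_comp mg mroot.
have n0 : ((n.+1%:R^-1 : R)%:E * n.+1%:R%:E)%E = 1%E.
  by rewrite -EFinM mulVf// pnatr_eq0.
exists ((n.+1%:R^-1)%:E * \int[@lebesgue_pos R]_t (g (root t))%:E)%E; split.
  by rewrite mule_ge0 ?lee_fin// integral_ge0// => t _; rewrite lee_fin.
move=> k mk k0.
have mek : measurable_fun setT (fun z => (k z)%:E) by exact/measurable_EFinP.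
have mh : measurable_fun setT (fun z : measurableTypeR R * 'rV[R]_n.+1 =>
    (g (root z.1) * k z.2)%:E).
  apply/measurable_EFinP; apply: measurable_funM.
    exact: measurableT_comp (measurableT_comp mg mroot) measurable_fst.
  exact: measurableT_comp mk measurable_snd.
have h0 (z : measurableTypeR R * 'rV[R]_n.+1) : (0 <= (g (root z.1) * k z.2)%:E)%E.
  by rewrite lee_fin mulr_ge0.
have P := polar_integral mh h0.
have -> : (\int[lebesgue_row n.+1]_(x in @punctured R n)
    (g (enorm x) * k (sphere_proj x))%:E =
    (n.+1%:R^-1)%:E * \int[lebesgue_pos \x @surface_measure R n.+1]_z
      (g (root z.1) * k z.2)%:E)%E.
  rewrite -P muleA n0 mul1e; apply: eq_integral => x _ /=; congr (g _ * _)%:E.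
  rewrite /root -powR_mulrn ?enorm_ge0// -powRrM mulfV ?pnatr_eq0//.
  by rewrite powRr1// enorm_ge0.
rewrite -muleA; congr (_ * _)%E.
rewrite (fubini_tonelli1 _ mh h0) /fubini_F.
have K0 : (0 <= \int[@surface_measure R n.+1]_z (k z)%:E)%E.
  by rewrite integral_ge0// => z _; rewrite lee_fin.
rewrite -ge0_integralZr//; last by move=> t _; rewrite lee_fin.
apply: eq_integral => t _; rewrite -ge0_integralZl//=.
- by move=> z _; rewrite lee_fin.
- by rewrite lee_fin.
Qed.

(** * Continuous functions on row vectors are measurable *)

Section open_measurable_row.
Context {R : realType} (n : nat).

Let box (p : 'rV[rat]_n * nat) : set 'rV[R]_n :=
  [set y | forall i, `|ratr (p.1 ord0 i) - y ord0 i| < p.2.+1%:R^-1].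

Let mbox p : measurable (box p).
Proof.
rewrite (_ : box p = \bigcap_(i in [set: 'I_n])
    [set y | `|ratr (p.1 ord0 i) - y ord0 i| < p.2.+1%:R^-1]); last first.
  by apply/seteqP; split => [x h i _|x h i]; [exact: h|exact: (h i I)].
apply: fin_bigcap_measurable => // i _.
have m : measurable_fun setT (fun x : 'rV[R]_n => `|ratr (p.1 ord0 i) - x ord0 i| : R).
  apply: measurableT_comp => //; apply: measurable_funB => //.
  exact: measurable_coord.
have := m measurableT `]-oo, p.2.+1%:R^-1[%classic (measurable_itv _).
by rewrite setTI; congr measurable; apply/seteqP; split => x /=; rewrite in_itv.
Qed.

(** The sigma-algebra is generated by the coordinates, so topology has to be linked to it: an open
    set is the union of the countably many rational boxes that it contains. *)
Lemma open_measurable_row (U : set 'rV[R]_n) : open U -> measurable U.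
Proof.
move=> oU.
have -> : U = \bigcup_p (if `[< box p `<=` U >] then box p else set0).
  apply/seteqP; split => [x Ux|x [p _]]; last first.
    by case: asboolP => [h /h|_ //].
  have /nbhs_ballP[e /= e0 xeU] := open_nbhs_nbhs (conj oU Ux).
  pose k := Num.truncn (2 / e).
  have ke : k.+1%:R^-1 < e / 2 :> R.
    rewrite -[ltRHS]invrK ltf_pV2 ?posrE ?invr_gt0 ?divr_gt0//.
    by rewrite invfM invrK mulrC truncnS_gt.
  have k0 : 0 < k.+1%:R^-1 :> R by rewrite invr_gt0.
  have /choice[q qP] (i : 'I_n) : exists q : rat, `|ratr q - x ord0 i| < k.+1%:R^-1.
    have : x ord0 i - k.+1%:R^-1 < x ord0 i + k.+1%:R^-1 by rewrite ltrD2l gtrN.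
    move=> /rat_in_itvoo[q]; rewrite inE/= => /itvP h; exists q.
    by rewrite ltr_distl !h.
  exists (\row_i q i, k) => //.
  case: asboolP => [_|nb]; first by move=> i /=; rewrite mxE; exact: qP.
  exfalso; apply: nb => y hy; apply: xeU; split => // i j; rewrite (ord1 i).
  rewrite /ball/= (splitr e); have := hy j; rewrite /= mxE => hj.
  have := qP j; rewrite distrC => hq.
  apply: le_lt_trans (ler_distD (ratr (q j)) _ _) _.
  by rewrite ltrD// (lt_trans _ ke).
apply: countable_bigcupT_measurable; first exact: countableP.
by move=> p; case: asboolP => // _; exact: mbox.
Qed.

Lemma continuous_measurable_row (U : set 'rV[R]_n) (f : 'rV[R]_n -> R) :
  open U -> (forall x, U x -> {for x, continuous f}) -> measurable_fun U f.
Proof.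
move=> oU cf; apply: (measurability _ (RGenOpens.measurableE R)).
move=> _ [_ [a [b ->] <-]]; apply: open_measurable_row.
rewrite openE => x [Ux fx]; rewrite /interior.
apply: filterI; first exact: open_nbhs_nbhs.
apply: (cf _ Ux); apply: open_nbhs_nbhs; split => //; exact: interval_open.
Qed.

End open_measurable_row.

(** * Homogeneous extensions and the smooth Poincare inequality on the hemisphere *)

Lemma is_derive_along (R : realType) (V : normedModType R) (f : V -> R)
    (x v : V) (df : R) :
  is_derive x v f df <-> is_derive (0 : R) 1 (fun h : R => f (h *: v + x)) df.
Proof.
have E : (fun h : R => h^-1 *: ((f \o shift x) (h *: v) - f x)) =
    (fun h : R => h^-1 *: (((fun h : R => f (h *: v + x)) \o shift 0) (h *: (1:R)) -
      f (0 *: v + x))).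
  by apply/funext => h /=; rewrite addr0 scale0r add0r [h%:A]mulr1.
by split => -[]; rewrite /derivable /derive => d1 d2; apply: DeriveDef;
  rewrite /derivable /derive ?E// -?E.
Qed.

Lemma is_derive_comp_real (R : realType) (V : normedModType R) (f : V -> R)
    (phi : R -> R) (x v : V) (df a : R) :
  is_derive x v f df -> is_derive (f x) 1 phi a ->
  is_derive x v (phi \o f) (a * df).
Proof.
move=> /is_derive_along d1 d2; apply/is_derive_along.
have d2' : is_derive (f (0 *: v + x)) 1 phi a by rewrite scale0r add0r.
exact: (is_derive1_comp (g := fun h : R => f (h *: v + x)) d2' d1).
Qed.

Section enorm_calculus.
Context {R : realType} (n : nat).
Implicit Types (x v : 'rV[R]_n).

Lemma is_derive_coord x v i : is_derive x v (fun y : 'rV[R]_n => y ord0 i) (v ord0 i).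
Proof.
apply/is_derive_along.
under eq_fun do rewrite !mxE.
by apply: is_derive_eq; rewrite /GRing.scale/= mulr0 add0r mulr1 addr0.
Qed.

Lemma is_derive_dot x v :
  is_derive x v (fun y : 'rV[R]_n => dot y y) (2 * dot x v).
Proof.
have -> : (fun y : 'rV[R]_n => dot y y) =
    \sum_(i < n) (fun y : 'rV[R]_n => y ord0 i * y ord0 i).
  by apply/funext => y; rewrite fct_sumE.
have h i : is_derive x v (fun y : 'rV[R]_n => y ord0 i * y ord0 i)
    (2 * (x ord0 i * v ord0 i)).
  have c := is_derive_coord x v i.
  apply: (is_derive_eq (is_deriveM c c)).
  by rewrite /GRing.scale/=; ring.
apply: (is_derive_eq (is_derive_sum h)).
by rewrite /dot mulr_sumr.
Qed.

Lemma is_derive_enorm x v : 0 < enorm x ->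
  is_derive x v (@enorm R n) (dot x v / enorm x).
Proof.
move=> x0; have d0 : 0 < dot x x by rewrite -sqrtr_gt0.
apply: (is_derive_eq (is_derive_comp_real (is_derive_dot x v) (is_derive1_sqrt d0))).
by rewrite -/(enorm x); field; rewrite gt_eqF.
Qed.

Lemma dot_delta x i : dot x (delta_mx ord0 i) = x ord0 i.
Proof.
rewrite /dot (bigD1 i)//= big1 ?addr0 ?mxE ?eqxx ?mulr1// => j ji.
by rewrite mxE (negbTE ji) andbF mulr0.
Qed.

End enorm_calculus.

Section homogeneous.
Context {R : realType} (n : nat) (u : 'rV[R]_n -> R).
Let H := hext u.

Lemma hextZ (c : R) x : 0 < c -> H (c *: x) = H x.
Proof. by move=> c0; rewrite /H /hext sphere_projZ. Qed.

Lemma hext_sphere z : enorm z = 1 -> H z = u z.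
Proof. by move=> z1; rewrite /H /hext sphere_proj_id. Qed.

Lemma derive_linear_sum (f : 'rV[R]_n -> R) x v : differentiable f x ->
  'D_v f x = \sum_i v ord0 i * 'D_(delta_mx ord0 i) f x.
Proof.
move=> df; rewrite deriveE// {1}(row_sum_delta v) linear_sum.
by apply: eq_bigr => i _; rewrite linearZ/= deriveE.
Qed.

(** The extension is constant along the ray through x, so its derivative in the direction x is 0:
    the spherical gradient is tangent to the sphere. *)
Lemma hext_euler x : differentiable H x ->
  \sum_i x ord0 i * 'D_(delta_mx ord0 i) H x = 0.
Proof.
move=> dH; rewrite -derive_linear_sum//.
have dx : derivable H x x by exact: diff_derivable.
have /is_derive_along[_ <-] := derivableP dx.
rewrite (@near_eq_derive _ _ _ _ (cst (H x))); last first.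
  near=> h; rewrite -[X in _ + X]scale1r -scalerDl hextZ//.
  rewrite -ltrBlDr sub0r; near: h.
  by apply: lt_nbhsr; rewrite ltrN10.
by rewrite derive_cst.
Unshelve. all: by end_near. Qed.

Lemma hext_derive x i : 0 < enorm x -> differentiable H (sphere_proj x) ->
  is_derive x (delta_mx ord0 i) H ((enorm x)^-1 * grad_sphere u (sphere_proj x) ord0 i).
Proof.
move=> x0 dH.
have -> : H = H \o (fun y => (enorm x)^-1 *: y).
  by apply/funext => y /=; rewrite hextZ ?invr_gt0.
apply: (@is_derive_line _ _ _ H (fun y => (enorm x)^-1 *: y) x (delta_mx ord0 i)
  ((enorm x)^-1 *: delta_mx ord0 i)).
  by move=> h; rewrite scalerDr !scalerA mulrC.
rewrite -/(sphere_proj x).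
apply: (is_derive_eq (derivableP (_ : derivable H _ _))).
  exact: diff_derivable.
by rewrite deriveE// linearZ/= mxE -deriveE.
Qed.

End homogeneous.

(** Radial constants and surface masses are not computed; that they are positive and finite is read
    off from products whose value is known to be so. *)
Lemma mule_gt0_fin (R : realDomainType) (a b : \bar R) :
  (0 <= a -> 0 <= b -> 0 < a * b < +oo -> 0 < b < +oo)%E.
Proof.
move=> a0 b0 /andP[ab0 aboo].
have a_gt0 : (0 < a)%E.
  by rewrite lt_neqAle a0 andbT; apply/eqP => a_eq0; move: ab0; rewrite -a_eq0 mul0e ltxx.
have b_gt0 : (0 < b)%E.
  by rewrite lt_neqAle b0 andbT; apply/eqP => b_eq0; move: ab0; rewrite -b_eq0 mule0 ltxx.
rewrite b_gt0/= ltey; apply/eqP => boo.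
by move: aboo; rewrite boo gt0_muley// ltxx.
Qed.

(** * From Gaussian integrals of homogeneous functions to integrals over the hemisphere *)

Section gauss_sphere.
Context {R : realType} (n : nat) (alpha : R).
Hypothesis alpha1 : -1 < alpha.
Let hemi := @hemisphere R n.
Let rho (z : 'rV[R]_n.+1) := z ord0 ord_max `^ alpha.
Notation S := (wI (@surface_measure R n.+1) hemi rho).
Notation W := (wI (lebesgue_row n.+1) setT (@gweight R alpha n)).

Lemma halfspace_enorm (x : 'rV[R]_n.+1) : halfspace x -> 0 < enorm x.
Proof. by move=> x0; apply: lt_le_trans (coord_le_enorm x ord_max); rewrite normr_gt0 gt_eqF. Qed.

Lemma halfspace_proj (x : 'rV[R]_n.+1) : halfspace x -> hemi (sphere_proj x).
Proof.
move=> x0; have e0 := halfspace_enorm x0; split; first exact: enorm_sphere_proj.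
by rewrite mxE mulr_gt0// invr_gt0.
Qed.

Lemma measurable_hemisphere : measurable hemi.
Proof.
have -> : hemi = (@enorm R n.+1 @^-1` [set 1]) `&` @halfspace R n by [].
apply: measurableI; last exact: measurable_halfspace.
by have := @measurable_enorm R n.+1 measurableT [set 1]; rewrite setTI; apply.
Qed.

Lemma measurable_rho : measurable_fun hemi rho.
Proof.
apply: measurable_funTS.
exact: measurableT_comp (measurable_powR _) (measurable_coord _).
Qed.

Lemma rho_ge0 z : hemi z -> 0 <= rho z. Proof. by rewrite powR_ge0. Qed.

(* c p is the integral of r^(p + alpha + n) exp (- r^2 / 2) over (0, +oo). *)
Lemma gauss_wI_homogeneous (p : nat) : exists C : \bar R, (0 <= C)%E /\
  forall (F k : 'rV[R]_n.+1 -> R), measurable_fun setT F -> (forall x, 0 <= F x) ->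
    measurable_fun hemi k -> (forall z, hemi z -> 0 <= k z) ->
    (forall x, halfspace x -> F x = enorm x ^+ p * k (sphere_proj x)) ->
    W F = (C * S k)%E.
Proof.
(* The weight splits as x_last^alpha = r^alpha z_last^alpha, and r^alpha is its radial part. The
   last factor removes negative r, where r^p may be negative. *)
pose g (r : R) := r ^+ p * r `^ alpha * gauss r * (0 < r)%R%:R.
have g0 r : 0 <= g r.
  rewrite /g; have [r0|_] := ltP 0 r; last by rewrite mulr0.
  by rewrite mulr1 !mulr_ge0 ?exprn_ge0 ?powR_ge0 ?expR_ge0// ltW.
have mg : measurable_fun setT g.
  rewrite (_ : g = fun r => r ^+ p * r `^ alpha * gauss r * \1_(`]0, +oo[%classic) r); last first.
    by apply/funext => r; rewrite /g indicE mem_setE in_itv/= andbT.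
  apply: measurable_funM; last by apply: measurable_indic; exact: measurable_itv.
  apply: measurable_funM; last by apply: continuous_measurable_fun; exact: continuous_gauss.
  by apply: measurable_funM; [exact: measurable_funX|exact: measurable_powR].
have [C [C0 CP]] := polar_integral_radial n mg g0.
exists C; split => // F k mF F0 mk k0 Fk.
pose K := (fun z => k z * rho z) \_ hemi.
have mK : measurable_fun setT K.
  apply/(measurable_restrictT _ measurable_hemisphere).
  by apply: measurable_funM => //; exact: measurable_rho.
have K0 z : 0 <= K z.
  by rewrite /K patchE; case: ifPn => // /set_mem hz; rewrite mulr_ge0 ?k0 ?rho_ge0.
have -> : S k = (\int[@surface_measure R n.+1]_z (K z)%:E)%E.
  rewrite /wI integral_mkcond; apply: eq_integral => z _.
  by rewrite /K !patchE; case: ifP.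
rewrite -CP// /wI [RHS]integral_mkcond; apply: eq_integral => x _.
rewrite patchE; case: ifPn => [/set_mem x0|xn]; last first.
  rewrite /gweight indicE memNset ?mulr0// => /halfspace_enorm x0.
  by move: xn; rewrite notin_setE; exact.
congr EFin; rewrite /gweight indicE /K patchE.
have [xU|xU] := boolP (0 < x ord0 ord_max); last first.
  rewrite memNset ?memNset ?mulr0//; last by rewrite /halfspace/=; exact/negP.
  move=> [_]; rewrite mxE pmulr_rgt0 ?invr_gt0//; exact/negP.
have hx := halfspace_proj xU.
rewrite !mem_set// Fk// mulr1 /g /rho /sphere_proj mxE powRM ?invr_ge0 ?enorm_ge0 ?(ltW xU)//.
have -> : (enorm x)^-1 `^ alpha = (enorm x `^ alpha)^-1.
  rewrite -powR_inv1 ?enorm_ge0// -powRrM mulN1r powRN//.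
rewrite x0 /gauss enorm_sqr mulr1.
have : enorm x `^ alpha != 0 by rewrite gt_eqF ?powR_gt0.
by move=> ?; field.
Qed.

Let M := W (fun=> 1%R).

Let M_gt0 : (0 < M)%E. Proof. by have /andP[] := gauss_wI1_gt0_fin alpha1 n. Qed.
Let M_fin : (M < +oo)%E. Proof. by have /andP[] := gauss_wI1_gt0_fin alpha1 n. Qed.

(** For alpha < 0 the weight blows up at the equator; finiteness is inherited from the Gaussian
    mass, which is a multiple of the surface mass. *)
Lemma surface_mass_gt0_fin : (0 < S (fun=> 1%R) < +oo)%E.
Proof.
have [C [C0 CP]] := gauss_wI_homogeneous 0.
have S0 : (0 <= S (fun=> 1%R))%E by apply: wI_ge0 => //; exact: rho_ge0.
have E : M = (C * S (fun=> 1%R))%E.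
  by apply: CP => // x _; rewrite expr0 mulr1.
by apply: (mule_gt0_fin C0 S0); rewrite -E M_gt0 M_fin.
Qed.

Let S1_gt0 : (0 < S (fun=> 1%R))%E. Proof. by have /andP[] := surface_mass_gt0_fin. Qed.
Let S1_fin : (S (fun=> 1%R) < +oo)%E. Proof. by have /andP[] := surface_mass_gt0_fin. Qed.

Let sqr_enorm_half (x : 'rV[R]_n.+1) : halfspace x -> dot x x = enorm x ^+ 2 * 1.
Proof. by move=> _; rewrite enorm_sqr mulr1. Qed.

(* The three constants of gauss_wI_homogeneous for p = 0, 1, 2; the exact value
   of the last one relative to the first is that of the second moment. *)
Lemma gauss_sphere_constants : exists c0 c1 : R, [/\ 0 < c0, 0 < c1 &
  forall (F k : 'rV[R]_n.+1 -> R), measurable_fun setT F -> (forall x, 0 <= F x) ->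
    measurable_fun hemi k -> (forall z, hemi z -> 0 <= k z) ->
  [/\ (forall x, halfspace x -> F x = k (sphere_proj x)) -> W F = (c0%:E * S k)%E,
      (forall x, halfspace x -> F x = enorm x * k (sphere_proj x)) ->
        W F = (c1%:E * S k)%E &
      (forall x, halfspace x -> F x = enorm x ^+ 2 * k (sphere_proj x)) ->
        W F = (((n%:R + 1 + alpha) * c0)%:E * S k)%E]].
Proof.
have [C0 [C0_ge0 C0P]] := gauss_wI_homogeneous 0.
have [C1 [C1_ge0 C1P]] := gauss_wI_homogeneous 1.
have [C2 [C2_ge0 C2P]] := gauss_wI_homogeneous 2.
have m1 : measurable_fun hemi (fun=> 1 : R) by exact: measurable_cst.
have E0 : M = (C0 * S (fun=> 1%R))%E.
  by apply: C0P => // x _; rewrite expr0 mulr1.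
have E2 : W (fun x => dot x x) = (C2 * S (fun=> 1%R))%E.
  by apply: C2P => //; [exact: measurable_dot|exact: dot_ge0].
have E1 : W (fun x => enorm x) = (C1 * S (fun=> 1%R))%E.
  apply: C1P => //; [exact: measurable_enorm|exact: enorm_ge0|].
  by move=> x _; rewrite expr1 mulr1.
have /andP[C0_gt0 C0_fin] : (0 < C0 < +oo)%E.
  apply: (mule_gt0_fin (ltW S1_gt0) C0_ge0).
  by rewrite muleC -E0 M_gt0 M_fin.
have na0 : 0 < n%:R + 1 + alpha by rewrite -addrA ltr_wpDl// addrC -ltrBlDr sub0r.
have dotfin : (W (fun x => dot x x) < +oo)%E.
  by rewrite gauss_wI_dot// lte_mul_pinfty// lee_fin ltW.
have mgw := @measurable_gweight R alpha n.
have gw0 x : setT x -> 0 <= @gweight R alpha n x by move=> _; exact: gweight_ge0.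
have /andP[C2_gt0 C2_fin] : (0 < C2 < +oo)%E.
  apply: (mule_gt0_fin (ltW S1_gt0) C2_ge0).
  by rewrite muleC -E2 dotfin andbT gauss_wI_dot// mule_gt0.
have C1_fin : (C1 < +oo)%E.
  (* The bound |x| <= 1 + |x|^2 reduces this to the mass and the second moment. *)
  have : (W (fun x => enorm x) < +oo)%E.
    apply: (@le_lt_trans _ _ (W (fun x => 1 + dot x x)%R)).
      apply: le_wI => //; first exact: measurable_enorm.
        by apply: measurable_funD => //; exact: measurable_dot.
      move=> x _; rewrite enorm_ge0/= -enorm_sqr.
      have := sqr_ge0 (enorm x - 1); have := enorm_ge0 x; rewrite sqrrB1 -mulr_natl.
      set e := enorm x; set e2 := e ^+ 2; lra.
    rewrite ge0_wID//; first by rewrite lte_add_pinfty.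
      exact: measurable_dot.
    by move=> x _; exact: dot_ge0.
  rewrite E1; case: C1 C1_ge0 {C1P E1} => [c _ _||]//; first exact: ltry.
  by rewrite gt0_mulye.
have C1_gt0 : (0 < C1)%E.
  (* Were the constant 0, |x| times the weight would vanish almost everywhere. So would the weight,
     which lives where |x| > 0, and this contradicts the positivity of its mass. *)
  rewrite lt0e C1_ge0 andbT; apply/eqP => C1_eq0.
  have mT : measurable ([set: 'rV[R]_n.+1]) by [].
  have mgE := measurable_weighted mgw (@measurable_enorm R n.+1).
  have mg1 := measurable_weighted mgw (@measurable_cst _ _ _ _ setT (1 : R)).
  have /(ae_eq_integral_abs _ mT mgE) ae0 :
      (\int[lebesgue_row n.+1]_x `|(enorm x * gweight alpha x)%:E| = 0)%E.
    rewrite -[RHS](mul0e (S (fun=> 1%R))) -C1_eq0 -E1; apply: eq_integral => x _.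
    by rewrite gee0_abs// lee_fin mulr_ge0 ?enorm_ge0 ?gw0.
  suff /(ae_eq_integral_abs _ mT mg1) M0 :
      ae_eq (lebesgue_row n.+1) setT (fun x => (1 * gweight alpha x)%:E) (cst 0%E).
    move: M_gt0; rewrite /M /wI -M0 lt_neqAle => /andP[/eqP + _]; apply.
    by apply: eq_integral => x _; rewrite gee0_abs// lee_fin mulr_ge0 ?gw0.
  apply: filterS ae0 => x + _ => /(_ Logic.I) [/eqP].
  rewrite mul1r mulf_eq0 => /orP[/eqP x0|/eqP ->//]; congr EFin; apply/eqP.
  apply: contraT => gx; have /halfspace_enorm : halfspace x.
    by rewrite /halfspace/= -(gweight_gt0 alpha) lt0r gx gw0.
  by rewrite x0 ltxx.
have f0 : C0 \is a fin_num by rewrite ge0_fin_numE.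
have f1 : C1 \is a fin_num by rewrite ge0_fin_numE.
have f2 : C2 \is a fin_num by rewrite ge0_fin_numE.
have fS : S (fun=> 1%R) \is a fin_num by rewrite ge0_fin_numE ?ltW.
exists (fine C0), (fine C1); split; rewrite ?fine_gt0 ?C0_gt0 ?C1_gt0//.
(* The case k = 1 determines the ratio of the two constants, since the second moment is a known
   multiple of the mass. *)
have EC2 : C2 = ((n%:R + 1 + alpha) * fine C0)%:E.
  have : (C2 * S (fun=> 1%R) = (n%:R + 1 + alpha)%:E * (C0 * S (fun=> 1%R)))%E.
    by rewrite -E2 -E0 gauss_wI_dot.
  rewrite -(fineK f0) -(fineK f2) -(fineK fS) -!EFinM => -[h]; congr EFin.
  have s0 : fine (S (fun=> 1%R)) != 0 by rewrite gt_eqF// fine_gt0 ?S1_gt0.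
  by apply: (mulIf s0); rewrite h/=; ring.
move=> F k mF F0 mk k0; split => Fk.
- by rewrite fineK//; apply: C0P => // x xU; rewrite expr0 mul1r Fk.
- by rewrite fineK//; apply: C1P => // x xU; rewrite expr1 Fk.
- by rewrite -EC2; apply: C2P.
Qed.

End gauss_sphere.

(** * The inequality for smooth functions on the hemisphere *)

Section smooth_poincare.
Context {R : realType} (n : nat) (alpha : R).
Hypothesis alpha1 : -1 < alpha.
Let hemi := @hemisphere R n.
Let rho (z : 'rV[R]_n.+1) := z ord0 ord_max `^ alpha.
Notation S := (wI (@surface_measure R n.+1) (@hemisphere R n)
  (fun z : 'rV[R]_n.+1 => z ord0 ord_max `^ alpha)).
Notation W := (wI (lebesgue_row n.+1) setT (@gweight R alpha n)).
Let U := @halfspace R n.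

Lemma differentiable_dot m (x : 'rV[R]_m) :
  differentiable (fun y : 'rV[R]_m => dot y y) x.
Proof.
have -> : (fun y : 'rV[R]_m => dot y y) =
    \sum_(i < m) ((fun y : 'rV[R]_m => y ord0 i) * (fun y : 'rV[R]_m => y ord0 i)).
  by apply/funext => y; rewrite fct_sumE.
by apply: differentiable_sum => i; apply: differentiableM; exact: differentiable_coord.
Qed.

Lemma differentiable_enorm m (x : 'rV[R]_m) : 0 < enorm x ->
  differentiable (@enorm R m) x.
Proof.
move=> x0; have d0 : 0 < dot x x by rewrite -sqrtr_gt0.
apply: (@differentiable_comp _ _ _ _ (fun y : 'rV[R]_m => dot y y) Num.sqrt).
  exact: differentiable_dot.
by apply/derivable1_diffP; have [] := is_derive1_sqrt d0.
Qed.

Lemma open_halfspace : open U.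
Proof.
rewrite (_ : U = (fun x : 'rV[R]_n.+1 => x ord0 ord_max) @^-1` `]0, +oo[%classic).
  apply: open_comp; last exact: interval_open.
  by move=> x _; exact: coord_continuous.
by apply/seteqP; split => x /=; rewrite /U /halfspace/= in_itv/= andbT.
Qed.

Lemma hemi_halfspace : hemi `<=` U. Proof. by move=> z []. Qed.

Variable w : 'rV[R]_n.+1 -> R.
Hypothesis smooth_w : smooth_hemisphere w.
Let H := hext w.
Let DH i := 'D_(delta_mx ord0 i) H : 'rV[R]_n.+1 -> R.

Let dH x : U x -> differentiable H x.
Proof. exact: (smooth_w [::]). Qed.

Let dDH i x : U x -> differentiable (DH i) x.
Proof. exact: (smooth_w [:: i]). Qed.

Lemma measurable_smooth : measurable_fun hemi w.
Proof.
have mH : measurable_fun U H.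
  apply: continuous_measurable_row; first exact: open_halfspace.
  by move=> x /dH/differentiable_continuous.
apply: (eq_measurable_fun H); last first.
  by apply: measurable_funS mH; [exact: measurable_halfspace|exact: hemi_halfspace].
by move=> z /set_mem[z1 _]; rewrite /H hext_sphere.
Qed.

Lemma measurable_grad i : measurable_fun hemi (fun z => grad_sphere w z ord0 i).
Proof.
have mD : measurable_fun U (DH i).
  apply: continuous_measurable_row; first exact: open_halfspace.
  by move=> x /(dDH i)/differentiable_continuous.
have -> : (fun z => grad_sphere w z ord0 i) = DH i by apply/funext => z; rewrite mxE.
by apply: measurable_funS mD; [exact: measurable_halfspace|exact: hemi_halfspace].
Qed.

Lemma measurable_grad_sqr : measurable_fun hemi (fun z => dot (grad_sphere w z) (grad_sphere w z)).
Proof.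
by apply: measurable_sum => i; apply: measurable_funM; exact: measurable_grad.
Qed.

Section extension.
Variable m : R.
Let F0 (x : 'rV[R]_n.+1) := enorm x * (H x - m).
Let g0 i (x : 'rV[R]_n.+1) := x ord0 i / enorm x * (H x - m) + enorm x * DH i x.
(** Extension by 0 gives functions measurable on the whole space; the weight ignores what happens
    outside the half-space. *)
Let F := F0 \_ U.
Let g i := g0 i \_ U.

Let cst_diff (x : 'rV[R]_n.+1) : differentiable (fun _ : 'rV[R]_n.+1 => m) x.
Proof. exact: differentiable_cst. Qed.

Let dF0 x : U x -> differentiable F0 x.
Proof.
move=> xU; apply: differentiableM; first exact: differentiable_enorm (halfspace_enorm xU).
by apply: differentiableB; [exact: dH|exact: cst_diff].
Qed.

Let dg0 i x : U x -> differentiable (g0 i) x.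
Proof.
move=> xU; have e0 := halfspace_enorm xU.
have de := differentiable_enorm e0.
apply: differentiableD; apply: differentiableM => //.
- apply: differentiableM; first exact: differentiable_coord.
  by apply: differentiableV => //; rewrite gt_eqF.
- by apply: differentiableB; [exact: dH|exact: cst_diff].
- exact: dDH.
Qed.

Let mF : measurable_fun setT F.
Proof.
apply/(measurable_restrictT _ (@measurable_halfspace R n)).
apply: continuous_measurable_row; first exact: open_halfspace.
by move=> x /dF0/differentiable_continuous.
Qed.

Let mg i : measurable_fun setT (g i).
Proof.
apply/(measurable_restrictT _ (@measurable_halfspace R n)).
apply: continuous_measurable_row; first exact: open_halfspace.
by move=> x /(dg0 i)/differentiable_continuous.
Qed.

Let FE x : U x -> F x = F0 x.
Proof. by move=> xU; rewrite /F patchE mem_set. Qed.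

Let gE i x : U x -> g i x = g0 i x.
Proof. by move=> xU; rewrite /g patchE mem_set. Qed.

Let nearU x : U x -> \forall y \near x, U y.
Proof. by move=> xU; apply: open_nbhs_nbhs; split => //; exact: open_halfspace. Qed.

Let is_derive_F x : U x -> forall i, is_derive x (delta_mx ord0 i) F (g i x).
Proof.
move=> xU i; apply: (@near_eq_is_derive _ _ _ F0).
  by near=> y; rewrite FE//; near: y; exact: nearU.
have e0 := halfspace_enorm xU.
have de := is_derive_enorm (delta_mx ord0 i) e0.
have dHx0 : derivable H x (delta_mx ord0 i) by apply: diff_derivable; exact: dH.
have dHx := derivableP dHx0.
rewrite gE//.
apply: (is_derive_eq (is_deriveM de (is_deriveB dHx (is_derive_cst m x _)))).
rewrite dot_delta /g0 subr0 /GRing.scale/= -/(DH i x) /DH.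
by rewrite addrC mulrC.
Unshelve. all: by end_near. Qed.

Let line_continuous_g x : U x -> forall i,
  {for 0, continuous (fun t : R => g i (t *: delta_mx ord0 i + x))}.
Proof.
move=> xU i.
have cg : {for x, continuous (g i)}.
  rewrite /prop_for /continuous_at gE//.
  have E : {near x, g0 i =1 g i}.
    by near=> y; rewrite gE//; near: y; exact: nearU.
  exact: cvg_trans (near_eq_cvg E) (differentiable_continuous (dg0 i xU)).
have cl : {for (0 : R), continuous (fun t : R => t *: delta_mx ord0 i + x : 'rV[R]_n.+1)}.
  apply: continuousD; last exact: cst_continuous.
  exact: scalel_continuous.
apply: (continuous_comp cl) => /=.
by rewrite scale0r add0r.
Unshelve. all: by end_near. Qed.

(** At x the gradient of F is (w - m) z + grad_S w, evaluated at z = x/|x|. Since |z| = 1 and the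
    cross term is 0 by [hext_euler], the squares add up. *)
Let sum_g_sqr x : U x -> \sum_i g i x ^+ 2 =
  (w (sphere_proj x) - m) ^+ 2 +
  dot (grad_sphere w (sphere_proj x)) (grad_sphere w (sphere_proj x)).
Proof.
move=> xU; have e0 := halfspace_enorm xU.
have zU : U (sphere_proj x) by have [] := halfspace_proj xU.
set z := sphere_proj x; set a := w z - m; set G := grad_sphere w z.
have gi i : g i x = z ord0 i * a + G ord0 i.
  have [_ dHi] := hext_derive i e0 (dH zU).
  rewrite gE// /g0 /DH dHi -/G mulrA mulfV ?gt_eqF// mul1r.
  by have -> : z ord0 i = x ord0 i / enorm x by rewrite /z mxE mulrC.
have z1 : dot z z = 1 by rewrite -enorm_sqr enorm_sphere_proj ?expr1n.
have zG : \sum_i z ord0 i * G ord0 i = 0.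
  by rewrite -[RHS](hext_euler (dH zU)); apply: eq_bigr => i _; rewrite /G [X in _ * X]mxE.
transitivity (\sum_i (a ^+ 2 * (z ord0 i * z ord0 i) +
    (2 * a * (z ord0 i * G ord0 i) + G ord0 i * G ord0 i))).
  by apply: eq_bigr => i _; rewrite gi; ring.
rewrite big_split/= -mulr_sumr -/(dot z z) z1 mulr1; congr (_ + _).
by rewrite big_split/= -mulr_sumr zG mulr0 add0r.
Qed.

Let mgw := @measurable_gweight R alpha n.
Let gw0 x : setT x -> 0 <= @gweight R alpha n x.
Proof. by move=> _; exact: gweight_ge0. Qed.
Let mrho : measurable_fun hemi rho. Proof. exact: measurable_rho. Qed.
Let rho0 z : hemi z -> 0 <= rho z. Proof. exact: rho_ge0. Qed.

Hypothesis w_L2 : wL2 (@surface_measure R n.+1) hemi rho w.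
Hypothesis mean_w : wE (@surface_measure R n.+1) hemi rho (fun z => w z - m) = 0.

Lemma mean0_poincare :
  ((n%:R + alpha)%:E * S (fun z => (w z - m) ^+ 2)%R <=
   S (fun z => dot (grad_sphere w z) (grad_sphere w z)))%E.
Proof.
have mhemi : measurable hemi := @measurable_hemisphere R n.
have /andP[S1_gt0 S1_fin] := surface_mass_gt0_fin n alpha1.
have /andP[M_gt0 M_fin] := gauss_wI1_gt0_fin alpha1 n.
have [c0 [c1 [c0_gt0 _ cP]]] := gauss_sphere_constants n alpha1.
have lwm : wL2 (@surface_measure R n.+1) hemi rho (fun z => w z - m).
  apply: wL2B => //; apply: wL2_cst => //.
have [mwm wm_fin] := lwm.
have mwm2 : measurable_fun hemi (fun z => (w z - m) ^+ 2) by exact: measurable_funX.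
have mF2 : measurable_fun setT (fun x => F x ^+ 2) by exact: measurable_funX.
have [_ _ WF2] := cP _ _ mF2 (fun x => sqr_ge0 _) mwm2 (fun z _ => sqr_ge0 _).
have {}WF2 : W (fun x => F x ^+ 2)%R =
    (((n%:R + 1 + alpha) * c0)%:E * S (fun z => (w z - m) ^+ 2)%R)%E.
  by apply: WF2 => x xU; rewrite FE// /F0 exprMn.
have na0 : 0 < n%:R + 1 + alpha by rewrite -addrA ltr_wpDl// addrC -ltrBlDr sub0r.
have WF2_fin : (W (fun x => F x ^+ 2)%R < +oo)%E.
  by rewrite WF2 lte_mul_pinfty// lee_fin mulr_ge0 ?ltW.
have LF : wL2 (lebesgue_row n.+1) setT (@gweight R alpha n) F by split.
have LF1 := wL2_L1 measurableT mgw gw0 M_fin LF.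
have max0 (t : R) : 0 <= Num.max t 0 by rewrite le_max lexx orbT.
(* sg = 1 and sg = -1 give the positive and negative parts; taking them commutes with the factor
   |x|, which is nonnegative. *)
have Wpart (sg : R) : W (fun x => Num.max (sg * F x) 0)%R =
    (c1%:E * S (fun z => Num.max (sg * (w z - m)) 0)%R)%E.
  have mFs : measurable_fun setT (fun x => Num.max (sg * F x) 0).
    by apply: measurable_maxr => //; exact: measurable_funM.
  have mws : measurable_fun hemi (fun z => Num.max (sg * (w z - m)) 0).
    by apply: measurable_maxr => //; exact: measurable_funM.
  have [_ + _] := cP _ _ mFs (fun x => max0 _) mws (fun z _ => max0 _).
  apply => x xU; rewrite FE// /F0 mulrCA -[X in Num.max _ X](mulr0 (enorm x)).
  by rewrite maxr_pMr ?enorm_ge0.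
have LFs sg := wL2_max measurableT mgw gw0 (wL2Z measurableT mgw gw0 sg LF).
have Lws sg := wL2_max mhemi mrho rho0 (wL2Z mhemi mrho rho0 sg lwm).
have mean_F : wE (lebesgue_row n.+1) setT (@gweight R alpha n) F = 0.
  rewrite (wE_maxB measurableT mgw gw0 M_fin LF).
  have := mean_w; rewrite (wE_maxB mhemi mrho rho0 S1_fin lwm) => /eqP.
  rewrite subr_eq0 => /eqP E; apply/eqP; rewrite subr_eq0; apply/eqP.
  rewrite /wE; congr fine.
  under eq_wI do rewrite -[F _]mul1r; rewrite Wpart.
  under [RHS]eq_wI do rewrite -mulN1r; rewrite Wpart; congr (_ * _)%E.
  have L1 := wL2_L1 mhemi mrho rho0 S1_fin (Lws 1).
  have LN1 := wL2_L1 mhemi mrho rho0 S1_fin (Lws (-1)).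
  rewrite (wIE mhemi L1) (wIE mhemi LN1); congr EFin.
  under [X in wE _ _ _ X]eq_fun do rewrite mul1r.
  by under [X in _ = wE _ _ _ X]eq_fun do rewrite mulN1r.
have [c hc] := gauss_poincare alpha1 mF mg is_derive_F line_continuous_g WF2_fin.
have lFc : wL2 (lebesgue_row n.+1) setT (@gweight R alpha n) (fun x => F x - c).
  by apply: wL2B => //; exact: wL2_cst.
(* The constant c is unknown, but F has mean 0, so 0 is at least as good a constant as c. *)
have {hc} : (W (fun x => F x ^+ 2)%R <= W (fun x => \sum_i g i x ^+ 2)%R)%E.
  apply: le_trans hc.
  rewrite (wIE measurableT (wL2_sqr mgw gw0 LF)) (wIE measurableT (wL2_sqr mgw gw0 lFc)).
  rewrite lee_fin wE_sqrB// mean_F mulr0 subr0 lerDl mulr_ge0 ?sqr_ge0//.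
  exact: wE_ge0.
have mk : measurable_fun hemi (fun z => (w z - m) ^+ 2 +
    dot (grad_sphere w z) (grad_sphere w z)).
  by apply: measurable_funD => //; exact: measurable_grad_sqr.
have mg2 : measurable_fun setT (fun x => \sum_i g i x ^+ 2).
  by apply: measurable_sum => i; exact: measurable_funX.
have [+ _ _] := cP _ _ mg2 (fun x => sumr_ge0 _ (fun i _ => sqr_ge0 _)) mk
  (fun z _ => addr_ge0 (sqr_ge0 _) (dot_ge0 _)).
move=> ->; last exact: sum_g_sqr.
rewrite WF2 ge0_wID//; last 3 first.
- exact: measurable_grad_sqr.
- by move=> z _; exact: sqr_ge0.
- by move=> z _; exact: dot_ge0.
have : (0 <= S (fun z => dot (grad_sphere w z) (grad_sphere w z)))%E.
  by apply: (wI_ge0 _ rho0) => z _; exact: dot_ge0.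
rewrite (wIE mhemi (wL2_sqr mrho rho0 lwm)).
(* An infinite gradient norm makes the claim trivial. Otherwise the factor c0 cancels and (n + 1 +
   alpha) s <= s + v remains. *)
case: (S (fun z => dot _ _)) => [v| |]// v0; last by rewrite leey.
rewrite -!EFinD -!EFinM !lee_fin => h.
rewrite -(ler_pM2l c0_gt0); set s := wE _ _ _ _ in h *; lra.
Qed.

End extension.

End smooth_poincare.

(** The difference g - f vanishes near x, so its differential there is 0. Iterated partial
    derivatives are identified only on open sets, hence the need for a local statement. *)
Lemma near_eq_differentiable (R : realType) (V : normedModType R) (f g : V -> R) (x : V) :
  {near x, f =1 g} -> differentiable f x -> differentiable g x.
Proof.
move=> fg df; pose h : V -> R := g - f.
have h0 : \forall y \near x, h y = 0.
  by apply: filterS fg => y fgy; rewrite -[LHS]/(g y - f y) fgy subrr.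
have sh : (fun y => y + x) @ (0 : V) --> x.
  by rewrite -[X in _ --> X](add0r x); apply: cvgD; [exact: cvg_id|exact: cvg_cst].
have h0x : \forall y \near (0 : V), h (y + x) = 0 by exact: sh h0.
have ho : h \o shift x = cst (h x) + (\0 : {linear V -> R}) +o_ (0 : V) id.
  apply/eqaddoP => _/posnumP[e]; near=> y.
  rewrite -[(_ - _) y]/(h (y + x) - (h x + 0)) (nbhs_singleton h0).
  have -> : h (y + x) = 0 by near: y.
  by rewrite addr0 subr0 normr0 mulr_ge0.
have dh : differentiable h x.
  apply/diff_locallyP; rewrite (diff_unique (df := \0 : {linear V -> R})) //.
    by split => //; exact: cst_continuous.
  exact: cst_continuous.
have -> : g = f + h by apply/funext => y; rewrite -[RHS]/(f y + (g y - f y)) addrC subrK.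
exact: differentiableD.
Unshelve. all: by end_near. Qed.

Lemma smooth_on_affine (R : realType) n (U : set 'rV[R]_n) (f g : 'rV[R]_n -> R)
    (t c : R) : open U -> smooth_on U f -> smooth_on U g ->
  smooth_on U (fun x => f x + t * (g x - c)).
Proof.
move=> oU sf sg.
(* The subtracted constant survives only when no derivative has been taken. *)
pose a (s : seq 'I_n) := if s is [::] then c else 0.
have nearU x : U x -> \forall y \near x, U y.
  by move=> Ux; apply: open_nbhs_nbhs; split.
pose L s x := iter_partial s f x + t * (iter_partial s g x - a s).
have dL s x : U x -> differentiable (L s) x.
  move=> Ux; apply: differentiableD; first exact: sf.
  apply: differentiableM; first exact: differentiable_cst.
  by apply: differentiableB; [exact: sg|exact: differentiable_cst].
have E s x : U x -> iter_partial s (fun x => f x + t * (g x - c)) x = L s x.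
  elim: s x => [//|i s ih] x Ux /=.
  rewrite (@near_eq_derive _ _ _ _ (L s)); last first.
    by near=> y; apply: ih; near: y; exact: nearU.
  have df : derivable (iter_partial s f) x (delta_mx ord0 i).
    by apply: diff_derivable; exact: sf.
  have dg : derivable (iter_partial s g) x (delta_mx ord0 i).
    by apply: diff_derivable; exact: sg.
  have := is_deriveD (derivableP df)
    (is_deriveM (is_derive_cst t x (delta_mx ord0 i))
      (is_deriveB (derivableP dg) (is_derive_cst (a s) x (delta_mx ord0 i)))).
  case=> _ ->; rewrite /L /= /GRing.scale/= mulr0 addr0 !subr0.
  by [].
move=> s x Ux; apply: (near_eq_differentiable _ (dL s x Ux)).
by near=> y; rewrite E//; near: y; exact: nearU.
Unshelve. all: by end_near. Qed.

Section sobolev.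
Context {R : realType} (n : nat) (alpha : R).
Hypothesis alpha1 : -1 < alpha.
Let hemi := @hemisphere R n.
Let rho (z : 'rV[R]_n.+1) := z ord0 ord_max `^ alpha.
Notation S := (wI (@surface_measure R n.+1) (@hemisphere R n)
  (fun z : 'rV[R]_n.+1 => z ord0 ord_max `^ alpha)).
Implicit Types (u w : 'rV[R]_n.+1 -> R) (V : 'rV[R]_n.+1 -> 'rV[R]_n.+1).

Lemma wintE u : wint alpha u = S u. Proof. by []. Qed.
Lemma sqnormE u : sqnorm alpha u = S (fun z => u z ^+ 2). Proof. by []. Qed.
Lemma sqnormvE V : sqnormv alpha V = S (fun z => dot (V z) (V z)). Proof. by []. Qed.

Lemma smooth_hemisphere_affine u w (t c : R) :
  smooth_hemisphere u -> smooth_hemisphere w ->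
  smooth_hemisphere (fun z => u z + t * (w z - c)).
Proof. by move=> su sw; apply: smooth_on_affine => //; exact: open_halfspace. Qed.

Lemma grad_sphere_affine u w (t c : R) z :
  smooth_hemisphere u -> smooth_hemisphere w -> hemi z ->
  grad_sphere (fun z => u z + t * (w z - c)) z = grad_sphere u z + t *: grad_sphere w z.
Proof.
move=> su sw [_ zU]; apply/rowP => i; rewrite !mxE.
have du : derivable (hext u) z (delta_mx ord0 i) by apply: diff_derivable; exact: (su [::]).
have dw : derivable (hext w) z (delta_mx ord0 i) by apply: diff_derivable; exact: (sw [::]).
have := is_deriveD (derivableP du)
  (is_deriveM (is_derive_cst t z (delta_mx ord0 i))
    (is_deriveB (derivableP dw) (is_derive_cst c z (delta_mx ord0 i)))).
case=> _ E; apply: etrans E _.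
by rewrite /GRing.scale/= mulr0 addr0 subr0.
Qed.

Lemma measurable_dot_comp V V' : measurable_fun hemi V -> measurable_fun hemi V' ->
  measurable_fun hemi (fun z => dot (V z) (V' z)).
Proof.
move=> mV mV'; apply: measurable_sum => i.
by apply: measurable_funM; exact: measurableT_comp (measurable_coord i) _.
Qed.

Lemma measurable_grad_sphere w : smooth_hemisphere w -> measurable_fun hemi (grad_sphere w).
Proof.
move=> sw; apply: measurable_fun_rowP; first exact: measurable_hemisphere.
by move=> i; exact: measurable_grad.
Qed.

End sobolev.

(** * The Sobolev space *)

(** The difference of the two sides is (e a - b)^2 / e. This plays the role of the triangle
    inequality while staying with squared norms. *)
Lemma sqrD_young (R : realFieldType) (a b e : R) : 0 < e ->
  (a + b) ^+ 2 <= (1 + e) * a ^+ 2 + (1 + e^-1) * b ^+ 2.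
Proof.
move=> e0; rewrite -subr_ge0.
have -> : (1 + e) * a ^+ 2 + (1 + e^-1) * b ^+ 2 - (a + b) ^+ 2 = (e * a - b) ^+ 2 / e.
  by field; rewrite gt_eqF.
by rewrite divr_ge0 ?sqr_ge0// ltW.
Qed.

Lemma dotD_young (R : realType) n (x y : 'rV[R]_n) (e : R) : 0 < e ->
  dot (x + y) (x + y) <= (1 + e) * dot x x + (1 + e^-1) * dot y y.
Proof.
move=> e0; rewrite /dot !mulr_sumr -big_split/=; apply: ler_sum => i _.
by rewrite !mxE -!expr2 sqrD_young.
Qed.

Section sobolev_poincare.
Context {R : realType} (n : nat) (alpha : R).
Hypothesis alpha1 : -1 < alpha.
Hypothesis mu_ge0 : 0 <= n%:R + alpha.
Let hemi := @hemisphere R n.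
Let rho (z : 'rV[R]_n.+1) := z ord0 ord_max `^ alpha.
Notation S := (wI (@surface_measure R n.+1) (@hemisphere R n)
  (fun z : 'rV[R]_n.+1 => z ord0 ord_max `^ alpha)).
Notation L2 := (wL2 (@surface_measure R n.+1) (@hemisphere R n)
  (fun z : 'rV[R]_n.+1 => z ord0 ord_max `^ alpha)).
Notation E := (wE (@surface_measure R n.+1) (@hemisphere R n)
  (fun z : 'rV[R]_n.+1 => z ord0 ord_max `^ alpha)).
Implicit Types (u w : 'rV[R]_n.+1 -> R) (V : 'rV[R]_n.+1 -> 'rV[R]_n.+1).

Let mhemi : measurable hemi. Proof. exact: measurable_hemisphere. Qed.
Let mrho : measurable_fun hemi rho. Proof. exact: measurable_rho. Qed.
Let rho0 z : hemi z -> 0 <= rho z. Proof. exact: rho_ge0. Qed.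
Let S1_fin : (S (fun=> 1%R) < +oo)%E.
Proof. by have /andP[] := surface_mass_gt0_fin n alpha1. Qed.
Let S1_gt0 : (0 < S (fun=> 1%R))%E.
Proof. by have /andP[] := surface_mass_gt0_fin n alpha1. Qed.

Lemma S_young (f g h : 'rV[R]_n.+1 -> R) (e : R) : 0 < e ->
  measurable_fun hemi f -> measurable_fun hemi g -> measurable_fun hemi h ->
  (forall z, 0 <= f z) -> (forall z, 0 <= g z) -> (forall z, 0 <= h z) ->
  (forall z, hemi z -> h z <= (1 + e) * f z + (1 + e^-1) * g z) ->
  (S h <= (1 + e)%:E * S f + (1 + e^-1)%:E * S g)%E.
Proof.
move=> e0 mf mg mh f0 g0 h0 hfg.
have e1 : 0 <= 1 + e by rewrite addr_ge0// ltW.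
have e2 : 0 <= 1 + e^-1 by rewrite addr_ge0// invr_ge0 ltW.
have m1 : measurable_fun hemi (fun z => (1 + e) * f z) by exact: measurable_funM.
have m2 : measurable_fun hemi (fun z => (1 + e^-1) * g z) by exact: measurable_funM.
have n1 z : hemi z -> 0 <= (1 + e) * f z by rewrite mulr_ge0.
have n2 z : hemi z -> 0 <= (1 + e^-1) * g z by rewrite mulr_ge0.
rewrite -(ge0_wIZ _ mhemi mrho rho0 mf (fun z _ => f0 z) e1).
rewrite -(ge0_wIZ _ mhemi mrho rho0 mg (fun z _ => g0 z) e2).
rewrite -(ge0_wID _ mhemi mrho rho0 m1 m2 n1 n2).
apply: (le_wI _ mhemi mrho rho0 mh); first exact: measurable_funD.
by move=> z hz; rewrite h0 hfg.
Qed.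

Lemma sobolev_poincare u V : sobolev alpha u V -> wint alpha u = 0%E ->
  ((n%:R + alpha)%:E * sqnorm alpha u <= sqnormv alpha V)%E.
Proof.
move=> [mu mV uoo Voo [w [sw cu cV]]] u0.
have Lu : L2 u by [].
have mVV : measurable_fun hemi (fun z => dot (V z) (V z)) by exact: measurable_dot_comp.
have LVV := wL1_ge0 mrho rho0 mVV (fun z _ => dot_ge0 _) Voo.
have Lu2 := wL2_sqr mrho rho0 Lu.
rewrite sqnormE sqnormvE (wIE mhemi Lu2) (wIE mhemi LVV) -EFinM lee_fin.
set s := E _; set v := E _.
have s0 : 0 <= s by apply: (wE_ge0 _ rho0) => z _; exact: sqr_ge0.
have v0 : 0 <= v by apply: (wE_ge0 _ rho0) => z _; exact: dot_ge0.
pose m := n%:R + alpha.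
(* An approximant within e^2 in both squared norms is compared with u by Young's inequality with
   parameter e. The errors are of order (1 + e^-1) e^2 = e^2 + e, which tends to 0. *)
have key (e : R) : 0 < e -> m * s <=
    (1 + e) * ((1 + e) * v + (1 + e^-1) * e ^+ 2) + m * ((1 + e^-1) * e ^+ 2).
  move=> e0; have e20 : 0 < e ^+ 2 by rewrite exprn_gt0.
  have [k [ku kV]] : exists k, (sqnorm alpha (fun z => w k z - u z)%R < (e ^+ 2)%:E)%E /\
      (sqnormv alpha (fun z => grad_sphere (w k) z - V z)%R < (e ^+ 2)%:E)%E.
    have h1 : \forall k \near \oo, (sqnorm alpha (fun z => w k z - u z)%R < (e ^+ 2)%:E)%E.
      apply: (cu [set y | (y < (e ^+ 2)%:E)%E]); apply: open_nbhs_nbhs.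
      by split; [exact: open_ereal_lt_ereal|rewrite /= lte_fin].
    have h2 : \forall k \near \oo, (sqnormv alpha (fun z => grad_sphere (w k) z - V z)%R < (e ^+ 2)%:E)%E.
      apply: (cV [set y | (y < (e ^+ 2)%:E)%E]); apply: open_nbhs_nbhs.
      by split; [exact: open_ereal_lt_ereal|rewrite /= lte_fin].
    by have [k _ /(_ k (leqnn k))] := filterI h1 h2; exists k.
  set b := E (fun z => (w k z - u z) ^+ 2).
  have mwk : measurable_fun hemi (w k) by exact: measurable_smooth.
  have Lwu : L2 (fun z => w k z - u z).
    by split; [exact: measurable_funB|exact: lt_trans ku (ltry _)].
  have Lw : L2 (w k).
    have -> : w k = (fun z => (w k z - u z) + u z) by apply/funext => z; rewrite subrK.
    exact: wL2D.
  have L1w := wL2_L1 mhemi mrho rho0 S1_fin Lw.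
  have Lc c : L2 (fun=> c) := wL2_cst mhemi mrho rho0 S1_fin c.
  have L1c c := wL2_L1 mhemi mrho rho0 S1_fin (Lc c).
  pose mk := E (w k) / E (fun=> 1).
  have mean_w : E (fun z => w k z - mk) = 0.
    rewrite (wEB mhemi L1w (L1c mk)).
    have -> : E (fun=> mk) = mk * E (fun=> 1).
      by rewrite -(wEZ mhemi mk (L1c 1)); congr wE; apply/funext => z; rewrite mulr1.
    by rewrite /mk divfK ?subrr// gt_eqF// wE1_gt0.
  have Lwm : L2 (fun z => w k z - mk) by exact: wL2B.
  have Lum : L2 (fun z => u z - mk) by exact: wL2B.
  have mgw := measurable_grad_sphere (sw k).
  have mgg : measurable_fun hemi (fun z => dot (grad_sphere (w k) z) (grad_sphere (w k) z)).
    exact: measurable_dot_comp.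
  have mgV : measurable_fun hemi (fun z => grad_sphere (w k) z - V z).
    apply: measurable_fun_rowP => // i.
    have -> : (fun z => (grad_sphere (w k) z - V z) ord0 i) =
        (fun z => grad_sphere (w k) z ord0 i - V z ord0 i).
      by apply/funext => z; rewrite mxE [X in _ + X]mxE.
    by apply: measurable_funB; exact: (measurableT_comp (measurable_coord i)).
  have mgVgV : measurable_fun hemi
      (fun z => dot (grad_sphere (w k) z - V z) (grad_sphere (w k) z - V z)).
    exact: measurable_dot_comp.
  have LgV := wL1_ge0 mrho rho0 mgVgV (fun z _ => dot_ge0 _) (lt_trans kV (ltry _)).
  have P := mean0_poincare alpha1 (sw k) Lw mean_w.
  have Y1 := @S_young (fun z => dot (V z) (V z)) _ (fun z => dot (grad_sphere (w k) z)
    (grad_sphere (w k) z)) e e0 mVV mgVgV mgg (fun z => dot_ge0 _) (fun z => dot_ge0 _)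
    (fun z => dot_ge0 _).
  have {}Y1 := le_trans P (Y1 _).
  have Y2 := @S_young (fun z => (w k z - mk) ^+ 2) (fun z => (w k z - u z) ^+ 2)
    (fun z => (u z - mk) ^+ 2) e e0 (measurable_funX _ Lwm.1) (measurable_funX _ Lwu.1)
    (measurable_funX _ Lum.1) (fun z => sqr_ge0 _) (fun z => sqr_ge0 _) (fun z => sqr_ge0 _).
  have {Y1} : (m%:E * S (fun z => (w k z - mk) ^+ 2)%R <=
      (1 + e)%:E * S (fun z => dot (V z) (V z)) + (1 + e^-1)%:E *
      S (fun z => dot (grad_sphere (w k) z - V z) (grad_sphere (w k) z - V z))%R)%E.
    apply: Y1 => z _; rewrite -[X in dot X X](subrKC (V z)).
    exact: dotD_young.
  have {Y2} : (S (fun z => (u z - mk) ^+ 2)%R <=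
      (1 + e)%:E * S (fun z => (w k z - mk) ^+ 2)%R + (1 + e^-1)%:E *
      S (fun z => (w k z - u z) ^+ 2)%R)%E.
    apply: Y2 => z _.
    have -> : u z - mk = (w k z - mk) + - (w k z - u z) by ring.
    by rewrite -[X in _ + _ * X]sqrrN sqrD_young.
  move: ku kV; rewrite sqnormE sqnormvE.
  rewrite (wIE mhemi (wL2_sqr mrho rho0 Lwu)) (wIE mhemi (wL2_sqr mrho rho0 Lwm)).
  rewrite (wIE mhemi (wL2_sqr mrho rho0 Lum)) (wIE mhemi LgV) (wIE mhemi LVV).
  rewrite -!EFinM -!EFinD !lte_fin !lee_fin -/v -/b.
  set a := E (fun z => (w k z - mk) ^+ 2).
  set c := E (fun z => dot (_ - _) _).
  (* As u has mean 0, shifting it by the mean mk of the approximant can only increase its norm; the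
     convergence of mk to 0 is thus bypassed. *)
  have -> : E (fun z => (u z - mk) ^+ 2) = s + mk ^+ 2 * E (fun=> 1).
    by rewrite (wE_sqrB mhemi mrho rho0 S1_fin)// {2}/wE -wintE u0/= mulr0 subr0.
  move=> be ce h1 h2.
  have h3 : s <= (1 + e) * a + (1 + e^-1) * b.
    apply: le_trans h1; rewrite lerDl mulr_ge0 ?sqr_ge0//.
    exact: wE_ge0.
  have e1 : 0 < 1 + e by rewrite addr_gt0.
  have e2 : 0 < 1 + e^-1 by rewrite addr_gt0// invr_gt0.
  apply: le_trans (ler_wpM2l mu_ge0 h3) _; rewrite mulrDr; apply: lerD.
    rewrite mulrCA ler_wpM2l ?(ltW e1)//; apply: le_trans h2 _.
    by rewrite lerD2l ler_wpM2l ?ltW.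
  by rewrite ler_wpM2l// ler_wpM2l ?ltW.
apply/ler_addgt0Pr => e e0.
(* For d <= 1 this bounds the coefficient of d in the estimate [key d], which is (2 + d) v + (1 +
   d)^2 + m (1 + d). *)
pose C := 3 * v + 4 + 2 * m.
have C0 : 0 < C by rewrite /C; have := mu_ge0; rewrite -/m; lra.
pose d := Num.min 1 (e / C).
have d0 : 0 < d by rewrite lt_min ltr01 divr_gt0.
have d1 : d <= 1 by rewrite ge_min lexx.
have dC : d * C <= e by rewrite -ler_pdivlMr// ge_min lexx orbT.
apply: le_trans (key d d0) _.
have -> : (1 + d) * ((1 + d) * v + (1 + d^-1) * d ^+ 2) + m * ((1 + d^-1) * d ^+ 2) =
    v + d * ((2 + d) * v + (1 + d) ^+ 2 + m * (1 + d)).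
  by field; rewrite gt_eqF.
rewrite lerD2l; apply: le_trans dC; rewrite ler_wpM2l ?(ltW d0)//.
have m0 : 0 <= m by [].
have d2 : (1 + d) ^+ 2 <= 4.
  have -> : 4 = 2 ^+ 2 :> R by ring.
  by rewrite lerXn2r ?nnegrE//; lra.
have h1 : (2 + d) * v <= 3 * v by rewrite ler_wpM2r//; lra.
have h2 : m * (1 + d) <= 2 * m by rewrite mulrC ler_wpM2r//; lra.
by rewrite /C !lerD.
Qed.

End sobolev_poincare.

(** * The weak equation satisfied by a minimizer *)

Section weak_equation.
Context {R : realType} (n : nat) (alpha : R).
Hypothesis alpha1 : -1 < alpha.
Hypothesis mu_ge0 : 0 <= n%:R + alpha.
Let hemi := @hemisphere R n.
Let rho (z : 'rV[R]_n.+1) := z ord0 ord_max `^ alpha.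
Notation S := (wI (@surface_measure R n.+1) (@hemisphere R n)
  (fun z : 'rV[R]_n.+1 => z ord0 ord_max `^ alpha)).
Notation L1 := (wL1 (@surface_measure R n.+1) (@hemisphere R n)
  (fun z : 'rV[R]_n.+1 => z ord0 ord_max `^ alpha)).
Notation L2 := (wL2 (@surface_measure R n.+1) (@hemisphere R n)
  (fun z : 'rV[R]_n.+1 => z ord0 ord_max `^ alpha)).
Notation E := (wE (@surface_measure R n.+1) (@hemisphere R n)
  (fun z : 'rV[R]_n.+1 => z ord0 ord_max `^ alpha)).
Implicit Types (u v w : 'rV[R]_n.+1 -> R) (V W : 'rV[R]_n.+1 -> 'rV[R]_n.+1).

Let mhemi : measurable hemi. Proof. exact: measurable_hemisphere. Qed.
Let mrho : measurable_fun hemi rho. Proof. exact: measurable_rho. Qed.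
Let rho0 z : hemi z -> 0 <= rho z. Proof. exact: rho_ge0. Qed.
Let S1_fin : (S (fun=> 1%R) < +oo)%E.
Proof. by have /andP[] := surface_mass_gt0_fin n alpha1. Qed.
Let S1_gt0 : (0 < S (fun=> 1%R))%E.
Proof. by have /andP[] := surface_mass_gt0_fin n alpha1. Qed.

Lemma wL2_coord V i : measurable_fun hemi V -> (sqnormv alpha V < +oo)%E ->
  L2 (fun z => V z ord0 i).
Proof.
move=> mV Voo; have mVi : measurable_fun hemi (fun z => V z ord0 i).
  exact: (measurableT_comp (measurable_coord i)).
split => //; apply: le_lt_trans Voo; rewrite sqnormvE.
apply: (le_wI _ mhemi mrho rho0); first exact: measurable_funX.
  exact: measurable_dot_comp.
move=> z _; rewrite sqr_ge0/= /dot (bigD1 i)//= -expr2 lerDl sumr_ge0// => j _.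
by rewrite -expr2 sqr_ge0.
Qed.

Lemma dot_affine (x y : 'rV[R]_n.+1) t :
  dot (x + t *: y) (x + t *: y) = dot x x + (2 * t * dot x y + t ^+ 2 * dot y y).
Proof.
rewrite /dot !mulr_sumr -!big_split/=; apply: eq_bigr => i _.
by rewrite !mxE; ring.
Qed.

Lemma wL1_dot V W : measurable_fun hemi V -> measurable_fun hemi W ->
  (sqnormv alpha V < +oo)%E -> (sqnormv alpha W < +oo)%E ->
  L1 (fun z => dot (V z) (W z)).
Proof.
move=> mV mW Voo Woo; rewrite /dot.
elim: (index_enum _) => [|i r ih].
  under [X in wL1 _ _ _ X]eq_fun do rewrite big_nil.
  by have := wL2_L1 mhemi mrho rho0 S1_fin (wL2_cst mhemi mrho rho0 S1_fin 0).
under [X in wL1 _ _ _ X]eq_fun do rewrite big_cons.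
apply: wL1D => //; apply: (wL2M mhemi mrho rho0); exact: wL2_coord.
Qed.

Lemma sobolev_smooth u : smooth_hemisphere u -> (sqnorm alpha u < +oo)%E ->
  (sqnormv alpha (grad_sphere u) < +oo)%E -> sobolev alpha u (grad_sphere u).
Proof.
move=> su u2 gu2; split => //; [exact: measurable_smooth|exact: measurable_grad_sphere|].
exists (fun=> u); split => //.
  rewrite (_ : (fun _ : nat => _) = (fun=> 0%E)); first exact: cvg_cst.
  apply/funext => _; rewrite sqnormE.
  under eq_wI do rewrite subrr expr0n.
  by rewrite /wI; under eq_integral do rewrite mul0r; rewrite integral0.
rewrite (_ : (fun _ : nat => _) = (fun=> 0%E)); first exact: cvg_cst.
apply/funext => _; rewrite sqnormvE.
rewrite /wI integral0_eq// => z _.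
by rewrite /dot big1 ?mul0r// => i _; rewrite subrr mxE mul0r.
Qed.

(** These are the competitors of the variational argument; c serves to give them mean 0 and leaves
    the gradient unchanged. *)
Lemma sobolev_affine u v V t c : smooth_hemisphere u -> (sqnorm alpha u < +oo)%E ->
  (sqnormv alpha (grad_sphere u) < +oo)%E -> sobolev alpha v V ->
  sobolev alpha (fun z => u z + t * (v z - c)) (fun z => grad_sphere u z + t *: V z).
Proof.
move=> su u2 gu2 [mv mV v2 V2 [w [sw cw cW]]].
have mu := measurable_smooth su; have mgu := measurable_grad_sphere su.
have Lu : L2 u by []. have Lv : L2 v by [].
have t20 : 0 <= t ^+ 2 by exact: sqr_ge0.
have mGV : measurable_fun hemi (fun z => grad_sphere u z + t *: V z).
  apply: measurable_fun_rowP => // i.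
  have -> : (fun z => (grad_sphere u z + t *: V z) ord0 i) =
      (fun z => grad_sphere u z ord0 i + t * V z ord0 i).
    by apply/funext => z; rewrite mxE [X in _ + X]mxE.
  apply: measurable_funD; first exact: (measurableT_comp (measurable_coord i)).
  by apply: measurable_funM => //; exact: (measurableT_comp (measurable_coord i)).
have [muv uv2] : L2 (fun z => u z + t * (v z - c)).
  apply: (wL2D mhemi mrho rho0) => //; apply: (wL2Z mhemi mrho rho0).
  by apply: (wL2B mhemi mrho rho0) => //; exact: wL2_cst.
split => //.
- rewrite sqnormvE; under eq_wI do rewrite dot_affine.
  rewrite (wIE mhemi) ?ltry//; apply: (wL1D mhemi); first exact: wL1_dot.
  apply: (wL1D mhemi); apply: (wL1Z mhemi); exact: wL1_dot.
- exists (fun k z => u z + t * (w k z - c)); split.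
  + by move=> k; exact: smooth_hemisphere_affine.
  + rewrite (_ : (fun k => _) =
        (fun k => (t ^+ 2)%:E * sqnorm alpha (fun z => w k z - v z)%R)%E).
      by rewrite -(mule0 (t ^+ 2)%:E); apply: cvgeZl.
    apply/funext => k; rewrite !sqnormE -(ge0_wIZ _ mhemi mrho rho0)//.
    * by apply: eq_wI => z _; ring.
    * by apply: measurable_funX; apply: measurable_funB => //; exact: measurable_smooth.
    * by move=> z _; exact: sqr_ge0.
  + rewrite (_ : (fun k => _) =
        (fun k => (t ^+ 2)%:E * sqnormv alpha (fun z => grad_sphere (w k) z - V z)%R)%E).
      by rewrite -(mule0 (t ^+ 2)%:E); apply: cvgeZl.
    have mgV k : measurable_fun hemi (fun z => grad_sphere (w k) z - V z).
      have mgw := measurable_grad_sphere (sw k).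
      apply: measurable_fun_rowP => // i.
      have -> : (fun z => (grad_sphere (w k) z - V z) ord0 i) =
          (fun z => grad_sphere (w k) z ord0 i - V z ord0 i).
        by apply/funext => z; rewrite mxE [X in _ + X]mxE.
      by apply: measurable_funB; exact: (measurableT_comp (measurable_coord i)).
    apply/funext => k; rewrite !sqnormvE -(ge0_wIZ _ mhemi mrho rho0)//.
    * apply: eq_wI => z /set_mem hz; rewrite grad_sphere_affine//.
      rewrite /dot mulr_sumr; apply: eq_bigr => i _.
      by rewrite !mxE; ring.
    * exact: measurable_dot_comp.
    * by move=> z _; exact: dot_ge0.
Qed.

(* The quadratic form [sqnormv - mu sqnorm] is nonnegative on mean zero functions
   and vanishes at u, so its polar form vanishes on u. *)
Lemma minimizer_weak_equation u v V : smooth_hemisphere u ->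
  (sqnorm alpha u < +oo)%E -> wint alpha u = 0%E ->
  sqnormv alpha (grad_sphere u) = ((n%:R + alpha)%:E * sqnorm alpha u)%E ->
  sobolev alpha v V ->
  wint alpha (fun z => dot (grad_sphere u z) (V z)) =
  ((n%:R + alpha)%:E * wint alpha (fun z => u z * v z)%R)%E.
Proof.
move=> su u2 u0 guE sv; have [mv mV v2 V2 _] := sv.
have mu := measurable_smooth su; have mgu := measurable_grad_sphere su.
have Lu : L2 u by []. have Lv : L2 v by [].
have Lc c : L2 (fun=> c) := wL2_cst mhemi mrho rho0 S1_fin c.
have gu2 : (sqnormv alpha (grad_sphere u) < +oo)%E.
  by rewrite guE lte_mul_pinfty// wI_ge0// => z _; exact: sqr_ge0.
set m := n%:R + alpha.
(* Removing the mean of v makes u + t (v - c) admissible. The right-hand side of the equation does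
   not change, since u has mean 0. *)
pose c := E v / E (fun=> 1).
have Lvc : L2 (fun z => v z - c) by exact: wL2B.
have LU : L1 u by exact: wL2_L1.
have LV : L1 v by exact: wL2_L1.
have Eu : E u = 0 by rewrite /wE -wintE u0.
have LvcL := wL2_L1 mhemi mrho rho0 S1_fin Lvc.
have Evc : E (fun z => v z - c) = 0.
  rewrite (wEB mhemi)//; last exact: (wL2_L1 mhemi mrho rho0 S1_fin (Lc c)).
  have -> : E (fun=> c) = c * E (fun=> 1).
    rewrite -(wEZ mhemi c (wL2_L1 mhemi mrho rho0 S1_fin (Lc 1))).
    by congr wE; apply/funext => z; rewrite mulr1.
  by rewrite /c divfK ?subrr// gt_eqF// wE1_gt0.
have Luv := wL2M mhemi mrho rho0 Lu Lv.
have Luvc := wL2M mhemi mrho rho0 Lu Lvc.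
have EuvE : E (fun z => u z * (v z - c)) = E (fun z => u z * v z).
  have -> : (fun z => u z * (v z - c)) = (fun z => u z * v z - c * u z).
    by apply/funext => z; ring.
  by rewrite (wEB mhemi)// ?(wEZ mhemi)// ?Eu ?mulr0 ?subr0//; exact: wL1Z.
have LGV := wL1_dot mgu mV gu2 V2.
have LGG := wL1_dot mgu mgu gu2 gu2.
have LVV := wL1_dot mV mV V2 V2.
have Lu2 := wL2_sqr mrho rho0 Lu.
have Lvc2 := wL2_sqr mrho rho0 Lvc.
rewrite !wintE (wIE mhemi LGV) (wIE mhemi Luv) -EFinM; congr EFin.
set B := E _; rewrite -EuvE; set b := E _.
have GGE : E (fun z => dot (grad_sphere u z) (grad_sphere u z)) = m * E (fun z => u z ^+ 2).
  by move: guE; rewrite sqnormvE sqnormE (wIE mhemi LGG) (wIE mhemi Lu2) -EFinM => -[].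
pose K := E (fun z => dot (V z) (V z)) - m * E (fun z => (v z - c) ^+ 2).
have key t : 0 <= 2 * t * (B - m * b) + t ^+ 2 * K.
  have S0 := sobolev_affine t c su u2 gu2 sv.
  have L0 : L1 (fun z => u z + t * (v z - c)).
    by apply: (wL1D mhemi) => //; exact: wL1Z.
  have L2u : L1 (fun z => 2 * t * (u z * (v z - c)) + t ^+ 2 * (v z - c) ^+ 2).
    by apply: (wL1D mhemi); exact: wL1Z.
  have L2V : L1 (fun z => 2 * t * dot (grad_sphere u z) (V z) + t ^+ 2 * dot (V z) (V z)).
    by apply: (wL1D mhemi); exact: wL1Z.
  have mean0 : wint alpha (fun z => u z + t * (v z - c)) = 0%E.
    rewrite wintE (wIE mhemi L0) (wED mhemi)//; last exact: wL1Z.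
    by rewrite Eu (wEZ mhemi)// Evc mulr0 addr0.
  have := sobolev_poincare alpha1 mu_ge0 S0 mean0.
  rewrite sqnormE sqnormvE.
  have -> : (fun z => (u z + t * (v z - c)) ^+ 2) = (fun z => u z ^+ 2 +
      (2 * t * (u z * (v z - c)) + t ^+ 2 * (v z - c) ^+ 2)).
    by apply/funext => z; ring.
  under [in leRHS]eq_wI do rewrite dot_affine.
  rewrite (wIE mhemi); last exact: wL1D.
  rewrite (wIE mhemi); last exact: wL1D.
  rewrite -EFinM lee_fin !(wED mhemi) ?(wEZ mhemi)//; try exact: wL1Z.
  rewrite GGE -/B -/b -subr_ge0 => h; apply: le_trans h _.
  by rewrite le_eqVlt; apply/orP; left; apply/eqP; rewrite /K /m; ring.
apply/eqP; rewrite -subr_eq0; apply/eqP; set x := B - m * b in key *.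
(* The quadratic 2 t x + t^2 K is nonnegative for every t. With K replaced by its absolute value in
   the denominator, this t makes it a negative multiple of x^2 for either sign of K, so x = 0. *)
have := key (- x / (1 + `|K|)).
have K1 : 0 < 1 + `|K| by rewrite ltr_pwDl.
have -> : 2 * (- x / (1 + `|K|)) * x + (- x / (1 + `|K|)) ^+ 2 * K =
    - (x ^+ 2 * (2 * (1 + `|K|) - K)) / (1 + `|K|) ^+ 2.
  by field; rewrite gt_eqF.
rewrite mulNr oppr_ge0 pmulr_lle0 ?invr_gt0 ?exprn_gt0// pmulr_lle0; last first.
  by have := ler_norm K; have := normr_ge0 K; lra.
by move=> h; apply/eqP; rewrite -sqrf_eq0 eq_le h sqr_ge0.
Qed.

End weak_equation.

(** * The first coordinate *)

Section coordinate.
Context {R : realType} (n : nat).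
Implicit Types (f g : 'rV[R]_n -> R) (x : 'rV[R]_n).

Lemma near_enorm_gt0 x : 0 < enorm x -> \forall y \near x, 0 < enorm y.
Proof.
move=> x0; have := differentiable_continuous (differentiable_enorm x0).
by move=> /(_ _ (lt_nbhsr x0)); apply.
Qed.

Lemma is_derive_enormV x i : 0 < enorm x ->
  is_derive x (delta_mx ord0 i) (fun y : 'rV[R]_n => (enorm y)^-1) (- (x ord0 i * (enorm x)^-1 ^+ 3)).
Proof.
move=> x0; have x1 : enorm x != 0 by rewrite gt_eqF.
have dV : is_derive (enorm x) (1 : R) (fun r : R => r^-1) (- (enorm x) ^- 2 *: (1 : R)).
  by apply: is_deriveV => //; exact: is_derive_id.
apply: (is_derive_eq (is_derive_comp_real (is_derive_enorm (delta_mx ord0 i) x0) dV)).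
by rewrite dot_delta /GRing.scale/=; field.
Qed.

(** The extension x_k / |x| of a coordinate belongs to this class, and so, away from 0, do the
    partial derivatives of its members. One differentiation step therefore gives smoothness of all
    orders. *)
Inductive enorm_rational : ('rV[R]_n -> R) -> Prop :=
| enorm_rational_cst c : enorm_rational (fun=> c)
| enorm_rational_coord i : enorm_rational (fun x => x ord0 i)
| enorm_rational_enormV : enorm_rational (fun x => (enorm x)^-1)
| enorm_rationalD f g : enorm_rational f -> enorm_rational g ->
    enorm_rational (fun x => f x + g x)
| enorm_rationalM f g : enorm_rational f -> enorm_rational g ->
    enorm_rational (fun x => f x * g x).

Lemma enorm_rational_differentiable f x : enorm_rational f -> 0 < enorm x ->
  differentiable f x.
Proof.
move=> + x0; elim=> [c|i||{}f g _ df _ dg|{}f g _ df _ dg].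
- exact: differentiable_cst.
- exact: differentiable_coord.
- by apply: differentiableV; [exact: differentiable_enorm|rewrite gt_eqF].
- exact: differentiableD.
- exact: differentiableM.
Qed.

Lemma enorm_rational_derive f i : enorm_rational f -> exists2 g, enorm_rational g &
  forall x, 0 < enorm x -> is_derive x (delta_mx ord0 i) f (g x).
Proof.
elim=> [c|j||{}f g rf [f' rf' df] rg [g' rg' dg]|{}f g rf [f' rf' df] rg [g' rg' dg]].
- exists (fun=> 0); first exact: enorm_rational_cst.
  by move=> x _; exact: is_derive_cst.
- exists (fun=> (delta_mx ord0 i : 'rV[R]_n) ord0 j); first exact: enorm_rational_cst.
  by move=> x _; exact: is_derive_coord.
- exists (fun x => (-1) * (x ord0 i * ((enorm x)^-1 * ((enorm x)^-1 * (enorm x)^-1)))).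
    do ! [exact: enorm_rational_cst|exact: enorm_rational_coord
         |exact: enorm_rational_enormV|apply: enorm_rationalM].
  move=> x x0; apply: (is_derive_eq (is_derive_enormV i x0)).
  by rewrite mulN1r !exprS expr0 mulr1.
- exists (fun x => f' x + g' x); first exact: enorm_rationalD.
  by move=> x x0; exact: is_deriveD (df _ x0) (dg _ x0).
- exists (fun x => f x * g' x + g x * f' x).
    by apply: enorm_rationalD; exact: enorm_rationalM.
  by move=> x x0; exact: is_deriveM (df _ x0) (dg _ x0).
Qed.

Lemma enorm_rational_smooth f : enorm_rational f -> smooth_on [set x | 0 < enorm x] f.
Proof.
move=> rf s; suff [g rg fg] : exists2 g, enorm_rational g &
    forall x, 0 < enorm x -> iter_partial s f x = g x.
  move=> x x0; apply: (near_eq_differentiable _ (enorm_rational_differentiable rg x0)).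
  by near=> y; rewrite fg//; near: y; exact: near_enorm_gt0.
elim: s => [|i s [g rg fg]]; first by exists f.
have [h rh gh] := enorm_rational_derive i rg.
exists h => // x x0 /=; rewrite (@near_eq_derive _ _ _ _ g); first by have [] := gh x x0.
by near=> y; rewrite fg//; near: y; exact: near_enorm_gt0.
Unshelve. all: by end_near. Qed.

Lemma hext_coord (k : 'I_n) (c : R) :
  hext (fun z : 'rV[R]_n => c * z ord0 k) = (fun x => c * ((enorm x)^-1 * x ord0 k)).
Proof. by apply/funext => x; rewrite /hext mxE. Qed.

(** The factor c will be sin t, when the first coordinate is restricted to the slice of polar angle
    t. *)
Lemma is_derive_hext_coord (k i : 'I_n) c x : 0 < enorm x ->
  is_derive x (delta_mx ord0 i) (hext (fun z : 'rV[R]_n => c * z ord0 k))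
    (c * ((k == i)%:R * (enorm x)^-1 - x ord0 k * x ord0 i * (enorm x)^-1 ^+ 3)).
Proof.
move=> x0; rewrite hext_coord.
have := is_deriveM (is_derive_enormV i x0) (is_derive_coord x (delta_mx ord0 i) k).
move=> d; apply: (is_derive_eq (is_deriveM (is_derive_cst c x _) d)).
by rewrite mxE eqxx /= /GRing.scale/=; ring.
Qed.

Lemma grad_sphere_coord (k i : 'I_n) z : enorm z = 1 ->
  grad_sphere (fun z : 'rV[R]_n => z ord0 k) z ord0 i = (k == i)%:R - z ord0 k * z ord0 i.
Proof.
move=> z1; have z0 : 0 < enorm z by rewrite z1.
have -> : (fun z : 'rV[R]_n => z ord0 k) = (fun z => 1 * z ord0 k).
  by apply/funext => y; rewrite mul1r.
rewrite mxE; have [_ ->] := is_derive_hext_coord k i 1 z0.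
by rewrite z1 invr1; ring.
Qed.

Lemma grad_sphere_coord_sqr (k : 'I_n) z : enorm z = 1 ->
  let G := grad_sphere (fun z : 'rV[R]_n => z ord0 k) z in
  dot G G = 1 - z ord0 k ^+ 2.
Proof.
move=> z1 /=; rewrite /dot.
transitivity (\sum_i ((k == i)%:R * (1 - 2 * z ord0 k * z ord0 i) +
    z ord0 k ^+ 2 * (z ord0 i * z ord0 i))).
  apply: eq_bigr => i _; rewrite grad_sphere_coord//.
  by case: eqP => _ /=; ring.
rewrite big_split/= -mulr_sumr -/(dot z z) -enorm_sqr z1 expr1n mulr1.
rewrite (bigD1 k)//= eqxx big1; first by rewrite /=; ring.
by move=> i; rewrite eq_sym => /negbTE ->; rewrite mul0r.
Qed.

(** Coordinates are the spherical harmonics of degree 1, with eigenvalue n - 1 on the unit sphere of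
    R^n. *)
Lemma laplacian_sphere_coord (k : 'I_n) c z : enorm z = 1 ->
  laplacian_sphere (fun z : 'rV[R]_n => c * z ord0 k) z = c * (1 - n%:R) * z ord0 k.
Proof.
move=> z1; have z0 : 0 < enorm z by rewrite z1.
rewrite /laplacian_sphere.
transitivity (\sum_i ((k == i)%:R * (- 2 * c * z ord0 i) +
    (3 * c * z ord0 k * (z ord0 i * z ord0 i) - c * z ord0 k))).
  apply: eq_bigr => i _.
  pose g (x : 'rV[R]_n) := c * ((k == i)%:R * (enorm x)^-1 -
    x ord0 k * x ord0 i * (enorm x)^-1 ^+ 3).
  rewrite (@near_eq_derive _ _ _ _ g); last first.
    near=> y; have [|_ ->//] := @is_derive_hext_coord k i c y.
    by near: y; exact: near_enorm_gt0.
  have dV := is_derive_enormV i z0.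
  have dk := is_derive_coord z (delta_mx ord0 i) k.
  have di := is_derive_coord z (delta_mx ord0 i) i.
  have := is_deriveB (is_deriveM (is_derive_cst ((k == i)%:R : R) z _) dV)
    (is_deriveM (is_deriveM dk di) (is_deriveX 3 dV)).
  move=> d; have dg : is_derive z (delta_mx ord0 i) g _ := is_deriveM (is_derive_cst c z _) d.
  have [_ ->] := dg.
  have VE : ((fun y : 'rV[R]_n => (enorm y)^-1) ^+ 3) z = 1.
    by rewrite -[LHS]/((enorm z)^-1 ^+ 3) z1 invr1 expr1n.
  rewrite VE z1 invr1 !mxE !eqxx /GRing.scale/= !mulr0.
  rewrite (_ : ((fun y : 'rV[R]_n => y ord0 k) * (fun y => y ord0 i)) z =
    z ord0 k * z ord0 i)//.
  by case: eqP => [->|_] /=; ring.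
rewrite !big_split/= -!mulr_sumr -/(dot z z) -enorm_sqr z1 expr1n mulr1.
rewrite sumr_const card_ord (bigD1 k)//= eqxx big1; first by rewrite -mulr_natl /=; ring.
by move=> i; rewrite eq_sym => /negbTE ->; rewrite mul0r.
Unshelve. all: by end_near. Qed.

End coordinate.

(** * The first coordinate is an eigenfunction and minimizes the Rayleigh quotient *)

Section eigenfunction.
Context {R : realType} (n : nat) (alpha : R).
Hypothesis alpha1 : -1 < alpha.
Let hemi := @hemisphere R n.+1.
Let rho (z : 'rV[R]_n.+2) := z ord0 ord_max `^ alpha.
Notation S := (wI (@surface_measure R n.+2) (@hemisphere R n.+1)
  (fun z : 'rV[R]_n.+2 => z ord0 ord_max `^ alpha)).
Notation L1 := (wL1 (@surface_measure R n.+2) (@hemisphere R n.+1)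
  (fun z : 'rV[R]_n.+2 => z ord0 ord_max `^ alpha)).
Notation L2 := (wL2 (@surface_measure R n.+2) (@hemisphere R n.+1)
  (fun z : 'rV[R]_n.+2 => z ord0 ord_max `^ alpha)).
Notation E := (wE (@surface_measure R n.+2) (@hemisphere R n.+1)
  (fun z : 'rV[R]_n.+2 => z ord0 ord_max `^ alpha)).
Notation W := (wI (lebesgue_row n.+2) setT (@gweight R alpha n.+1)).
Let u (z : 'rV[R]_n.+2) := z ord0 ord0.
Let mu : R := n.+1%:R + alpha.

Let mu_gt0 : 0 < mu.
Proof.
have : (1 : R) <= n.+1%:R by rewrite ler1n.
by rewrite /mu; have := alpha1; lra.
Qed.

Let mhemi : measurable hemi. Proof. exact: measurable_hemisphere. Qed.
Let mrho : measurable_fun hemi rho. Proof. exact: measurable_rho. Qed.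
Let rho0 z : hemi z -> 0 <= rho z. Proof. exact: rho_ge0. Qed.
Let S1_fin : (S (fun=> 1%R) < +oo)%E.
Proof. by have /andP[] := surface_mass_gt0_fin n.+1 alpha1. Qed.
Let S1_gt0 : (0 < S (fun=> 1%R))%E.
Proof. by have /andP[] := surface_mass_gt0_fin n.+1 alpha1. Qed.

Lemma coord_smooth : smooth_hemisphere u.
Proof.
move=> s x xU; apply: enorm_rational_smooth; last exact: halfspace_enorm.
have -> : u = (fun z => 1 * z ord0 ord0) by apply/funext => z; rewrite mul1r.
rewrite hext_coord.
apply: enorm_rationalM; first exact: enorm_rational_cst.
by apply: enorm_rationalM; [exact: enorm_rational_enormV|exact: enorm_rational_coord].
Qed.

Let measurable_u : measurable_fun hemi u. Proof. exact: measurable_smooth coord_smooth. Qed.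

Lemma coord_proj (x : 'rV[R]_n.+2) : halfspace x -> x ord0 ord0 = enorm x * u (sphere_proj x).
Proof.
by move=> xU; rewrite /u mxE mulrA mulfV ?mul1r// gt_eqF//; exact: halfspace_enorm.
Qed.

Let coord_sqr_le1 z : hemi z -> u z ^+ 2 <= 1.
Proof.
move=> [z1 _]; have := coord_le_enorm z ord0; rewrite z1 -/(u z) => h.
by rewrite -(expr1n _ 2) -real_normK ?num_real// lerXn2r ?nnegrE.
Qed.

Let sqnorm_coord_fin : (sqnorm alpha u < +oo)%E.
Proof.
apply: le_lt_trans S1_fin; rewrite sqnormE; apply: (le_wI _ mhemi mrho rho0).
- exact: measurable_funX.
- exact: measurable_cst.
- by move=> z hz; rewrite sqr_ge0 coord_sqr_le1.
Qed.

Let Lu : L2 u. Proof. by []. Qed.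
Let L1c := wL2_L1 mhemi mrho rho0 S1_fin (wL2_cst mhemi mrho rho0 S1_fin 1).
Let Lu2 := wL2_sqr mrho rho0 Lu.

(** The first coordinate is a standard Gaussian variable, so x_1^2 and 1 have the same weighted
    integral. In polar form these are (mu + 1) c0 E u^2 and c0 E 1. *)
Lemma sqr_coord_mean : (mu + 1) * E (fun z => u z ^+ 2) = E (fun=> 1).
Proof.
have [c0 [c1 [c0_gt0 _ cP]]] := gauss_sphere_constants n.+1 alpha1.
have m1 : measurable_fun hemi (fun=> 1 : R) := @measurable_cst _ _ _ _ _ _.
have m2 : measurable_fun hemi (fun z => u z ^+ 2) by exact: measurable_funX.
have mW : measurable_fun setT (fun x : 'rV[R]_n.+2 => x ord0 ord0 ^+ 2).
  by apply: measurable_funX; exact: measurable_coord.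
have mW1 : measurable_fun [set: 'rV[R]_n.+2] (fun=> 1 : R) := @measurable_cst _ _ _ _ _ _.
have [_ _ E2] := cP _ _ mW (fun x => sqr_ge0 _) m2 (fun z _ => sqr_ge0 _).
have [E0 _ _] := cP _ _ mW1 (fun x => ler01) m1 (fun z _ => ler01).
have := gauss_wI_coord2 alpha1 n.
rewrite E0// E2; last by move=> x xU; rewrite {1}coord_proj// exprMn.
rewrite (wIE mhemi Lu2) (wIE mhemi L1c) -!EFinM => -[h].
have c00 : c0 != 0 by rewrite gt_eqF.
by apply: (mulfI c00); rewrite -h /mu; ring.
Qed.

Lemma wint_coord : wint alpha u = 0%E.
Proof.
have LuI := wL2_L1 mhemi mrho rho0 S1_fin Lu.
rewrite wintE (wIE mhemi LuI) (wE_maxB mhemi mrho rho0 S1_fin Lu).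
have max0 (t : R) : 0 <= Num.max t 0 by rewrite le_max lexx orbT.
have [c0 [c1 [_ c1_gt0 cP]]] := gauss_sphere_constants n.+1 alpha1.
have mx : measurable_fun setT (fun x : 'rV[R]_n.+2 => x ord0 ord0) by exact: measurable_coord.
have mNx : measurable_fun setT (fun x : 'rV[R]_n.+2 => - x ord0 ord0).
  exact: measurableT_comp.
have mNu : measurable_fun hemi (fun z => - u z) by exact: measurableT_comp.
have m1 : measurable_fun setT (fun x : 'rV[R]_n.+2 => Num.max (x ord0 ord0) 0).
  exact: measurable_maxr.
have m2 : measurable_fun setT (fun x : 'rV[R]_n.+2 => Num.max (- x ord0 ord0) 0).
  exact: measurable_maxr.
have m3 : measurable_fun hemi (fun z => Num.max (u z) 0) by exact: measurable_maxr.
have m4 : measurable_fun hemi (fun z => Num.max (- u z) 0) by exact: measurable_maxr.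
have [_ Ep _] := cP _ _ m1 (fun x => max0 _) m3 (fun z _ => max0 _).
have [_ En _] := cP _ _ m2 (fun x => max0 _) m4 (fun z _ => max0 _).
have LN : L2 (fun z => - u z).
  by under [X in wL2 _ _ _ X]eq_fun do rewrite -mulN1r; exact: wL2Z.
have Lp := wL2_L1 mhemi mrho rho0 S1_fin (wL2_max mhemi mrho rho0 Lu).
have Ln := wL2_L1 mhemi mrho rho0 S1_fin (wL2_max mhemi mrho rho0 LN).
have := gauss_wI_odd alpha1 n; rewrite Ep ?En; last 2 first.
- move=> x xU; rewrite {1}coord_proj// -mulrN -[X in Num.max _ X](mulr0 (enorm x)).
  by rewrite maxr_pMr ?enorm_ge0.
- move=> x xU; rewrite {1}coord_proj// -[X in Num.max _ X](mulr0 (enorm x)).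
  by rewrite maxr_pMr ?enorm_ge0.
rewrite (wIE mhemi Lp) (wIE mhemi Ln) -!EFinM => -[h].
have c10 : c1 != 0 by rewrite gt_eqF.
by rewrite (mulfI c10 h) subrr.
Qed.

(** On the sphere |grad u|^2 = 1 - u^2, and 1 integrates to mu + 1 times the integral of u^2. *)
Lemma sqnormv_grad_coord :
  sqnormv alpha (grad_sphere u) = (mu%:E * sqnorm alpha u)%E.
Proof.
rewrite sqnormvE sqnormE; transitivity (S (fun z => 1 - u z ^+ 2)).
  by apply: eq_wI => z /set_mem[z1 _]; rewrite /= grad_sphere_coord_sqr.
rewrite (wIE mhemi); last exact: wL1B.
by rewrite (wIE mhemi Lu2) -EFinM (wEB mhemi)// -sqr_coord_mean; congr EFin; ring.
Qed.

Lemma sqnorm_coord_neq0 : sqnorm alpha u <> 0%E.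
Proof.
rewrite sqnormE (wIE mhemi Lu2) => -[h]; have := sqr_coord_mean; rewrite h mulr0.
by apply/eqP; rewrite lt_eqF// (wE1_gt0 S1_fin S1_gt0).
Qed.

Lemma polar0 (t : R) (w : 'rV[R]_n.+1) : u (polar t w) = sin t * w ord0 ord0.
Proof.
rewrite /u /polar mxE; have -> : ord0 = lift ord_max (ord0 : 'I_n.+1) by exact/val_inj.
by rewrite liftK.
Qed.

Lemma weighted_laplacian_coord (t : R) (w : 'rV[R]_n.+1) : 0 < t < pi / 2 ->
  enorm w = 1 -> - weighted_laplacian alpha u t w = mu * cos t `^ alpha * u (polar t w).
Proof.
move=> /andP[t0 t2] w1.
have s0 : 0 < sin t.
  by apply: sin_gt0_pi; rewrite t0/=; apply: lt_trans t2 _; have := @pi_gt0 R; lra.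
have c0 : 0 < cos t.
  by apply: cos_gt0_pihalf; rewrite t2 andbT; apply: lt_trans t0; have := @pi_gt0 R; lra.
rewrite /weighted_laplacian polar0.
under [X in laplacian_sphere X]eq_fun do rewrite polar0.
rewrite laplacian_sphere_coord//=.
have E1 s : derive1 (fun r => u (polar r w)) s = cos s * w ord0 ord0.
  under eq_fun do rewrite polar0.
  rewrite derive1E; have ds := is_derive_sin s.
  have [_ ->] := is_deriveM ds (is_derive_cst (w ord0 ord0) s 1).
  by rewrite /GRing.scale/= mulr0 add0r mulrC.
under [X in derive1 X]eq_fun do rewrite E1.
have dp := is_derive1_comp (is_derive1_powR alpha c0) (is_derive_cos t).
have ds : is_derive t 1 (fun s => sin s ^+ n) (n%:R * sin t ^+ n.-1 * cos t).
  by have := is_deriveX n (is_derive_sin t); rewrite exprfctE.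
have dc := is_deriveM (is_derive_cos t) (is_derive_cst (w ord0 ord0) t 1).
pose F s := sin s ^+ n * cos s `^ alpha * (cos s * w ord0 ord0).
have dF : is_derive t 1 F _ := is_deriveM (is_deriveM ds dp) dc.
rewrite -/F derive1E; have [_ ->] := dF.
rewrite /GRing.scale/= ![(_ * _) t]/GRing.mul/=.
have -> : cos t `^ (alpha - 1) = cos t `^ alpha / cos t.
  rewrite powRD; last by rewrite (gt_eqF c0) implybT.
  by rewrite powR_inv1// ltW.
(* At n = 0 the exponent n.-1 is truncated, but both sides carry the factor n. *)
have -> : n%:R * sin t ^+ n.-1 = n%:R * sin t ^+ n / sin t.
  case: (n) => [|m]; first by rewrite !mul0r.
  by rewrite exprSr mulrA mulfK// gt_eqF.
have P0 : sin t ^+ n != 0 by rewrite expf_neq0// gt_eqF.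
have := cos2Dsin2 t; move: P0.
set P := sin t ^+ n; set a := cos t `^ alpha; set x := w ord0 ord0 => P0 cs.
have s1 : sin t != 0 by rewrite gt_eqF.
have c1 : cos t != 0 by rewrite gt_eqF.
(* The subtracted term is 0 because cos^2 + sin^2 = 1; it supplies the multiple of this identity
   that [field] cannot find. *)
transitivity (mu * a * (sin t * x) - n%:R * a * x * (cos t ^+ 2 + sin t ^+ 2 - 1) / sin t); last first.
  by rewrite cs subrr mulr0 mul0r subr0.
rewrite /mu -[n.+1]addn1 natrD; field.
by rewrite s1 c1 P0.
Qed.

Lemma coord_sobolev : sobolev alpha u (grad_sphere u).
Proof.
apply: sobolev_smooth => //; first exact: coord_smooth.
by rewrite sqnormv_grad_coord lte_mul_pinfty ?wI_ge0 ?lee_fin ?(ltW mu_gt0)// => z _; exact: sqr_ge0.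
Qed.

Lemma coord_neumann_eigenfunction : neumann_eigenfunction alpha mu u.
Proof.
split.
- exact: coord_smooth.
- exact: coord_sobolev.
- by split; [exact: sqnorm_coord_neq0|exact: wint_coord].
- exact: weighted_laplacian_coord.
- move=> v V; apply: minimizer_weak_equation => //.
  + exact: (ltW mu_gt0).
  + exact: coord_smooth.
  + exact: wint_coord.
  + exact: sqnormv_grad_coord.
Qed.

Lemma rayleigh_ge r : rayleigh_quotients n.+1 alpha r -> mu <= r.
Proof.
move=> [v [V [sv [v0 vm] ->]]].
have := sobolev_poincare alpha1 (ltW mu_gt0) sv vm.
have [_ _ v2 V2 _] := sv.
have s0 : (0 <= sqnorm alpha v)%E by apply: (wI_ge0 _ rho0) => z _; exact: sqr_ge0.
have f1 : sqnorm alpha v \is a fin_num by rewrite ge0_fin_numE.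
have f2 : sqnormv alpha V \is a fin_num.
  by rewrite ge0_fin_numE// sqnormvE; apply: (wI_ge0 _ rho0) => z _; exact: dot_ge0.
rewrite -{1}(fineK f1) -{1}(fineK f2) -EFinM lee_fin => h.
rewrite ler_pdivlMr// fine_gt0// v2 andbT lt_neqAle s0 andbT eq_sym.
by apply/eqP.
Qed.

(** The weak equation is tested with the eigenfunction itself. Every eigenvalue is thus a Rayleigh
    quotient, and the lower bound on quotients applies to it. *)
Lemma neumann_eigenvalue_rayleigh m (v : 'rV[R]_n.+2 -> R) : neumann_eigenfunction alpha m v ->
  m = fine (sqnormv alpha (grad_sphere v)) / fine (sqnorm alpha v).
Proof.
move=> [_ sv [v0 _] _ /(_ _ _ sv)].
have [_ _ v2 V2 _] := sv.
have s0 : (0 <= sqnorm alpha v)%E by apply: (wI_ge0 _ rho0) => z _; exact: sqr_ge0.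
have f1 : sqnorm alpha v \is a fin_num by rewrite ge0_fin_numE.
rewrite /sqnormv => ->.
rewrite -[wint _ (fun z => v z * v z)]/(sqnorm alpha v) fineM//= mulfK//.
by rewrite fine_eq0//; apply/eqP.
Qed.

End eigenfunction.

Theorem theorem3p1 (R : realType) (N : nat) (alpha : R)
    (hN : (2 <= N)%N) (halpha : -1 < alpha) :
  is_mu1 N.-1 alpha (N%:R + alpha - 1) /\
  is_min (rayleigh_quotients N.-1 alpha) (N%:R + alpha - 1).
Proof.
case: N hN => [|[|n]]// _ /=.
have -> : n.+2%:R + alpha - 1 = n.+1%:R + alpha by rewrite -[n.+2]addn1 natrD; ring.
have eu := coord_neumann_eigenfunction n halpha.
split; split.
- by exists (fun z => z ord0 ord0).
- move=> m [v ev]; apply: rayleigh_ge => //; have [_ sv v0 _ _] := ev.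
  by exists v, (grad_sphere v); split => //; exact: neumann_eigenvalue_rayleigh ev.
- exists (fun z => z ord0 ord0), (grad_sphere (fun z => z ord0 ord0)).
  by have [_ sv v0 _ _] := eu; split => //; exact: neumann_eigenvalue_rayleigh eu.
- by move=> r /rayleigh_ge; exact.
Qed.
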